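(* Let $(M,g,P)$ be a 4-dimensional paraHermitian manifold whose Ricci tensor $\rho$ (of the Levi-Civita connection of $g$) is $P$-anti-invariant, that is, $\rho(PX,PY)=-\rho(X,Y)$ for all $X,Y$. Then $d\theta$ is an anti-self-dual 2-form, $d\theta^+=0$. In particular, on a paraHermitian Einstein 4-manifold the fundamental 2-form $F$ is an eigenform of the positive Weyl tensor $W^+$.
   Context: A paraHermitian 4-manifold $(M,g,P)$ is a smooth 4-manifold with a $(1,1)$-tensor $P$ satisfying $P^2=\mathrm{id}$, whose $\pm1$-eigenbundles both have rank 2, and a pseudo-Riemannian metric $g$ (necessarily of signature $(2,2)$) with $g(PX,Y)+g(X,PY)=0$, such that $P$ is integrable: $[PX,PY]+[X,Y]-P[PX,Y]-P[X,PY]=0$. The fundamental 2-form is $F(X,Y)=g(X,PY)$. In dimension 4 the Lee form $\theta$ is the unique 1-form with $dF=\theta\wedge F$. $M$ is oriented so that $F$ is self-dual; $\alpha^+$ denotes the self-dual part of a 2-form $\alpha$ with respect to the Hodge operator. The positive Weyl tensor $W^+$ is the self-dual part of the Weyl tensor, viewed as an endomorphism of the bundle $\Lambda^+M$ of self-dual 2-forms. *)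

(* Defs.v *)
From HB Require Import structures.
From mathcomp Require Import all_boot all_order all_algebra.
From mathcomp Require Import all_classical all_reals all_analysis.

Set Implicit Arguments.
Unset Strict Implicit.
Unset Printing Implicit Defensive.

Import Order.TTheory GRing.Theory Num.Theory.
Import numFieldNormedType.Exports.

Local Open Scope classical_set_scope.
Local Open Scope ring_scope.

(* Tangent vectors in a chart are row vectors.  Accordingly, an endomorphism
   with matrix A acts by v |-> v *m A, and the Jacobian 'J f x of a map f acts
   by v |-> v *m 'J f x.  A bilinear form has matrix (b (e_i, e_j))_ij and a
   2-form is represented by the matrix of its values on the basis, with no
   normalising factor. *)

Section Coordinates.
Variables (R : realType) (n : nat).
Implicit Types (U : set 'rV[R]_n) (f : 'rV[R]_n -> R).
Implicit Types (X Y Z : 'rV[R]_n -> 'rV[R]_n) (G : 'rV[R]_n -> 'M[R]_n).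

Definition basisv (i : 'I_n) : 'rV[R]_n := delta_mx 0 i.

Definition partial (i : 'I_n) f : 'rV[R]_n -> R := fun x => 'D_(basisv i) f x.

Definition partials (s : seq 'I_n) f : 'rV[R]_n -> R := foldr partial f s.

(* C^infinity on an open set: the partial derivatives of all orders exist and
   are differentiable, hence continuous. *)
Definition smooth_on U f :=
  forall (s : seq 'I_n) (x : 'rV[R]_n), U x -> differentiable (partials s f) x.

Definition smooth_mx_on U (p q : nat) (A : 'rV[R]_n -> 'M[R]_(p, q)) :=
  forall i j, smooth_on U (fun x => A x i j).

Definition bil (A : 'M[R]_n) (u v : 'rV[R]_n) : R := (u *m A *m v^T) 0 0.

Definition lie_bracket X Y : 'rV[R]_n -> 'rV[R]_n := fun x =>
  \row_k \sum_(i < n) (X x 0 i * partial i (fun y => Y y 0 k) x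
                     - Y x 0 i * partial i (fun y => X y 0 k) x).

(* Gamma^k_ij of the Levi-Civita connection of G. *)
Definition christoffel G (k i j : 'I_n) : 'rV[R]_n -> R := fun x =>
  2^-1 * \sum_(l < n) invmx (G x) k l *
    (partial i (fun y => G y j l) x + partial j (fun y => G y i l) x
     - partial l (fun y => G y i j) x).

(* nabla_X Y *)
Definition nabla G X Y : 'rV[R]_n -> 'rV[R]_n := fun x =>
  \row_k (\sum_(i < n) X x 0 i * partial i (fun y => Y y 0 k) x
          + \sum_(i < n) \sum_(j < n) christoffel G k i j x * X x 0 i * Y x 0 j).

(* R(X, Y) Z = nabla_X nabla_Y Z - nabla_Y nabla_X Z - nabla_[X, Y] Z *)
Definition curvature G X Y Z : 'rV[R]_n -> 'rV[R]_n := fun x =>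
  nabla G X (nabla G Y Z) x - nabla G Y (nabla G X Z) x
  - nabla G (lie_bracket X Y) Z x.

Definition coordinate_field (i : 'I_n) : 'rV[R]_n -> 'rV[R]_n :=
  fun=> basisv i.

(* G (R(e_i, e_j) e_k, e_l) *)
Definition riemann G (x : 'rV[R]_n) (i j k l : 'I_n) : R :=
  bil (G x) (curvature G (coordinate_field i) (coordinate_field j)
                         (coordinate_field k) x) (basisv l).

(* rho (Y, Z) = trace of X |-> R(X, Y) Z *)
Definition ricci G (x : 'rV[R]_n) : 'M[R]_n :=
  \matrix_(j, k) \sum_(i < n)
    curvature G (coordinate_field i) (coordinate_field j)
                (coordinate_field k) x 0 i.

Definition scalar_curvature G (x : 'rV[R]_n) : R :=
  \sum_(i < n) \sum_(j < n) invmx (G x) i j * ricci G x i j.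

(* theta is the column of the values theta (e_i) *)
Definition d_one_form (theta : 'rV[R]_n -> 'cV[R]_n) (x : 'rV[R]_n) : 'M[R]_n :=
  \matrix_(i, j) (partial i (fun y => theta y j 0) x
                - partial j (fun y => theta y i 0) x).

Definition d_two_form (A : 'rV[R]_n -> 'M[R]_n) (x : 'rV[R]_n)
    (i j k : 'I_n) : R :=
  partial i (fun y => A y j k) x + partial j (fun y => A y k i) x
  + partial k (fun y => A y i j) x.

Definition wedge12 (t : 'cV[R]_n) (A : 'M[R]_n) (i j k : 'I_n) : R :=
  t i 0 * A j k + t j 0 * A k i + t k 0 * A i j.

(* alpha^{kl} = g^{ka} g^{lb} alpha_{ab} *)
Definition raise2 (g A : 'M[R]_n) : 'M[R]_n := invmx g *m A *m (invmx g)^T.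

End Coordinates.

Section DimensionFour.
Variable R : realType.
Implicit Types (g A : 'M[R]_4) (o : R) (G : 'rV[R]_4 -> 'M[R]_4).

Definition levi_civita_symbol (a b c d : 'I_4) : R :=
  \det (\matrix_(r < 4, s < 4) (tnth [tuple a; b; c; d] r == s)%:R).

(* The volume form of g, where o = 1 or -1 according to whether the coordinate
   basis is positively oriented or not. *)
Definition volume g o (a b c d : 'I_4) : R :=
  o * Num.sqrt `|\det g| * levi_civita_symbol a b c d.

(* Normalised by alpha /\ *beta = <alpha, beta> vol. *)
Definition hodge g o A : 'M[R]_4 :=
  \matrix_(c, d) (2^-1 * \sum_(a < 4) \sum_(b < 4)
                    raise2 g A a b * volume g o a b c d).

(* hodge is an involution on 2-forms in signature (2, 2), so this is the
   projection onto its +1-eigenspace. *)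
Definition self_dual_part g o A : 'M[R]_4 := 2^-1 *: (A + hodge g o A).

(* The trace-free part of riemann in dimension 4. *)
Definition weyl G (x : 'rV[R]_4) (i j k l : 'I_4) : R :=
  let g := G x in let rho := ricci G x in
  riemann G x i j k l
  - 2^-1 * (rho j k * g i l + g j k * rho i l - rho i k * g j l - g i k * rho j l)
  + scalar_curvature G x / 6 * (g j k * g i l - g i k * g j l).

(* The order l, k makes the curvature operator of a metric of constant
   curvature c equal to c times the identity. *)
Definition weyl_operator G (x : 'rV[R]_4) A : 'M[R]_4 :=
  \matrix_(i, j) (2^-1 * \sum_(k < 4) \sum_(l < 4)
                    weyl G x i j k l * raise2 (G x) A l k).

Definition weyl_plus G (x : 'rV[R]_4) o A : 'M[R]_4 :=
  self_dual_part (G x) o (weyl_operator G x (self_dual_part (G x) o A)).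

End DimensionFour.

Record smooth_manifold (R : realType) (n : nat) := SmoothManifold {
  carrier :> topologicalType;
  carrier_hausdorff : hausdorff_space carrier;
  carrier_second_countable : @second_countable carrier;
  chart_index : Type;
  chart_dom : chart_index -> set carrier;
  chart : chart_index -> carrier -> 'rV[R]_n;
  chart_inv : chart_index -> 'rV[R]_n -> carrier;
  chart_dom_open : forall i, open (chart_dom i);
  chart_dom_cover : forall p, exists i, chart_dom i p;
  chart_img_open : forall i, open (chart i @` chart_dom i);
  chartK : forall i p, chart_dom i p -> chart_inv i (chart i p) = p;
  chart_continuous : forall i p, chart_dom i p -> {for p, continuous (chart i)};
  chart_inv_continuous : forall i x, (chart i @` chart_dom i) x ->
    {for x, continuous (chart_inv i)};
  transition_smooth : forall i j,
    smooth_mx_on (chart i @` (chart_dom i `&` chart_dom j))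
                 (fun x => chart j (chart_inv i x))
}.

Section Tensors.
Variables (R : realType) (n : nat) (M : smooth_manifold R n).

Definition chart_img (i : chart_index M) : set 'rV[R]_n :=
  chart i @` chart_dom i.

Definition overlap (i j : chart_index M) : set 'rV[R]_n :=
  chart i @` (chart_dom i `&` chart_dom j).

Definition transition (i j : chart_index M) : 'rV[R]_n -> 'rV[R]_n :=
  fun x => chart j (chart_inv i x).

Record one_form := OneForm {
  one_form_comp :> chart_index M -> 'rV[R]_n -> 'cV[R]_n;
  one_form_smooth : forall i, smooth_mx_on (chart_img i) (one_form_comp i);
  one_form_change : forall i j x, overlap i j x ->
    one_form_comp i x =
    'J (transition i j) x *m one_form_comp j (transition i j x)
}.

Record tensor02 := Tensor02 {
  tensor02_comp :> chart_index M -> 'rV[R]_n -> 'M[R]_n;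
  tensor02_smooth : forall i, smooth_mx_on (chart_img i) (tensor02_comp i);
  tensor02_change : forall i j x, overlap i j x ->
    tensor02_comp i x =
    'J (transition i j) x *m tensor02_comp j (transition i j x)
      *m ('J (transition i j) x)^T
}.

Record tensor11 := Tensor11 {
  tensor11_comp :> chart_index M -> 'rV[R]_n -> 'M[R]_n;
  tensor11_smooth : forall i, smooth_mx_on (chart_img i) (tensor11_comp i);
  tensor11_change : forall i j x, overlap i j x ->
    tensor11_comp i x *m 'J (transition i j) x =
    'J (transition i j) x *m tensor11_comp j (transition i j x)
}.

(* The sign is 1 where the coordinate basis is positively oriented, and -1
   where it is negatively oriented. *)
Record orientation := Orientation {
  orientation_sign :> chart_index M -> 'rV[R]_n -> R;
  orientation_unit : forall i x, chart_img i x ->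
    orientation_sign i x = 1 \/ orientation_sign i x = -1;
  orientation_continuous : forall i x, chart_img i x ->
    {for x, continuous (orientation_sign i)};
  orientation_change : forall i j x, overlap i j x ->
    orientation_sign i x =
    Num.sg (\det ('J (transition i j) x)) * orientation_sign j (transition i j x)
}.

End Tensors.

Record paraHermitian (R : realType) (M : smooth_manifold R 4) := ParaHermitian {
  metric : tensor02 M;
  para : tensor11 M;
  metric_sym : forall i x, chart_img i x -> (metric i x)^T = metric i x;
  metric_nondegenerate : forall i x, chart_img i x -> metric i x \in unitmx;
  para_invol : forall i x, chart_img i x -> para i x *m para i x = 1%:M;
  para_rank_pos : forall i x, chart_img i x ->
    \rank (eigenspace (para i x) 1) = 2%N;
  para_rank_neg : forall i x, chart_img i x ->
    \rank (eigenspace (para i x) (-1)) = 2%N;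
  para_compatible : forall i x (u v : 'rV[R]_4), chart_img i x ->
    bil (metric i x) (u *m para i x) v + bil (metric i x) u (v *m para i x) = 0;
  para_integrable : forall i (X Y : 'rV[R]_4 -> 'rV[R]_4),
    smooth_mx_on (chart_img i) X -> smooth_mx_on (chart_img i) Y ->
    forall x, chart_img i x ->
    let P := para i in
    let PX := fun y => X y *m P y in
    let PY := fun y => Y y *m P y in
    lie_bracket PX PY x + lie_bracket X Y x
    - lie_bracket PX Y x *m P x - lie_bracket X PY x *m P x = 0
}.

Section ParaHermitianGeometry.
Variables (R : realType) (M : smooth_manifold R 4) (H : paraHermitian M).
Local Notation g := (metric H).
Local Notation P := (para H).

(* F (X, Y) = g (X, PY) *)
Definition fundamental_form (i : chart_index M) (x : 'rV[R]_4) : 'M[R]_4 :=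
  \matrix_(a, b) bil (g i x) (basisv R a) (basisv R b *m P i x).

Definition is_lee_form (theta : one_form M) :=
  forall i x, chart_img i x -> forall a b c : 'I_4,
    d_two_form (fundamental_form i) x a b c =
    wedge12 (theta i x) (fundamental_form i x) a b c.

Definition ricci_anti_invariant :=
  forall i x, chart_img i x -> forall u v : 'rV[R]_4,
    bil (ricci (g i) x) (u *m P i x) (v *m P i x) = - bil (ricci (g i) x) u v.

Definition einstein :=
  exists c : R, forall i x, chart_img i x -> ricci (g i) x = c *: g i x.

Definition fundamental_form_self_dual (o : orientation M) :=
  forall i x, chart_img i x ->
    hodge (g i x) (o i x) (fundamental_form i x) = fundamental_form i x.

Definition d_self_dual_part_zero (o : orientation M) (theta : one_form M) :=
  forall i x, chart_img i x ->
    self_dual_part (g i x) (o i x) (d_one_form (theta i) x) = 0.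

Definition fundamental_form_weyl_plus_eigenform (o : orientation M) :=
  exists lambda : M -> R, forall i x, chart_img i x ->
    fundamental_form i x != 0 /\
    weyl_plus (g i) x (o i x) (fundamental_form i x) =
      lambda (chart_inv i x) *: fundamental_form i x.

End ParaHermitianGeometry.

(* Main.v *)
Require Import Defs.
From HB Require Import structures.
From mathcomp Require Import all_boot all_order all_algebra.
From mathcomp Require Import all_classical all_reals all_analysis.
From mathcomp Require Import ring lra.

(* Let D be an eigenbundle of P, with frame e1, e2.  It is isotropic and integrable,
   so its leaves are totally geodesic, and g(nabla_Z e1, e2) = g(Z, e2) a1 - g(Z, e1) a2
   where dF = theta /\ F identifies 2 a with theta on D.  Anti-invariance of the Ricci
   tensor says that it vanishes on D x D, which in terms of the curvature R(., ., e1, e2)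
   means nabla_i a_j = - a_i a_j + v eps_ij along a leaf, whose curvature is then - v
   times the identity.  The Ricci identity gives nabla v = - 4 a v, and commuting the
   derivatives of v once more gives 10 v^2 = 0.  Hence v = 0, so d theta and the
   2-form R(F), the curvature contracted with F, vanish on D x D: both are
   of type (1, 1), and their self-dual parts are multiples of F.
     For d theta the multiple is 0, because d(dF) = 0 reads d theta /\ F = 0.  In the
   Einstein case W(F) = R(F)/2 - (c/3) F, so F is an eigenform of W^+; the eigenvalue
   is a scalar built from R, g and P, hence does not depend on the chart.
     The argument on a leaf is pure algebra: it holds over any torsion-free reduced
   commutative ring with commuting derivations, here the ring of smooth functions on
   an open subset of a chart. *)

Set Implicit Arguments.
Unset Strict Implicit.
Unset Printing Implicit Defensive.

Import Order.TTheory GRing.Theory Num.Theory.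
Import numFieldNormedType.Exports.

Local Open Scope classical_set_scope.
Local Open Scope ring_scope.

(** * Levi-Civita connections over a commutative ring *)

(** The argument on a leaf differentiates its own equations twice, which is unwieldy with [partial]
    on total functions, where each rule has a side condition at each point. Over a ring these steps
    are polynomial identities, and points reappear only when a conclusion is evaluated. The price is
    that nonzero elements need not be invertible: integers are cancelled by torsion-freeness, and
    only functions without zeros have inverses, so a frame extended from a point is usable only
    after its domain is shrunk. The frame consists of e1, e2 in D and the dual f1, f2 in the other
    eigenbundle, which is isotropic as well, so that the metric has constant coefficients in it. P
    acts on D by a single sign, whence rho(X, Y) = rho(PX, PY) = - rho(X, Y) there. By pair symmetry
    the Ricci components on D x D only involve the R(e_i, f_j, e1, e2), which contain one derivative
    of a: this is where equations for a come from. The other eigenbundle is the same case for -P.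
    The eigenvalue has to be a function on M and not one per chart, hence the naturality of the
    curvature under transition maps. *)

Section LinearCombination.
Variable A : comPzRingType.
Implicit Types x y l r c : A.

Lemma eq_add l1 r1 l2 r2 : l1 = r1 -> l2 = r2 -> l1 + l2 = r1 + r2 :> A.
Proof. by move=> -> ->. Qed.

Lemma eq_sub l1 r1 l2 r2 : l1 = r1 -> l2 = r2 -> l1 - l2 = r1 - r2 :> A.
Proof. by move=> -> ->. Qed.

Lemma eq_scale c l r : l = r -> c * l = c * r.
Proof. by move=> ->. Qed.

(** Serves as a certificate check: [l = r] is a combination of hypotheses assembled with [eq_add],
    [eq_sub] and [eq_scale], and the remaining goal is a polynomial identity for [ring]. *)
Lemma lincomb l r x y : l = r -> x - y = l - r -> x = y.
Proof. by move=> -> /eqP; rewrite subrr subr_eq0 => /eqP. Qed.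

End LinearCombination.

(** A Lie-Rinehart algebra with a metric and its connection, kept abstract so that computations in a
    frame see no coordinates. The ring may be zero, as is the ring of smooth functions on an empty
    open set. *)
Record leviCivita (A : comPzRingType) (V : lmodType A) := LeviCivita {
  act : V -> A -> A;
  br : V -> V -> V;
  met : V -> V -> A;
  nab : V -> V -> V;
  actDl : forall X Y a, act (X + Y) a = act X a + act Y a;
  actZl : forall a X b, act (a *: X) b = a * act X b;
  actDr : forall X a b, act X (a + b) = act X a + act X b;
  actM : forall X a b, act X (a * b) = act X a * b + a * act X b;
  act_br : forall X Y a, act (br X Y) a = act X (act Y a) - act Y (act X a);
  jacobi : forall X Y Z, br X (br Y Z) + br Y (br Z X) + br Z (br X Y) = 0;
  metC : forall X Y, met X Y = met Y X;
  metDl : forall X Y Z, met (X + Y) Z = met X Z + met Y Z;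
  metZl : forall a X Z, met (a *: X) Z = a * met X Z;
  nabDl : forall X Y Z, nab (X + Y) Z = nab X Z + nab Y Z;
  nabZl : forall a X Z, nab (a *: X) Z = a *: nab X Z;
  nabDr : forall X Y Z, nab X (Y + Z) = nab X Y + nab X Z;
  nabZr : forall a X Y, nab X (a *: Y) = act X a *: Y + a *: nab X Y;
  torsion_free : forall X Y, nab X Y - nab Y X = br X Y;
  metric_compat : forall X Y Z,
    act X (met Y Z) = met (nab X Y) Z + met Y (nab X Z)
}.

Section LeviCivitaTheory.
Variables (A : comPzRingType) (V : lmodType A) (C : leviCivita V).
Implicit Types (X Y Z W : V) (a b : A).
Local Notation act := (act C).
Local Notation br := (br C).
Local Notation g := (met C).
Local Notation nab := (nab C).

Lemma act0r X : act X 0 = 0.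
Proof. by apply: (addrI (act X 0)); rewrite -actDr !addr0. Qed.

Lemma actN X a : act X (- a) = - act X a.
Proof. by apply: (addrI (act X a)); rewrite -actDr !subrr act0r. Qed.

Lemma actB X a b : act X (a - b) = act X a - act X b.
Proof. by rewrite actDr actN. Qed.

Lemma act1 X : act X 1 = 0.
Proof.
have := actM C X 1 1; rewrite !mulr1 mul1r => h.
by apply: (addrI (act X 1)); rewrite -h addr0.
Qed.

Lemma act_nat X n : act X n%:R = 0.
Proof. by elim: n => [|n IH]; rewrite ?act0r // -natr1 actDr act1 IH addr0. Qed.

Lemma metDr X Y Z : g X (Y + Z) = g X Y + g X Z.
Proof. by rewrite metC metDl !(metC _ X). Qed.

Lemma metZr a X Z : g X (a *: Z) = a * g X Z.
Proof. by rewrite metC metZl metC. Qed.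

Lemma metNl X Y : g (- X) Y = - g X Y.
Proof. by rewrite -scaleN1r metZl mulN1r. Qed.

Lemma metNr X Y : g X (- Y) = - g X Y.
Proof. by rewrite metC metNl metC. Qed.

Lemma met0l X : g 0 X = 0.
Proof. by rewrite -(scale0r 0) metZl mul0r. Qed.

Lemma nabNl X Y : nab (- X) Y = - nab X Y.
Proof. by rewrite -scaleN1r nabZl scaleN1r. Qed.

Lemma nabNr X Y : nab X (- Y) = - nab X Y.
Proof.
by rewrite -scaleN1r nabZr actN act1 oppr0 scale0r add0r scaleN1r.
Qed.

Lemma br_skew X Y : br Y X = - br X Y.
Proof. by rewrite -!torsion_free opprB. Qed.

Lemma brE X Y : br X Y = nab X Y - nab Y X.
Proof. by rewrite torsion_free. Qed.

(** The connection is determined by the bracket and the metric, which is how [nab_pull] transports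
    it without touching Christoffel symbols. *)
Lemma koszul X Y Z : 2 * g (nab X Y) Z =
  act X (g Y Z) + act Y (g X Z) - act Z (g X Y)
  + g (br X Y) Z - g (br X Z) Y - g (br Y Z) X.
Proof.
rewrite !metric_compat !brE !(metDl, metNl).
rewrite (metC C Y (nab X Z)) (metC C X (nab Y Z)) (metC C X (nab Z Y)).
ring.
Qed.

Definition curv X Y Z : V :=
  nab X (nab Y Z) - nab Y (nab X Z) - nab (br X Y) Z.

Definition rm X Y Z W : A := g (curv X Y Z) W.

Lemma rmE X Y Z W : rm X Y Z W =
  g (nab X (nab Y Z)) W - g (nab Y (nab X Z)) W - g (nab (br X Y) Z) W.
Proof. by rewrite /rm /curv !metDl !metNl. Qed.

Lemma curv_skew X Y Z : curv Y X Z = - curv X Y Z.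
Proof. by rewrite /curv (br_skew X Y) nabNl opprK [RHS]opprB opprB addrC. Qed.

Lemma rm_skew12 X Y Z W : rm Y X Z W = - rm X Y Z W.
Proof. by rewrite /rm curv_skew metNl. Qed.

Lemma rm_skew34 X Y Z W : rm X Y W Z = - rm X Y Z W.
Proof.
have act2 P Q : g (nab P (nab Q Z)) W = act P (act Q (g Z W))
    - g (nab Q Z) (nab P W) - g (nab P Z) (nab Q W) - g (nab P (nab Q W)) Z.
  rewrite (metric_compat C Q) actDr !(metric_compat C P).
  by rewrite (metC C Z (nab P (nab Q W))); ring.
have act_nabbr : g (nab (br X Y) Z) W =
    act X (act Y (g Z W)) - act Y (act X (g Z W)) - g (nab (br X Y) W) Z.
  by rewrite -act_br metric_compat (metC C Z); ring.
by rewrite !rmE (act2 X Y) (act2 Y X) act_nabbr; ring.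
Qed.

Lemma rm_bianchi X Y Z W : rm X Y Z W + rm Y Z X W + rm Z X Y W = 0.
Proof.
rewrite -[RHS](met0l W) -(jacobi C X Y Z) !(brE X (br _ _)).
rewrite !(brE Y (br _ _)) !(brE Z (br _ _)) !rmE !brE.
by rewrite !(nabDl, nabDr, nabNl, nabNr) !(metDl, metNl); ring.
Qed.

(** A signed sum of four Bianchi identities. The factor 2 stays, since nothing at this stage allows
    it to be cancelled in the ring. *)
Lemma rm_pair X Y Z W : 2 * rm X Y Z W = 2 * rm Z W X Y.
Proof.
have b1 := rm_bianchi X Y Z W; have b2 := rm_bianchi Y Z W X.
have b3 := rm_bianchi Z W X Y; have b4 := rm_bianchi W X Y Z.
rewrite (rm_skew34 Y Z X W) (rm_skew34 Z W X Y) in b2.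
rewrite (rm_skew34 W X Y Z) (rm_skew34 X Z Y W) (rm_skew12 Z X) in b3.
rewrite (rm_skew34 X Y Z W) (rm_skew34 Y W Z X) (rm_skew12 W Y) in b4.
by apply: (lincomb (eq_sub (eq_sub (eq_add b1 b2) b3) b4)); ring.
Qed.

Lemma rmDl X X' Y Z W : rm (X + X') Y Z W = rm X Y Z W + rm X' Y Z W.
Proof.
rewrite !rmE !brE !(nabDl, nabDr, nabNl, nabNr) !(metDl, metNl).
by ring.
Qed.

Lemma rmZl a X Y Z W : rm (a *: X) Y Z W = a * rm X Y Z W.
Proof.
rewrite !rmE !brE !(nabDl, nabDr, nabNl, nabNr, nabZl, nabZr).
by rewrite !(metDl, metNl, metZl); ring.
Qed.

Lemma rmDr X X' Y Z W : rm Y (X + X') Z W = rm Y X Z W + rm Y X' Z W.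
Proof. by rewrite rm_skew12 rmDl opprD -!rm_skew12. Qed.

Lemma rmZr a X Y Z W : rm Y (a *: X) Z W = a * rm Y X Z W.
Proof. by rewrite rm_skew12 rmZl -mulrN -rm_skew12. Qed.

Lemma rmD4 X Y Z W W' : rm X Y Z (W + W') = rm X Y Z W + rm X Y Z W'.
Proof. by rewrite /rm metDr. Qed.

Lemma rmZ4 a X Y Z W : rm X Y Z (a *: W) = a * rm X Y Z W.
Proof. by rewrite /rm metZr. Qed.

Lemma rmD3 X Y Z Z' W : rm X Y (Z + Z') W = rm X Y Z W + rm X Y Z' W.
Proof. by rewrite rm_skew34 rmD4 opprD -!rm_skew34. Qed.

Lemma rmZ3 a X Y Z W : rm X Y (a *: Z) W = a * rm X Y Z W.
Proof. by rewrite rm_skew34 rmZ4 -mulrN -rm_skew34. Qed.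

End LeviCivitaTheory.

(* On a leaf spanned by e1 and e2 the connection reads nabla_1 e1 = p, nabla_1 e2 = q,
   nabla_2 e1 = r, nabla_2 e2 = s (components in e1, e2).  The hypotheses say that
   nabla_i a_j = - a_i a_j + v eps_ij and that the curvature of the leaf is - v
   times the identity.  The Ricci identity for a gives leaf_D1 and leaf_D2, that is
   nabla v = - 4 a v for the 2-form v, and the integrability condition of these
   equations is leaf_sqr. *)
Section Leaf.
Variables (A : comPzRingType) (D1 D2 : A -> A).
Hypotheses (D1D : forall a b, D1 (a + b) = D1 a + D1 b)
  (D2D : forall a b, D2 (a + b) = D2 a + D2 b)
  (D1N : forall a, D1 (- a) = - D1 a) (D2N : forall a, D2 (- a) = - D2 a)
  (D1M : forall a b, D1 (a * b) = D1 a * b + a * D1 b)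
  (D2M : forall a b, D2 (a * b) = D2 a * b + a * D2 b).
Variables (p1 p2 q1 q2 r1 r2 s1 s2 a1 a2 v : A).
Hypothesis comm : forall a,
  D1 (D2 a) - D2 (D1 a) = (q1 - r1) * D1 a + (q2 - r2) * D2 a.
Hypotheses
  (a11 : D1 a1 = p1 * a1 + p2 * a2 - a1 * a1)
  (a12 : D1 a2 = q1 * a1 + q2 * a2 - a1 * a2 + v)
  (a21 : D2 a1 = r1 * a1 + r2 * a2 - a1 * a2 - v)
  (a22 : D2 a2 = s1 * a1 + s2 * a2 - a2 * a2).
Hypotheses
  (R11 : D1 r1 + r1 * p1 + r2 * q1 - D2 p1 - p1 * r1 - p2 * s1
    - (q1 - r1) * p1 - (q2 - r2) * r1 = - v)
  (R12 : D1 r2 + r1 * p2 + r2 * q2 - D2 p2 - p1 * r2 - p2 * s2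
    - (q1 - r1) * p2 - (q2 - r2) * r2 = 0)
  (R21 : D1 s1 + s1 * p1 + s2 * q1 - D2 q1 - q1 * r1 - q2 * s1
    - (q1 - r1) * q1 - (q2 - r2) * s1 = 0)
  (R22 : D1 s2 + s1 * p2 + s2 * q2 - D2 q2 - q1 * r2 - q2 * s2
    - (q1 - r1) * q2 - (q2 - r2) * s2 = - v).

Lemma leaf_D1 : D1 v = (p1 + q2 - (a1 + a1 + a1 + a1)) * v.
Proof.
have := comm a1; rewrite a11 a21.
rewrite !(D1D, D2D, D1N, D2N, D1M, D2M) a11 a12 a21 a22 => h.
apply: (lincomb (eq_sub (eq_add (eq_scale a1 R11) (eq_scale a2 R12)) h)).
ring.
Qed.

Lemma leaf_D2 : D2 v = (r1 + s2 - (a2 + a2 + a2 + a2)) * v.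
Proof.
have := comm a2; rewrite a12 a22.
rewrite !(D1D, D2D, D1N, D2N, D1M, D2M) a11 a12 a21 a22 => h.
apply: (lincomb (eq_sub (eq_add (eq_scale a1 R21) (eq_scale a2 R22)) h)).
ring.
Qed.

(** The Ricci identity for the 2-form v, evaluated in two ways. The leaf curvature has trace - 2 v,
    so the commutator multiplies a 2-form by 2 v and yields 2 v^2; from nabla v = - 4 a v and da = 2
    v it yields - 8 v^2. The difference gives the 10. *)
Lemma leaf_sqr : 10 * (v * v) = 0.
Proof.
have := comm v; rewrite leaf_D1 leaf_D2.
rewrite !(D1D, D2D, D1N, D2N, D1M, D2M) leaf_D1 leaf_D2 a12 a21 => h.
apply: (lincomb (eq_sub (eq_add (eq_scale v R11) (eq_scale v R22)) h)).
ring.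
Qed.

End Leaf.

(** * Null frames adapted to an isotropic involutive distribution *)

Section NullFrame.
Variables (A : comPzRingType) (V : lmodType A) (C : leviCivita V).
Local Notation act := (act C).
Local Notation br := (br C).
Local Notation g := (met C).
Local Notation nab := (nab C).
Local Notation rm := (rm C).

Hypothesis torsion_freeA : forall n (a : A), n.+1%:R * a = 0 -> a = 0.
Hypothesis reducedA : forall a : A, a * a = 0 -> a = 0.

Variables e1 e2 f1 f2 : V.
Hypotheses (g11 : g e1 e1 = 0) (g12 : g e1 e2 = 0) (g22 : g e2 e2 = 0)
  (gef11 : g e1 f1 = 1) (gef12 : g e1 f2 = 0)
  (gef21 : g e2 f1 = 0) (gef22 : g e2 f2 = 1).
Hypothesis frame_span : forall Z,
  Z = g Z f1 *: e1 + g Z f2 *: e2 + g Z e1 *: f1 + g Z e2 *: f2.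

Definition ric X Y : A :=
  rm e1 X Y f1 + rm e2 X Y f2 + rm f1 X Y e1 + rm f2 X Y e2.

Hypotheses (ric11 : ric e1 e1 = 0) (ric12 : ric e1 e2 = 0)
  (ric22 : ric e2 e2 = 0).

Let reg2 (a b : A) : 2 * a = 2 * b -> a = b.
Proof.
move=> /eqP; rewrite -subr_eq0 -mulrBr => /eqP /torsion_freeA /eqP.
by rewrite subr_eq0 => /eqP.
Qed.

Let gn11 X : g (nab X e1) e1 = 0.
Proof.
apply: reg2; have := metric_compat C X e1 e1.
by rewrite g11 act0r (metC C e1) => h; apply: (lincomb (esym h)); ring.
Qed.

Let gn22 X : g (nab X e2) e2 = 0.
Proof.
apply: reg2; have := metric_compat C X e2 e2.
by rewrite g22 act0r (metC C e2) => h; apply: (lincomb (esym h)); ring.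
Qed.

Let gn21 X : g (nab X e2) e1 = - g (nab X e1) e2.
Proof.
have := metric_compat C X e1 e2; rewrite g12 act0r (metC C e1) => h.
by apply: (lincomb (esym h)); ring.
Qed.

Section Coefficients.
Variables p1 p2 q1 q2 r1 r2 s1 s2 a1 a2 : A.
Hypotheses (nab11 : nab e1 e1 = p1 *: e1 + p2 *: e2)
  (nab12 : nab e1 e2 = q1 *: e1 + q2 *: e2)
  (nab21 : nab e2 e1 = r1 *: e1 + r2 *: e2)
  (nab22 : nab e2 e2 = s1 *: e1 + s2 *: e2).
Hypothesis gn12 : forall Z, g (nab Z e1) e2 = g Z e2 * a1 - g Z e1 * a2.

Let gframe := (g11, g12, g22, gef11, gef12, gef21, gef22).

Let br12 : br e1 e2 = (q1 - r1) *: e1 + (q2 - r2) *: e2.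
Proof. by rewrite brE nab12 nab21 !scalerBl opprD addrACA. Qed.

Let gnef c b d : act c (g d b) = 0 -> g (nab c d) b = - g (nab c b) d.
Proof.
rewrite metric_compat (metC C d) => h.
by apply: (lincomb h); ring.
Qed.

Let rm_mixed c d : act c (g d e1) = 0 -> act c (g d e2) = 0 ->
  rm c d e1 e2 = act c (g (nab d e1) e2) - g (nab d e1) (nab c e2)
   - g (nab d (nab c e1)) e2
   - ((- g (nab c e2) d - g (nab d c) e2) * a1
      - (- g (nab c e1) d - g (nab d c) e1) * a2).
Proof.
move=> h1 h2; rewrite rmE gn12 brE !(metDl, metNl) (gnef h1) (gnef h2).
by rewrite (metric_compat C c (nab d e1)); ring.
Qed.

Let gscal := (metDl, metZl, metNl, metDr, metZr, metNr).

Let act_g : (act e1 0 = 0) * (act e1 1 = 0) * (act e2 0 = 0) * (act e2 1 = 0).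
Proof. by rewrite !act0r !act1. Qed.

Let act_fe : (act e1 (g f1 e1) = 0) * (act e1 (g f2 e1) = 0)
  * (act e1 (g f1 e2) = 0) * (act e1 (g f2 e2) = 0) * (act e2 (g f1 e1) = 0)
  * (act e2 (g f2 e1) = 0) * (act e2 (g f1 e2) = 0) * (act e2 (g f2 e2) = 0).
Proof. by rewrite !(metC C f1) !(metC C f2) !gframe !act_g. Qed.

Let gframeC : (g e2 e1 = 0) * (g f1 e1 = 1) * (g f2 e1 = 0) * (g f1 e2 = 0)
  * (g f2 e2 = 1).
Proof. by rewrite !(metC C f1) !(metC C f2) (metC C e2) !gframe. Qed.

Let mixed11 : rm e1 f1 e1 e2 = - (act e1 a2 - q1 * a1 - q2 * a2 + a1 * a2).
Proof.
rewrite rm_mixed ?act_fe // nab11 nab12 !(nabDr, nabZr, gscal).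
rewrite !(gn12, gn22, gn11, gn21) !(gframe, gframeC) !(actB, actN, act0r).
rewrite ?mul0r ?mul1r ?sub0r ?subr0 ?(actN, actB, act0r).
ring.
Qed.

Let mixed12 : rm e1 f2 e1 e2 = act e1 a1 - p1 * a1 - p2 * a2 + a1 * a1.
Proof.
rewrite rm_mixed ?act_fe // nab11 nab12 !(nabDr, nabZr, gscal).
rewrite !(gn12, gn22, gn11, gn21) !(gframe, gframeC) !(actB, actN, act0r).
rewrite ?mul0r ?mul1r ?sub0r ?subr0 ?(actN, actB, act0r).
ring.
Qed.

Let mixed21 : rm e2 f1 e1 e2 = - (act e2 a2 - s1 * a1 - s2 * a2 + a2 * a2).
Proof.
rewrite rm_mixed ?act_fe // nab21 nab22 !(nabDr, nabZr, gscal).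
rewrite !(gn12, gn22, gn11, gn21) !(gframe, gframeC) !(actB, actN, act0r).
rewrite ?mul0r ?mul1r ?sub0r ?subr0 ?(actN, actB, act0r).
ring.
Qed.

Let mixed22 : rm e2 f2 e1 e2 = act e2 a1 - r1 * a1 - r2 * a2 + a1 * a2.
Proof.
rewrite rm_mixed ?act_fe // nab21 nab22 !(nabDr, nabZr, gscal).
rewrite !(gn12, gn22, gn11, gn21) !(gframe, gframeC) !(actB, actN, act0r).
rewrite ?mul0r ?mul1r ?sub0r ?subr0 ?(actN, actB, act0r).
ring.
Qed.

Let same_mixed c d : rm e1 e2 c d = rm c d e1 e2.
Proof. by apply: reg2; exact: rm_pair. Qed.

(** Each Ricci component on the leaf has two nonzero kinds of terms, which pair symmetry identifies
    or compares: [ric e1 e1] and [ric e2 e2] are twice a mixed component up to sign, and [ric e1 e2]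
    is a difference of two. *)
Let ric_mixed : [/\ rm e1 f2 e1 e2 = 0, rm e2 f1 e1 e2 = 0
  & rm e2 f2 e1 e2 = rm e1 f1 e1 e2].
Proof.
have rm_diag X Z W : rm X X Z W = 0.
  apply: reg2; have h := rm_skew12 C X X Z W.
  by apply: (lincomb h); ring.
have rm_diag' X Y Z : rm X Y Z Z = 0.
  apply: reg2; have h := rm_skew34 C X Y Z Z.
  by apply: (lincomb h); ring.
have h11 := ric11; have h12 := ric12; have h22 := ric22.
rewrite /ric !rm_diag !rm_diag' (rm_skew12 C e1 e2) (rm_skew12 C e1 f2) in h11.
rewrite /ric !rm_diag !rm_diag' (rm_skew12 C e1 e2) (rm_skew12 C e1 f1) in h12.
rewrite /ric !rm_diag !rm_diag' (rm_skew12 C e2 f1) in h22.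
rewrite !(rm_skew34 C _ _ e1 e2) in h11 h12 h22.
rewrite !same_mixed in h11 h12 h22.
split.
- by apply: reg2; apply: (lincomb (eq_scale (-1) h11)); ring.
- by apply: reg2; apply: (lincomb h22); ring.
- by apply: (lincomb (eq_scale (-1) h12)); ring.
Qed.

(** The leaf is totally geodesic, so pairing R(e1, e2) c with f1 or f2 reads off the components of
    the curvature of the leaf itself. *)
Let leaf_curv (c d : V) P Q R S :
  nab e2 c = P *: e1 + Q *: e2 -> nab e1 c = R *: e1 + S *: e2 ->
  rm e1 e2 c d = g (act e1 P *: e1 + P *: nab e1 e1 + (act e1 Q *: e2 + Q *: nab e1 e2)
   - (act e2 R *: e1 + R *: nab e2 e1 + (act e2 S *: e2 + S *: nab e2 e2))
   - ((q1 - r1) *: nab e1 c + (q2 - r2) *: nab e2 c)) d.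
Proof.
move=> h1 h2; rewrite /rm /curv {1}h1 {1}h2 br12 !nabDr !nabZr.
by rewrite nabDl !nabZl.
Qed.

Lemma leaf_obstruction : rm e1 e2 e1 f1 = 0 /\ rm e1 e2 e2 f2 = 0.
Proof.
have [x12 x21 x22] := ric_mixed; set v := - rm e1 f1 e1 e2.
have a12 : act e1 a2 = q1 * a1 + q2 * a2 - a1 * a2 + v.
  by rewrite /v mixed11; ring.
have a11 : act e1 a1 = p1 * a1 + p2 * a2 - a1 * a1.
  by apply: (lincomb x12); rewrite mixed12; ring.
have a22 : act e2 a2 = s1 * a1 + s2 * a2 - a2 * a2.
  by apply: (lincomb (eq_scale (-1) x21)); rewrite mixed21; ring.
have a21 : act e2 a1 = r1 * a1 + r2 * a2 - a1 * a2 - v.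
  by rewrite /v -x22 mixed22; ring.
suff v0 : v = 0.
  rewrite !same_mixed x22; move: v0; rewrite /v => /eqP.
  by rewrite oppr_eq0 => /eqP.
(* [torsion_freeA] cancels the successor of its argument, here the 10 of [leaf_sqr]. *)
apply: reducedA; apply: (@torsion_freeA 9).
have := leaf_curv f1 nab21 nab11; have := leaf_curv f2 nab21 nab11.
have := leaf_curv f1 nab22 nab12; have := leaf_curv f2 nab22 nab12.
rewrite !same_mixed x12 x21 x22 -[rm e1 f1 e1 e2]opprK -/v.
rewrite nab11 nab12 nab21 nab22 !gscal !gframe => R22 R21 R12 R11.
apply: (leaf_sqr (D1 := act e1) (D2 := act e2) _ _ _ _ _ _ _ a11 a12 a21 a22).
- exact: actDr.
- exact: actDr.
- exact: actN.
- exact: actN.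
- exact: actM.
- exact: actM.
- move=> a; rewrite -act_br br12 actDl !actZl //.
- by apply: (lincomb (esym R11)); ring.
- by apply: (lincomb (esym R12)); ring.
- by apply: (lincomb (esym R21)); ring.
- by apply: (lincomb (esym R22)); ring.
Qed.

(** The left side is da on the leaf. The formulas [mixed11] and [mixed22] make it minus the sum of
    the two curvature components that [leaf_obstruction] annihilates. *)
Lemma leaf_closed : act e1 a2 - act e2 a1
  - ((q1 - r1) * a1 + (q2 - r2) * a2) = 0.
Proof.
have [x1 x2] := leaf_obstruction; rewrite !same_mixed in x1 x2.
apply: (lincomb (eq_scale (-1) (eq_add x1 x2))); rewrite mixed11 mixed22.
by ring.
Qed.

End Coefficients.

Section Conclusion.
Hypotheses (inv1 : g (br e1 e2) e1 = 0) (inv2 : g (br e1 e2) e2 = 0).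

(** Involutivity makes the leaf totally geodesic: in g([e1, e2], e1) the term g(nab_2 e1, e1)
    vanishes and g(nab_1 e2, e1) = - g(nab_1 e1, e2). *)
Let gn1_12 : g (nab e1 e1) e2 = 0.
Proof.
have := inv1; rewrite brE metDl metNl gn11 gn21 => h.
by apply: (lincomb (eq_scale (-1) h)); ring.
Qed.

Let gn2_12 : g (nab e2 e1) e2 = 0.
Proof.
have := inv2; rewrite brE metDl metNl gn22 => h.
by apply: (lincomb (eq_scale (-1) h)); ring.
Qed.

Let tangent (X : V) : g X e1 = 0 -> g X e2 = 0 ->
  X = g X f1 *: e1 + g X f2 *: e2.
Proof. by move=> h1 h2; rewrite {1}[X]frame_span h1 h2 !scale0r !addr0. Qed.

(** By the two preceding facts only the f-components of Z contribute. This is the origin of a1 =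
    g(nab_f2 e1, e2) and a2 = - g(nab_f1 e1, e2). *)
Let gn12 Z : g (nab Z e1) e2 =
  g Z e2 * g (nab f2 e1) e2 - g Z e1 * - g (nab f1 e1) e2.
Proof.
rewrite {1}[Z]frame_span !nabDl !nabZl !metDl !metZl gn1_12 gn2_12.
by ring.
Qed.

Let nabE : [/\ nab e1 e1 = g (nab e1 e1) f1 *: e1 + g (nab e1 e1) f2 *: e2,
  nab e1 e2 = g (nab e1 e2) f1 *: e1 + g (nab e1 e2) f2 *: e2,
  nab e2 e1 = g (nab e2 e1) f1 *: e1 + g (nab e2 e1) f2 *: e2
  & nab e2 e2 = g (nab e2 e2) f1 *: e1 + g (nab e2 e2) f2 *: e2].
Proof.
by split; apply: tangent; rewrite ?gn11 ?gn22 ?gn21 ?gn1_12 ?gn2_12 ?oppr0.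
Qed.

Theorem null_frame_curvature : rm e1 e2 e1 f1 = 0 /\ rm e1 e2 e2 f2 = 0.
Proof. by have [h1 h2 h3 h4] := nabE; apply: leaf_obstruction h1 h2 h3 h4 gn12. Qed.

(** [th1] and [th2] stand for the values of the Lee form on e1 and e2, that is 2 a1 and 2 a2; the
    conclusion is twice da = 0 along the leaf. *)
Theorem null_frame_closed th1 th2 :
  2 * g (nab f2 e1) e2 = th1 -> 2 * g (nab f1 e1) e2 = - th2 ->
  act e1 th2 - act e2 th1
  - (g (br e1 e2) f1 * th1 + g (br e1 e2) f2 * th2) = 0.
Proof.
move=> ht1 ht2; have [h1 h2 h3 h4] := nabE.
have := leaf_closed h1 h2 h3 h4 gn12.
have {ht2} -> : th2 = 2 * - g (nab f1 e1) e2.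
  by rewrite mulrN ht2 opprK.
rewrite -{}ht1 => h; rewrite !actM !act_nat !mul0r !add0r !brE.
by rewrite !(metDl, metNl); apply: (lincomb (eq_scale 2 h)); ring.
Qed.

End Conclusion.
End NullFrame.

(** * The Levi-Civita connection of a metric in coordinates *)

Record derivations (A : comPzRingType) (n : nat) := Derivations {
  der :> 'I_n -> A -> A;
  derD : forall i a b, der i (a + b) = der i a + der i b;
  derM : forall i a b, der i (a * b) = der i a * b + a * der i b;
  derC : forall i j a, der i (der j a) = der j (der i a)
}.

Section CoordinateConnection.
Variables (A : comPzRingType) (n : nat) (d : derivations A n).
Variables (G Gi : 'M[A]_n) (hf : A).
Hypotheses (hf2 : 2 * hf = 1) (Gsym : G^T = G) (GGi : G *m Gi = 1%:M).

Implicit Types (X Y Z : 'rV[A]_n) (a b : A).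

Definition cact X a := \sum_i X 0 i * d i a.

Definition cbr X Y : 'rV[A]_n :=
  \row_k \sum_(i < n) (X 0 i * d i (Y 0 k) - Y 0 i * d i (X 0 k)).

(** [hf] and [Gi] stand for 1/2 and the inverse metric, which are given as elements because the ring
    has no division. *)
Definition cgamma (k i j : 'I_n) : A :=
  hf * \sum_l Gi k l * (d i (G j l) + d j (G i l) - d l (G i j)).

Definition cnab X Y : 'rV[A]_n :=
  \row_k (\sum_i X 0 i * d i (Y 0 k)
          + \sum_i \sum_j cgamma k i j * X 0 i * Y 0 j).

Definition cmet X Y : A := (X *m G *m Y^T) 0 0.

Lemma der0 i : d i 0 = 0.
Proof. by apply: (addrI (d i 0)); rewrite -derD !addr0. Qed.

Lemma derN i a : d i (- a) = - d i a.
Proof. by apply: (addrI (d i a)); rewrite -derD !subrr der0. Qed.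

Lemma cactDl X Y a : cact (X + Y) a = cact X a + cact Y a.
Proof. by rewrite -big_split; apply: eq_bigr => i _; rewrite mxE mulrDl. Qed.

Lemma cactZl a X b : cact (a *: X) b = a * cact X b.
Proof.
by rewrite /cact mulr_sumr; apply: eq_bigr => i _; rewrite mxE mulrA.
Qed.

Lemma cactDr X a b : cact X (a + b) = cact X a + cact X b.
Proof. by rewrite -big_split; apply: eq_bigr => i _; rewrite derD mulrDr. Qed.

Lemma cactM X a b : cact X (a * b) = cact X a * b + a * cact X b.
Proof.
rewrite mulr_suml mulr_sumr -big_split; apply: eq_bigr => i _ /=.
by rewrite derM; ring.
Qed.

Let cact_sum X (I : finType) (F : I -> A) :
  cact X (\sum_j F j) = \sum_j cact X (F j).
Proof.
apply: (big_morph _ (cactDr X)).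
by rewrite /cact big1 // => i _; rewrite der0 mulr0.
Qed.

Let cbrE X Y k : cbr X Y 0 k = cact X (Y 0 k) - cact Y (X 0 k).
Proof. by rewrite mxE sumrB. Qed.

Lemma cbrDl X Y Z : cbr (X + Y) Z = cbr X Z + cbr Y Z.
Proof.
apply/rowP => k; rewrite [RHS]mxE !cbrE cactDl mxE cactDr; ring.
Qed.

Lemma cbr_skew X Y : cbr X Y = - cbr Y X.
Proof. by apply/rowP => k; rewrite [RHS]mxE !cbrE opprB. Qed.

Lemma cbrDr X Y Z : cbr Z (X + Y) = cbr Z X + cbr Z Y.
Proof. by rewrite cbr_skew cbrDl opprD -!cbr_skew. Qed.

Lemma cbrNl X Y : cbr (- X) Y = - cbr X Y.
Proof.
apply: (addrI (cbr X Y)); rewrite -cbrDl !subrr; apply/rowP => k.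
rewrite cbrE [RHS]mxE /cact !big1 ?subrr // => i _; rewrite ?mxE ?mul0r //.
by rewrite der0 mulr0.
Qed.

Lemma cbr_signl (b : bool) X Y : cbr ((-1) ^+ b *: X) Y = (-1) ^+ b *: cbr X Y.
Proof. by case: b; rewrite ?expr0 ?expr1 ?scale1r // !scaleN1r cbrNl. Qed.

Lemma cbr_signr (b : bool) X Y : cbr X ((-1) ^+ b *: Y) = (-1) ^+ b *: cbr X Y.
Proof. by rewrite cbr_skew cbr_signl -scalerN -cbr_skew. Qed.

Let cact_br X Y a : cact (cbr X Y) a = cact X (cact Y a) - cact Y (cact X a).
Proof.
have act2 P Q : cact P (cact Q a) =
    \sum_i cact P (Q 0 i) * d i a + \sum_i Q 0 i * cact P (d i a).
  rewrite {2}/cact cact_sum -big_split.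
  by apply: eq_bigr => i _; rewrite cactM.
have sym : \sum_i Y 0 i * cact X (d i a) = \sum_i X 0 i * cact Y (d i a).
  under eq_bigr do rewrite /cact mulr_sumr.
  rewrite exchange_big; apply: eq_bigr => i _.
  rewrite /cact mulr_sumr; apply: eq_bigr => j _.
  by rewrite derC; ring.
rewrite !act2 sym opprD addrACA subrr addr0 -sumrB.
by apply: eq_bigr => i _; rewrite cbrE mulrBl.
Qed.

Lemma cactN X a : cact X (- a) = - cact X a.
Proof. by rewrite /cact -sumrN; apply: eq_bigr => i _; rewrite derN mulrN. Qed.

Let cjacobi X Y Z :
  cbr X (cbr Y Z) + cbr Y (cbr Z X) + cbr Z (cbr X Y) = 0.
Proof.
apply/rowP => k; have addE (U W : 'rV[A]_n) : (U + W) 0 k = U 0 k + W 0 k.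
  by rewrite mxE.
by rewrite !addE [RHS]mxE !cbrE !cact_br !(cactDr, cactN); ring.
Qed.

Let cmetC X Y : cmet X Y = cmet Y X.
Proof.
rewrite /cmet -[in LHS](trmxK (X *m G *m Y^T)) mxE.
by rewrite !trmx_mul trmxK Gsym mulmxA.
Qed.

Let cmetDl X Y Z : cmet (X + Y) Z = cmet X Z + cmet Y Z.
Proof. by rewrite /cmet !mulmxDl mxE. Qed.

Let cmetZl a X Y : cmet (a *: X) Y = a * cmet X Y.
Proof. by rewrite /cmet -!scalemxAl mxE. Qed.

(** The connection form evaluated on X, arranged to act on row vectors from the right. *)
Definition conn_mx X : 'M[A]_n := \matrix_(j, k) \sum_i cgamma k i j * X 0 i.

Let cnabE X Y : cnab X Y = map_mx (cact X) Y + Y *m conn_mx X.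
Proof.
apply/rowP => k; rewrite !mxE; congr (_ + _).
rewrite exchange_big; apply: eq_bigr => j _; rewrite mxE mulr_sumr.
by apply: eq_bigr => i _; rewrite mulrC.
Qed.

Lemma cact_mulmx X p q r (M : 'M[A]_(p, q)) (N : 'M[A]_(q, r)) :
  map_mx (cact X) (M *m N) = map_mx (cact X) M *m N + M *m map_mx (cact X) N.
Proof.
apply/matrixP => i j; rewrite !mxE cact_sum -big_split.
by apply: eq_bigr => k _; rewrite !mxE cactM.
Qed.

Let low_mx X : 'M[A]_n := \matrix_(j, l)
  \sum_i X 0 i * (d i (G j l) + d j (G i l) - d l (G i j)).

(** Lowering the index cancels [Gi] and leaves the Christoffel symbols of the first kind. *)
Let conn_mx_low X : conn_mx X *m G = hf *: low_mx X.
Proof.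
have -> : conn_mx X = hf *: (low_mx X *m Gi^T).
  apply/matrixP => j k; rewrite !mxE.
  transitivity (\sum_i \sum_l hf * (X 0 i
      * (d i (G j l) + d j (G i l) - d l (G i j)) * Gi k l)).
    apply: eq_bigr => i _; rewrite /cgamma mulrAC mulr_sumr.
    by apply: eq_bigr => l _; ring.
  rewrite exchange_big mulr_sumr; apply: eq_bigr => l _.
  by rewrite !mxE mulr_suml mulr_sumr.
have -> : Gi^T = Gi^T *m (G *m Gi) by rewrite GGi mulmx1.
by rewrite -scalemxAl -!mulmxA (mulmx1C GGi) mulmx1 -[in X in _ *m X]Gsym
  -trmx_mul GGi trmx1 mulmx1.
Qed.

(** Metric compatibility in matrix form. Symmetrising the first-kind symbols in j and l doubles the
    derivative of G_jl and cancels the other two terms. *)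
Let conn_met X : conn_mx X *m G + G *m (conn_mx X)^T = map_mx (cact X) G.
Proof.
have Gs p q : G p q = G q p by rewrite -{1}Gsym mxE.
have -> : G *m (conn_mx X)^T = (conn_mx X *m G)^T by rewrite trmx_mul Gsym.
rewrite conn_mx_low.
apply/matrixP => j l; rewrite !mxE -mulrDr -big_split mulr_sumr.
apply: eq_bigr => i _ /=.
rewrite -[X in _ = _ * X]mul1r -hf2.
by rewrite (Gs l j); ring.
Qed.

Let cgammaC k i j : cgamma k i j = cgamma k j i.
Proof.
have Gs p q : G p q = G q p by rewrite -{1}Gsym mxE.
rewrite /cgamma; congr (_ * _); apply: eq_bigr => l _.
by rewrite (Gs i j) [d j (G i l) + _]addrC.
Qed.

Let ctorsion X Y : cnab X Y - cnab Y X = cbr X Y.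
Proof.
apply/rowP => k; rewrite cbrE !mxE.
rewrite [X in _ - (_ + X)]exchange_big.
have -> : \sum_i \sum_j cgamma k j i * Y 0 j * X 0 i
   = \sum_i \sum_j cgamma k i j * X 0 i * Y 0 j.
  by apply: eq_bigr => i _; apply: eq_bigr => j _; rewrite cgammaC mulrAC.
by rewrite /cact; ring.
Qed.

Let cmetric_compat X Y Z :
  cact X (cmet Y Z) = cmet (cnab X Y) Z + cmet Y (cnab X Z).
Proof.
have -> : cact X (cmet Y Z) = map_mx (cact X) (Y *m G *m Z^T) 0 0.
  by rewrite [RHS]mxE.
have trE : map_mx (cact X) Z^T = (map_mx (cact X) Z)^T.
  by apply/matrixP => i j; rewrite !mxE.
rewrite !cact_mulmx trE -conn_met !cnabE /cmet !linearD /= !trmx_mul.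
by rewrite !(mulmxDl, mulmxDr) !mulmxA !mxE; ring.
Qed.

Let cmap0 a X Y : map_mx (cact (a *: X)) Y = a *: map_mx (cact X) Y.
Proof. by apply/matrixP => i j; rewrite !mxE cactZl. Qed.

Let conn_mxD X Y : conn_mx (X + Y) = conn_mx X + conn_mx Y.
Proof.
apply/matrixP => i j; rewrite !mxE -big_split; apply: eq_bigr => k _ /=.
by rewrite mxE mulrDr.
Qed.

Let conn_mxZ a X : conn_mx (a *: X) = a *: conn_mx X.
Proof.
apply/matrixP => i j; rewrite !mxE mulr_sumr; apply: eq_bigr => k _ /=.
by rewrite mxE mulrCA.
Qed.

Let cnabDl X Y Z : cnab (X + Y) Z = cnab X Z + cnab Y Z.
Proof.
rewrite !cnabE conn_mxD mulmxDr addrACA; congr (_ + _).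
by apply/rowP => k; rewrite !mxE cactDl.
Qed.

Let cnabZl a X Z : cnab (a *: X) Z = a *: cnab X Z.
Proof. by rewrite !cnabE cmap0 conn_mxZ -scalemxAr scalerDr. Qed.

Let cnabDr X Y Z : cnab X (Y + Z) = cnab X Y + cnab X Z.
Proof.
rewrite !cnabE mulmxDl addrACA; congr (_ + _).
by apply/rowP => k; rewrite !mxE cactDr.
Qed.

Let cnabZr a X Y : cnab X (a *: Y) = cact X a *: Y + a *: cnab X Y.
Proof.
rewrite !cnabE -scalemxAl scalerDr addrA; congr (_ + _).
by apply/rowP => k; rewrite !mxE cactM.
Qed.

Definition coordinate_connection : leviCivita 'rV[A]_n :=
  @LeviCivita _ _ cact cbr cmet cnab cactDl cactZl cactDr cactM cact_br
    cjacobi cmetC cmetDl cmetZl cnabDl cnabZl cnabDr cnabZr ctorsion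
    cmetric_compat.

End CoordinateConnection.

(** * Bilinear forms and their contraction in a null frame *)

Section Contraction.
Variables (A : comPzRingType) (n : nat).
Implicit Types (x y : 'rV[A]_n) (M : 'M[A]_n).

Definition bform M x y : A := (x *m M *m y^T) 0 0.

Lemma bformE M x y : bform M x y = \sum_i \sum_j x 0 i * M i j * y 0 j.
Proof.
rewrite /bform -mulmxA mxE; apply: eq_bigr => i _; rewrite mxE mulr_sumr.
by apply: eq_bigr => j _; rewrite mxE mulrA.
Qed.

Lemma bform_delta M i j : bform M (delta_mx 0 i) (delta_mx 0 j) = M i j.
Proof. by rewrite /bform -rowE trmx_delta -colE !mxE. Qed.

Lemma bformDl M x x' y : bform M (x + x') y = bform M x y + bform M x' y.
Proof. by rewrite /bform !mulmxDl mxE. Qed.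

Lemma bformZl M a x y : bform M (a *: x) y = a * bform M x y.
Proof. by rewrite /bform -!scalemxAl mxE. Qed.

Lemma bformDr M x y y' : bform M x (y + y') = bform M x y + bform M x y'.
Proof. by rewrite /bform linearD mulmxDr mxE. Qed.

Lemma bformZr M a x y : bform M x (a *: y) = a * bform M x y.
Proof. by rewrite /bform linearZ -scalemxAr mxE. Qed.

Lemma bformNl M x y : bform M (- x) y = - bform M x y.
Proof. by rewrite -scaleN1r bformZl mulN1r. Qed.

Lemma bformNr M x y : bform M x (- y) = - bform M x y.
Proof. by rewrite -scaleN1r bformZr mulN1r. Qed.

(** Identifies a tensor defined on fields with the matrix of its components, so that contractions
    become traces of matrices. *)
Lemma bilinear_form (B : 'rV[A]_n -> 'rV[A]_n -> A) x y :
  (forall x x' y, B (x + x') y = B x y + B x' y) ->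
  (forall a x y, B (a *: x) y = a * B x y) ->
  (forall x y y', B x (y + y') = B x y + B x y') ->
  (forall a x y, B x (a *: y) = a * B x y) ->
  B x y = bform (\matrix_(i, j) B (delta_mx 0 i) (delta_mx 0 j)) x y.
Proof.
move=> BDl BZl BDr BZr.
have B0l u : B 0 u = 0 by rewrite -(scale0r 0) BZl mul0r.
have B0r u : B u 0 = 0 by rewrite -(scale0r 0) BZr mul0r.
rewrite bformE {1}(row_sum_delta x) {1}(row_sum_delta y).
rewrite (big_morph (B ^~ _) (fun u v => BDl u v _) (B0l _)).
apply: eq_bigr => i _; rewrite BZl.
rewrite (big_morph (B _) (fun u v => BDr _ u v) (B0r _)) mulr_sumr.
by apply: eq_bigr => j _; rewrite BZr mxE; ring.
Qed.

End Contraction.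

Section FrameContraction.
Variables (A : comPzRingType) (G Gi : 'M[A]_4).
Hypotheses (Gsym : G^T = G) (GGi : G *m Gi = 1%:M).
Local Notation g := (bform G).
Variables e1 e2 f1 f2 : 'rV[A]_4.
Hypotheses (g11 : g e1 e1 = 0) (g12 : g e1 e2 = 0) (g22 : g e2 e2 = 0)
  (gff11 : g f1 f1 = 0) (gff12 : g f1 f2 = 0) (gff22 : g f2 f2 = 0)
  (gef11 : g e1 f1 = 1) (gef12 : g e1 f2 = 0)
  (gef21 : g e2 f1 = 0) (gef22 : g e2 f2 = 1).

Definition frame_mx : 'M[A]_4 := \matrix_(i, j)
  (tnth [tuple e1; e2; f1; f2] i) 0 j.

(** The Gram matrix of a null frame e1, e2, f1, f2: index i is paired with i + 2. *)
Definition swap_mx : 'M[A]_4 :=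
  \matrix_(i, j) ((i + 2 == j :> nat) || (j + 2 == i :> nat))%:R.

Lemma frame_mxE (M : 'M[A]_4) i j : (frame_mx *m M *m frame_mx^T) i j =
  bform M (tnth [tuple e1; e2; f1; f2] i) (tnth [tuple e1; e2; f1; f2] j).
Proof.
have rowE' k : row k frame_mx = tnth [tuple e1; e2; f1; f2] k.
  by apply/rowP => l; rewrite !mxE.
rewrite /bform -!rowE' -row_mul tr_row.
by rewrite -[_ *m col _ _]/(_ *m _) -row_mul !mxE; apply: eq_bigr => k _; rewrite !mxE.
Qed.

Lemma swap_mxK : swap_mx *m swap_mx = 1%:M.
Proof.
apply/matrixP => i j; rewrite !mxE !big_ord_recl big_ord0 !mxE.
case: i j => [[|[|[|[|i]]]] ilt] [[|[|[|[|j]]]] jlt] //=;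
  by rewrite /= ?(mul0r, mulr0, mul1r, mulr1, add0r, addr0).
Qed.

Lemma gram_frame : frame_mx *m G *m frame_mx^T = swap_mx.
Proof.
have gC x y : g x y = g y x.
  rewrite /bform -[in LHS](trmxK (x *m G *m y^T)) mxE.
  by rewrite !trmx_mul trmxK Gsym mulmxA.
apply/matrixP => i j; rewrite frame_mxE mxE.
case: i j => [[|[|[|[|i]]]] ilt] [[|[|[|[|j]]]] jlt] //=;
  rewrite !(tnth_nth 0) /= ?(g11, g12, g22, gff11, gff12, gff22);
  by rewrite ?(gef11, gef12, gef21, gef22) // gC
    ?(g11, g12, g22, gff11, gff12, gff22, gef11, gef12, gef21, gef22).
Qed.

(** The Gram matrix of the frame is an involution, so the inverse of the frame matrix is G times its
    transpose times [swap_mx]; multiplying by [Gi] gives the formula. *)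
Lemma inverse_metric_frame : Gi = frame_mx^T *m swap_mx *m frame_mx.
Proof.
have h : frame_mx *m (G *m frame_mx^T *m swap_mx) = 1%:M.
  by rewrite !mulmxA gram_frame swap_mxK.
rewrite -[RHS]mul1mx -(mulmx1C GGi) -!mulmxA.
by rewrite [X in _ *m X]mulmxA [X in _ *m X]mulmxA [G *m _ *m _ *m _](mulmx1C h) mulmx1.
Qed.

Lemma span_frame Z :
  Z = g Z f1 *: e1 + g Z f2 *: e2 + g Z e1 *: f1 + g Z e2 *: f2.
Proof.
transitivity (Z *m G *m frame_mx^T *m swap_mx *m frame_mx).
  rewrite -(mulmxA _ _ frame_mx) -(mulmxA _ frame_mx^T).
  by rewrite (mulmxA _ swap_mx) -inverse_metric_frame -mulmxA GGi mulmx1.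
have -> : Z *m G *m frame_mx^T =
    \row_k bform G Z (tnth [tuple e1; e2; f1; f2] k).
  apply/rowP => k; rewrite [RHS]mxE /bform [LHS]mxE [RHS]mxE.
  by apply: eq_bigr => l _; rewrite !mxE.
apply/rowP => j; rewrite !mxE !big_ord_recl big_ord0 !mxE !big_ord_recl.
rewrite !big_ord0 !mxE !(tnth_nth 0) /=.
ring.
Qed.

Lemma trace_frame (M : 'M[A]_4) : \tr (Gi *m M) =
  bform M e1 f1 + bform M e2 f2 + bform M f1 e1 + bform M f2 e2.
Proof.
rewrite inverse_metric_frame -!mulmxA mxtrace_mulC -!mulmxA.
rewrite [frame_mx *m _]mulmxA.
have -> : frame_mx *m M *m frame_mx^T = \matrix_(i, j)
  bform M (tnth [tuple e1; e2; f1; f2] i) (tnth [tuple e1; e2; f1; f2] j).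
  by apply/matrixP => i j; rewrite frame_mxE mxE.
rewrite /mxtrace !big_ord_recl big_ord0 !mxE !big_ord_recl !big_ord0 !mxE.
rewrite !(tnth_nth 0) /=.
ring.
Qed.

End FrameContraction.

Section CoordinateCurvature.
Variables (A : comPzRingType) (n : nat) (d : derivations A n).
Variables (G Gi : 'M[A]_n) (hf : A).
Hypotheses (hf2 : 2 * hf = 1) (Gsym : G^T = G) (GGi : G *m Gi = 1%:M).
Local Notation C := (coordinate_connection d hf2 Gsym GGi).
Local Notation "'e_ i" := (delta_mx 0 i : 'rV[A]_n) (at level 8, i at level 2).

Definition cricci : 'M[A]_n := \matrix_(j, k) \sum_i curv C 'e_i 'e_j 'e_k 0 i.

Definition rm_mx14 Y Z : 'M[A]_n := \matrix_(i, l) rm C 'e_i Y Z 'e_l.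

Definition rm_mx34 X Y : 'M[A]_n := \matrix_(k, l) rm C X Y 'e_k 'e_l.

Lemma bform_rm14 X Y Z W : bform (rm_mx14 Y Z) X W = rm C X Y Z W.
Proof.
rewrite (bilinear_form (B := fun X W => rm C X Y Z W)) // => *;
  by rewrite ?(rmDl, rmZl, rmD4, rmZ4).
Qed.

Lemma bform_rm34 X Y Z W : bform (rm_mx34 X Y) Z W = rm C X Y Z W.
Proof.
rewrite (bilinear_form (B := fun Z W => rm C X Y Z W)) // => *;
  by rewrite ?(rmD3, rmZ3, rmD4, rmZ4).
Qed.

(** Rewrites the trace of an endomorphism as a metric contraction of the lowered curvature, the
    shape that [trace_frame] evaluates in a null frame. *)
Lemma cricciE Y Z : bform cricci Y Z = \tr (Gi *m rm_mx14 Y Z).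
Proof.
pose B Y Z := \tr (Gi *m rm_mx14 Y Z).
have -> : cricci = \matrix_(j, k) B 'e_j 'e_k.
  apply/matrixP => j k; rewrite !mxE /B /mxtrace.
  under [RHS]eq_bigr do rewrite mxE.
  rewrite exchange_big; apply: eq_bigr => m _.
  under eq_bigr do rewrite mxE.
  rewrite -[curv _ _ _ _]mulmx1 -GGi mulmxA [LHS]mxE; apply: eq_bigr => i _.
  rewrite mulrC; congr (_ * _).
  by rewrite /rm /= /cmet trmx_delta -colE [RHS]mxE.
rewrite -(bilinear_form (B := B)) // /B => *.
- rewrite -linearD -mulmxDr; congr (\tr (_ *m _)).
  by apply/matrixP => i j; rewrite !mxE rmDr.
- rewrite -linearZ /= scalemxAr; congr (\tr (_ *m _)).
  by apply/matrixP => i j; rewrite !mxE rmZr.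
- rewrite -linearD -mulmxDr; congr (\tr (_ *m _)).
  by apply/matrixP => i j; rewrite !mxE rmD3.
- rewrite -linearZ /= scalemxAr; congr (\tr (_ *m _)).
  by apply/matrixP => i j; rewrite !mxE rmZ3.
Qed.

End CoordinateCurvature.

(** * Exterior derivatives and wedge products evaluated on fields *)

Section ExteriorDerivative.
Variables (A : comPzRingType) (n : nat) (d : derivations A n).
Implicit Types X Y Z : 'rV[A]_n.

(** Cartan's formula; it passes from components in the chart to values on the fields of a frame. *)
Lemma d_one_form_fields (t : 'cV[A]_n) X Y :
  bform (\matrix_(i, j) (d i (t j 0) - d j (t i 0))) X Y =
  cact d X ((Y *m t) 0 0) - cact d Y ((X *m t) 0 0) - (cbr d X Y *m t) 0 0.
Proof.
have dt Z W : cact d Z ((W *m t) 0 0) =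
    (map_mx (cact d Z) W *m t) 0 0 + \sum_i \sum_j Z 0 i * W 0 j * d i (t j 0).
  have -> : cact d Z ((W *m t) 0 0) = map_mx (cact d Z) (W *m t) 0 0.
    by rewrite [RHS]mxE.
  rewrite cact_mulmx mxE; congr (_ + _); rewrite mxE.
  rewrite exchange_big; apply: eq_bigr => j _; rewrite mxE /cact mulr_sumr.
  by apply: eq_bigr => i _; ring.
have -> : cbr d X Y = map_mx (cact d X) Y - map_mx (cact d Y) X.
  by apply/rowP => k; rewrite !mxE sumrB.
have -> : bform (\matrix_(i, j) (d i (t j 0) - d j (t i 0))) X Y =
    \sum_i \sum_j X 0 i * Y 0 j * d i (t j 0)
    - \sum_i \sum_j Y 0 i * X 0 j * d i (t j 0).
  rewrite bformE (exchange_big _ _ _ _ _ (fun i j => Y 0 i * _ * _)) -sumrB.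
  apply: eq_bigr => i _; rewrite -sumrB; apply: eq_bigr => j _.
  by rewrite mxE; ring.
have subE (U W : 'M[A]_1) : (U - W) 0 0 = U 0 0 - W 0 0 by rewrite !mxE.
by rewrite !dt mulmxBl subE; ring.
Qed.

(** Cartan's formula for 2-forms with each bracket split in two halves: [map_mx (cact d X) Y]
    differentiates the components of Y along X. *)
Lemma d_two_form_fields (F : 'M[A]_n) X Y Z :
  \sum_i \sum_j \sum_k X 0 i * Y 0 j * Z 0 k *
    (d i (F j k) + d j (F k i) + d k (F i j)) =
  cact d X (bform F Y Z) + cact d Y (bform F Z X) + cact d Z (bform F X Y)
  - bform F (map_mx (cact d X) Y) Z - bform F Y (map_mx (cact d X) Z)
  - bform F (map_mx (cact d Y) Z) X - bform F Z (map_mx (cact d Y) X)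
  - bform F (map_mx (cact d Z) X) Y - bform F X (map_mx (cact d Z) Y).
Proof.
have dF U V W : cact d U (bform F V W) =
    bform F (map_mx (cact d U) V) W + bform F V (map_mx (cact d U) W)
    + \sum_i \sum_j \sum_k U 0 i * V 0 j * W 0 k * d i (F j k).
  have -> : cact d U (bform F V W) =
      map_mx (cact d U) (V *m F *m W^T) 0 0 by rewrite [RHS]mxE.
  rewrite !cact_mulmx mulmxDl.
  have -> : map_mx (cact d U) W^T = (map_mx (cact d U) W)^T.
    by apply/matrixP => i j; rewrite !mxE.
  have -> : \sum_i \sum_j \sum_k U 0 i * V 0 j * W 0 k * d i (F j k) =
      bform (map_mx (cact d U) F) V W.
    rewrite bformE exchange_big; apply: eq_bigr => j _.
    rewrite exchange_big; apply: eq_bigr => k _.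
    rewrite mxE /cact mulr_sumr mulr_suml; apply: eq_bigr => i _; ring.
  rewrite /bform !mxE; ring.
rewrite (dF X) (dF Y) (dF Z).
have -> : \sum_i \sum_j \sum_k Y 0 i * Z 0 j * X 0 k * d i (F j k) =
    \sum_i \sum_j \sum_k X 0 i * Y 0 j * Z 0 k * d j (F k i).
  rewrite [RHS]exchange_big; apply: eq_bigr => i _.
  rewrite [RHS]exchange_big; apply: eq_bigr => j _; apply: eq_bigr => k _; ring.
have -> : \sum_i \sum_j \sum_k Z 0 i * X 0 j * Y 0 k * d i (F j k) =
    \sum_i \sum_j \sum_k X 0 i * Y 0 j * Z 0 k * d k (F i j).
  rewrite exchange_big; apply: eq_bigr => i _ /=.
  rewrite exchange_big; apply: eq_bigr => j _; apply: eq_bigr => k _; ring.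
rewrite -[LHS]addr0.
transitivity (\sum_i \sum_j \sum_k X 0 i * Y 0 j * Z 0 k * d i (F j k)
  + \sum_i \sum_j \sum_k X 0 i * Y 0 j * Z 0 k * d j (F k i)
  + \sum_i \sum_j \sum_k X 0 i * Y 0 j * Z 0 k * d k (F i j)); last by ring.
rewrite addr0 -!big_split; apply: eq_bigr => i _ /=.
rewrite -!big_split; apply: eq_bigr => j _ /=.
by rewrite -!big_split; apply: eq_bigr => k _ /=; ring.
Qed.

Lemma wedge_fields (F : 'M[A]_n) (t : 'cV[A]_n) X Y Z :
  \sum_i \sum_j \sum_k X 0 i * Y 0 j * Z 0 k *
    (t i 0 * F j k + t j 0 * F k i + t k 0 * F i j) =
  (X *m t) 0 0 * bform F Y Z + (Y *m t) 0 0 * bform F Z X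
  + (Z *m t) 0 0 * bform F X Y.
Proof.
have w (U V W : 'rV[A]_n) : \sum_i \sum_j \sum_k U 0 i * V 0 j * W 0 k * (t i 0 * F j k) =
    (U *m t) 0 0 * bform F V W.
  rewrite bformE mxE mulr_suml; apply: eq_bigr => i _.
  rewrite mulr_sumr; apply: eq_bigr => j _; rewrite mulr_sumr.
  by apply: eq_bigr => k _; ring.
rewrite -!w.
have -> : \sum_i \sum_j \sum_k Y 0 i * Z 0 j * X 0 k * (t i 0 * F j k) =
    \sum_i \sum_j \sum_k X 0 i * Y 0 j * Z 0 k * (t j 0 * F k i).
  rewrite [RHS]exchange_big; apply: eq_bigr => i _.
  rewrite [RHS]exchange_big; apply: eq_bigr => j _; apply: eq_bigr => k _; ring.
have -> : \sum_i \sum_j \sum_k Z 0 i * X 0 j * Y 0 k * (t i 0 * F j k) =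
    \sum_i \sum_j \sum_k X 0 i * Y 0 j * Z 0 k * (t k 0 * F i j).
  rewrite exchange_big; apply: eq_bigr => i _ /=.
  rewrite exchange_big; apply: eq_bigr => j _; apply: eq_bigr => k _; ring.
rewrite -!big_split; apply: eq_bigr => i _ /=.
rewrite -!big_split; apply: eq_bigr => j _ /=.
by rewrite -!big_split; apply: eq_bigr => k _ /=; ring.
Qed.

End ExteriorDerivative.

(** * Vanishing on an eigenbundle, over the ring *)

Section ParaHermitianAlgebra.
Variables (A : comPzRingType) (d : derivations A 4).
Variables (G Gi : 'M[A]_4) (hf : A).
Hypotheses (hf2 : 2 * hf = 1) (Gsym : G^T = G) (GGi : G *m Gi = 1%:M).
Hypothesis torsion_freeA : forall n (a : A), n.+1%:R * a = 0 -> a = 0.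
Hypothesis reducedA : forall a : A, a * a = 0 -> a = 0.
Local Notation C := (coordinate_connection d hf2 Gsym GGi).
Local Notation g := (bform G).

Variable P : 'M[A]_4.
Hypothesis PG : P *m G = - (G *m P^T).

Variables e1 e2 f1 f2 : 'rV[A]_4.
Hypotheses (Pe1 : e1 *m P = e1) (Pe2 : e2 *m P = e2)
  (Pf1 : f1 *m P = - f1) (Pf2 : f2 *m P = - f2).
Hypotheses (gef11 : g e1 f1 = 1) (gef12 : g e1 f2 = 0)
  (gef21 : g e2 f1 = 0) (gef22 : g e2 f2 = 1).
Hypothesis involutive : cbr d e1 e2 *m P = cbr d e1 e2.
Hypotheses (ricci11 : bform (cricci d hf2 Gsym GGi) e1 e1 = 0)
  (ricci12 : bform (cricci d hf2 Gsym GGi) e1 e2 = 0)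
  (ricci22 : bform (cricci d hf2 Gsym GGi) e2 e2 = 0).

Let bform_P x y : g (x *m P) y = - g x (y *m P).
Proof.
rewrite /bform -(mulmxA x) PG mulmxN mulNmx mxE trmx_mul !mulmxA.
by [].
Qed.

Let isotropic_pos x y : x *m P = x -> y *m P = y -> g x y = 0.
Proof.
move=> hx hy; apply: (@torsion_freeA 1); have := bform_P x y.
by rewrite hx hy => h; apply: (lincomb h); ring.
Qed.

Let isotropic_neg x y : x *m P = - x -> y *m P = - y -> g x y = 0.
Proof.
move=> hx hy; apply: (@torsion_freeA 1); have := bform_P x y.
rewrite hx hy bformNl bformNr => h; apply: (lincomb (eq_scale (-1) h)); ring.
Qed.

Let g11 := isotropic_pos Pe1 Pe1.
Let g12 := isotropic_pos Pe1 Pe2.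
Let g22 := isotropic_pos Pe2 Pe2.
Let gff11 := isotropic_neg Pf1 Pf1.
Let gff12 := isotropic_neg Pf1 Pf2.
Let gff22 := isotropic_neg Pf2 Pf2.

Let span := span_frame Gsym GGi g11 g12 g22 gff11 gff12 gff22
  gef11 gef12 gef21 gef22.

Let trace M := trace_frame Gsym GGi g11 g12 g22 gff11 gff12 gff22
  gef11 gef12 gef21 gef22 M.

Let ricE X Y : bform (cricci d hf2 Gsym GGi) X Y = ric C e1 e2 f1 f2 X Y.
Proof. by rewrite cricciE trace !bform_rm14. Qed.

Let ric11 : ric C e1 e2 f1 f2 e1 e1 = 0. Proof. by rewrite -ricE. Qed.
Let ric12 : ric C e1 e2 f1 f2 e1 e2 = 0. Proof. by rewrite -ricE. Qed.
Let ric22 : ric C e1 e2 f1 f2 e2 e2 = 0. Proof. by rewrite -ricE. Qed.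

Let inv1 : g (cbr d e1 e2) e1 = 0. Proof. exact: isotropic_pos. Qed.
Let inv2 : g (cbr d e1 e2) e2 = 0. Proof. exact: isotropic_pos. Qed.

Let cact0 x : cact d x 0 = 0. Proof. exact: (act0r C). Qed.

(** In the null frame, P being 1 on the e_i and -1 on the f_i, this contraction is -2 times R(e1,
    e2, e1, f1) + R(e1, e2, e2, f2), the trace of the curvature of the leaf. *)
Lemma curvature_contraction_null :
  \tr (Gi *m (rm_mx34 d hf2 Gsym GGi e1 e2 *m P^T)) = 0.
Proof.
have [r1 r2] := null_frame_curvature (C := C) torsion_freeA reducedA
  g11 g12 g22 gef11 gef12 gef21 gef22 span ric11 ric12 ric22 inv1 inv2.
have bformP M x y : bform (M *m P^T) x y = bform M x (y *m P).
  by rewrite /bform trmx_mul !mulmxA.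
rewrite trace !bformP Pe1 Pe2 Pf1 Pf2 !bformNr !bform_rm34.
by rewrite (rm_skew34 C e1 e2 e1 f1) (rm_skew34 C e1 e2 e2 f2) r1 r2; ring.
Qed.

Variable t : 'cV[A]_4.
Let F := G *m P^T.
Hypothesis lee : forall i j k,
  d i (F j k) + d j (F k i) + d k (F i j) =
  t i 0 * F j k + t j 0 * F k i + t k 0 * F i j.

Let bformF x y : bform F x y = g x (y *m P).
Proof. by rewrite /bform /F trmx_mul !mulmxA. Qed.

(** Evaluates dF = theta wedge F on (e1, e2, f). There F is the metric up to sign and its values are
    constant; torsion-freeness and metric compatibility then leave a single connection coefficient.
    Only the constancy of the pairings is assumed, so that f can be f1 or f2. *)
Let lee_null f : f *m P = - f ->
  (forall x, cact d x (g e1 f) = 0) -> (forall x, cact d x (g e2 f) = 0) ->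
  2 * g (cnab d G Gi hf f e1) e2 =
  g e2 f * (e1 *m t) 0 0 - g e1 f * (e2 *m t) 0 0.
Proof.
move=> Pf df1 df2.
have := d_two_form_fields d F e1 e2 f.
have -> : \sum_i \sum_j \sum_k e1 0 i * e2 0 j * f 0 k *
    (d i (F j k) + d j (F k i) + d k (F i j)) =
  \sum_i \sum_j \sum_k e1 0 i * e2 0 j * f 0 k *
    (t i 0 * F j k + t j 0 * F k i + t k 0 * F i j).
  apply: eq_bigr => i _; apply: eq_bigr => j _; apply: eq_bigr => k _.
  by rewrite lee.
have gC x y : g x y = g y x := metC C x y.
have Fr x : (bform F x e1 = g x e1) * (bform F x e2 = g x e2)
    * (bform F x f = - g x f).
  by rewrite !bformF Pe1 Pe2 Pf bformNr.
have Fl x : (bform F e1 x = - g x e1) * (bform F e2 x = - g x e2)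
    * (bform F f x = g x f).
  have FC y : bform F y x = - bform F x y by rewrite !bformF -bform_P gC.
  by rewrite !FC !Fr opprK.
rewrite wedge_fields !Fr !Fl (gC f e1) !cactN df1 df2 g12 !cact0.
have brm x y : cbr d x y = map_mx (cact d x) y - map_mx (cact d y) x.
  by apply/rowP => k; rewrite !mxE sumrB.
have br12 : g (cnab d G Gi hf e1 e2) f - g (cnab d G Gi hf e2 e1) f =
    g (map_mx (cact d e1) e2) f - g (map_mx (cact d e2) e1) f.
  rewrite -!bformNl -!bformDl -brm; congr (g _ _); exact: (torsion_free C).
have br1f : g (cnab d G Gi hf e1 f) e2 - g (cnab d G Gi hf f e1) e2 =
    g (map_mx (cact d e1) f) e2 - g (map_mx (cact d f) e1) e2.
  rewrite -!bformNl -!bformDl -brm; congr (g _ _); exact: (torsion_free C).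
have br2f : g (cnab d G Gi hf e2 f) e1 - g (cnab d G Gi hf f e2) e1 =
    g (map_mx (cact d e2) f) e1 - g (map_mx (cact d f) e2) e1.
  rewrite -!bformNl -!bformDl -brm; congr (g _ _); exact: (torsion_free C).
have m1 : 0 = g (cnab d G Gi hf e1 e2) f + g e2 (cnab d G Gi hf e1 f).
  by rewrite -(df2 e1); exact: (metric_compat C).
have m2 : 0 = g (cnab d G Gi hf e2 e1) f + g e1 (cnab d G Gi hf e2 f).
  by rewrite -(df1 e2); exact: (metric_compat C).
have m3 : 0 = g (cnab d G Gi hf f e1) e2 + g e1 (cnab d G Gi hf f e2).
  by rewrite -(cact0 f) -g12; exact: (metric_compat C).
rewrite (gC e2) in m1; rewrite (gC e1) in m2; rewrite (gC e1) in m3.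
move=> h.
apply: (lincomb (eq_sub h (eq_add (eq_add (eq_add (eq_sub br12 br2f) br1f)
  (eq_sub m1 m2)) m3))).
ring.
Qed.

Theorem d_lee_form_null :
  bform (\matrix_(i, j) (d i (t j 0) - d j (t i 0))) e1 e2 = 0.
Proof.
have cst (x : 'rV[A]_4) b : cact d x (b%:R) = 0 by exact: (act_nat C).
have t1 : 2 * g (cnab d G Gi hf f2 e1) e2 = (e1 *m t) 0 0.
  rewrite lee_null // ?gef12 ?gef22; first by rewrite mul1r mul0r subr0.
    by move=> x; exact: (cst x 0%N).
  by move=> x; exact: (cst x 1%N).
have t2 : 2 * g (cnab d G Gi hf f1 e1) e2 = - (e2 *m t) 0 0.
  rewrite lee_null // ?gef11 ?gef21; first by rewrite mul1r mul0r sub0r.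
    by move=> x; exact: (cst x 1%N).
  by move=> x; exact: (cst x 0%N).
have := null_frame_closed (C := C) torsion_freeA reducedA
  g11 g12 g22 gef11 gef12 gef21 gef22 span ric11 ric12 ric22 inv1 inv2 t1 t2.
rewrite d_one_form_fields => <-; congr (_ - _ - _).
rewrite {1}[cbr d e1 e2]span inv1 inv2 !scale0r !addr0 mulmxDl -!scalemxAl.
by rewrite !mxE.
Qed.

End ParaHermitianAlgebra.

(** * Naturality of the curvature under a change of coordinates *)

Section Naturality.
Variables (A A' : comPzRingType) (n : nat).
Variables (d : derivations A n) (d' : derivations A' n).
Variable phi : {rmorphism A' -> A}.
Variables (J K : 'M[A]_n) (x : 'I_n -> A).
Hypotheses (KJ : K *m J = 1%:M) (dx : forall i k, d i (x k) = J i k).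
Hypothesis dphi : forall i a, d i (phi a) = \sum_b J i b * phi (d' b a).

Hypothesis torsion_freeA : forall n (a : A), n.+1%:R * a = 0 -> a = 0.

Variables (G Gi : 'M[A]_n) (hf : A) (G' Gi' : 'M[A']_n) (hf' : A').
Hypotheses (hf2 : 2 * hf = 1) (Gsym : G^T = G) (GGi : G *m Gi = 1%:M).
Hypotheses (hf2' : 2 * hf' = 1) (Gsym' : G'^T = G') (GGi' : G' *m Gi' = 1%:M).
Hypothesis GJ : G = J *m map_mx phi G' *m J^T.
Local Notation C := (coordinate_connection d hf2 Gsym GGi).
Local Notation C' := (coordinate_connection d' hf2' Gsym' GGi').

(** Pulls a field of the target chart back to the source: its components are composed with the
    transition map, which is [phi], and multiplied by the inverse Jacobian [K]. *)
Definition pull (X : 'rV[A']_n) : 'rV[A]_n := map_mx phi X *m K.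

Lemma act_pull X a : cact d (pull X) (phi a) = phi (cact d' X a).
Proof.
rewrite /cact rmorph_sum /=.
transitivity (\sum_b (pull X *m J) 0 b * phi (d' b a)).
  under eq_bigr do rewrite dphi mulr_sumr.
  rewrite exchange_big; apply: eq_bigr => b _; rewrite mxE mulr_suml.
  by apply: eq_bigr => i _; rewrite mulrA.
by apply: eq_bigr => b _; rewrite /pull -mulmxA KJ mulmx1 mxE rmorphM.
Qed.

(** Both fields are compared through their action on the target coordinates [x k], whose derivatives
    along a pulled-back field are known from [act_pull]; the inverse Jacobian is never
    differentiated. *)
Lemma br_pull X Y : cbr d (pull X) (pull Y) = pull (cbr d' X Y).
Proof.
have coordE (Z : 'rV[A]_n) k : (Z *m J) 0 k = cact d Z (x k).
  by rewrite mxE; apply: eq_bigr => i _; rewrite dx.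
have pullJ Z : pull Z *m J = map_mx phi Z by rewrite /pull -mulmxA KJ mulmx1.
rewrite -[LHS]mulmx1 -[RHS]mulmx1 -(mulmx1C KJ) !mulmxA; congr (_ *m _).
rewrite pullJ; apply/rowP => k; rewrite coordE.
have := act_br C (pull X) (pull Y) (x k); rewrite /= => ->.
rewrite -!coordE !pullJ ![map_mx _ _ _ _]mxE.
rewrite !act_pull -rmorphB; congr (phi _).
by rewrite mxE sumrB.
Qed.

Lemma met_pull X Y : cmet G (pull X) (pull Y) = phi (cmet G' X Y).
Proof.
transitivity (map_mx phi (X *m G' *m Y^T) 0 0); last by rewrite mxE.
rewrite !map_mxM -map_trmx /cmet /pull GJ trmx_mul !mulmxA.
rewrite -(mulmxA _ K J) KJ mulmx1 -(mulmxA _ J^T) -trmx_mul KJ trmx1 mulmx1.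
by [].
Qed.

(** Koszul's formula has a natural right side, and pulled-back fields suffice to test equality
    because G and K are invertible. *)
Lemma nab_pull X Y :
  cnab d G Gi hf (pull X) (pull Y) = pull (cnab d' G' Gi' hf' X Y).
Proof.
have test (U W : 'rV[A]_n) :
    (forall Z, cmet G U (pull Z) = cmet G W (pull Z)) -> U = W.
  move=> UW; have {}UW : U *m G *m K^T = W *m G *m K^T.
    apply/rowP => k; have := UW (delta_mx 0 k).
    by rewrite /cmet /pull map_delta_mx trmx_mul trmx_delta !mulmxA -!colE !mxE.
  have KG : (G *m K^T) *m (J^T *m Gi) = 1%:M.
    by rewrite mulmxA -(mulmxA G) -trmx_mul (mulmx1C KJ) trmx1 mulmx1.
  by rewrite -[U]mulmx1 -[W]mulmx1 -KG !mulmxA UW.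
apply: test => Z.
have inj2 (a b : A) : 2 * a = 2 * b -> a = b.
  move=> /eqP; rewrite -subr_eq0 -mulrBr => /eqP /torsion_freeA /eqP.
  by rewrite subr_eq0 => /eqP.
apply: inj2; have := koszul C (pull X) (pull Y) (pull Z); rewrite /= => ->.
transitivity (phi (2 * cmet G' (cnab d' G' Gi' hf' X Y) Z)); last first.
  by rewrite rmorphM rmorph_nat met_pull.
have := koszul C' X Y Z; rewrite /= => ->.
by rewrite !br_pull !met_pull !act_pull !(rmorphD, rmorphN).
Qed.

Let pullB X Y : pull (X - Y) = pull X - pull Y.
Proof. by rewrite /pull map_mxB mulmxBl. Qed.

Lemma rm_pull X Y Z W :
  rm C (pull X) (pull Y) (pull Z) (pull W) = phi (rm C' X Y Z W).
Proof.
rewrite /rm /= -met_pull; congr (cmet G _ _).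
by rewrite /curv /= !br_pull !nab_pull -!pullB.
Qed.

End Naturality.

Section DoubleContraction.
Variables (A : comPzRingType) (n : nat) (d : derivations A n).
Variables (G Gi : 'M[A]_n) (hf : A).
Hypotheses (hf2 : 2 * hf = 1) (Gsym : G^T = G) (GGi : G *m Gi = 1%:M).
Local Notation C := (coordinate_connection d hf2 Gsym GGi).

(** For S = P^T Gi, which is F with raised indices, this is the scalar R_abkl F^lk F^ab behind the
    eigenvalue. *)
Definition contraction12_34 (S : 'M[A]_n) : A :=
  \tr (S^T *m \matrix_(i, j)
    \tr (S *m rm_mx34 d hf2 Gsym GGi (delta_mx 0 i) (delta_mx 0 j))).

Lemma contraction12_34E (S : 'M[A]_n) : contraction12_34 S =
  \sum_a \sum_b (\sum_k \sum_l
    rm C (delta_mx 0 a) (delta_mx 0 b) (delta_mx 0 k) (delta_mx 0 l) * S l k) * S a b.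
Proof.
have trE (M N : 'M[A]_n) : \tr (M *m N) = \sum_k \sum_l N k l * M l k.
  rewrite /mxtrace exchange_big; apply: eq_bigr => k _; rewrite mxE.
  by apply: eq_bigr => l _; rewrite mulrC.
rewrite /contraction12_34 trE; apply: eq_bigr => a _; apply: eq_bigr => b _.
rewrite [X in X * _]mxE trE [X in _ * X]mxE; congr (_ * _).
by apply: eq_bigr => k _; apply: eq_bigr => l _; rewrite [X in X * _]mxE.
Qed.

End DoubleContraction.

Section ContractionNaturality.
Variables (A A' : comPzRingType) (n : nat).
Variables (d : derivations A n) (d' : derivations A' n).
Variable phi : {rmorphism A' -> A}.
Variables (J K : 'M[A]_n) (x : 'I_n -> A).
Hypotheses (KJ : K *m J = 1%:M) (dx : forall i k, d i (x k) = J i k).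
Hypothesis dphi : forall i a, d i (phi a) = \sum_b J i b * phi (d' b a).
Hypothesis torsion_freeA : forall n (a : A), n.+1%:R * a = 0 -> a = 0.
Variables (G Gi : 'M[A]_n) (hf : A) (G' Gi' : 'M[A']_n) (hf' : A').
Hypotheses (hf2 : 2 * hf = 1) (Gsym : G^T = G) (GGi : G *m Gi = 1%:M).
Hypotheses (hf2' : 2 * hf' = 1) (Gsym' : G'^T = G') (GGi' : G' *m Gi' = 1%:M).
Hypothesis GJ : G = J *m map_mx phi G' *m J^T.
Variables (S : 'M[A]_n) (S' : 'M[A']_n).
Hypothesis SK : S = K^T *m map_mx phi S' *m K.

Let deltaK a : row a K = pull phi K (delta_mx 0 a).
Proof. by rewrite /pull map_delta_mx -rowE. Qed.

Let tr_form (M : 'M[A]_n) (M' : 'M[A']_n) :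
  (forall a b, bform M (row a K) (row b K) = phi (M' a b)) ->
  K *m M *m K^T = map_mx phi M'.
Proof.
move=> h; apply/matrixP => a b; rewrite [RHS]mxE -h /bform.
by rewrite -row_mul [LHS]mxE [RHS]mxE; apply: eq_bigr => k _; rewrite !mxE.
Qed.

(** The rows of K are the pulled-back coordinate fields, so curvature components turn into K M K^T,
    and under the trace these factors are exactly those in the law of S. The inner pair of slots is
    treated with the outer pair fixed, then the outer pair. *)
Lemma contraction_pull :
  contraction12_34 d hf2 Gsym GGi S = phi (contraction12_34 d' hf2' Gsym' GGi' S').
Proof.
have inner X Y : \tr (S *m rm_mx34 d hf2 Gsym GGi (pull phi K X) (pull phi K Y))
   = phi (\tr (S' *m rm_mx34 d' hf2' Gsym' GGi' X Y)).
  have /tr_form h (a b : 'I_n) : bform (rm_mx34 d hf2 Gsym GGi (pull phi K X)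
      (pull phi K Y)) (row a K) (row b K) = phi (rm_mx34 d' hf2' Gsym' GGi' X Y a b).
    rewrite bform_rm34 !deltaK.
    rewrite (rm_pull KJ dx dphi torsion_freeA _ _ _ hf2' Gsym' GGi' GJ).
    by rewrite mxE.
  rewrite -trace_map_mx map_mxM -h.
  rewrite [X in \tr (X *m _)]SK.
  by rewrite -!mulmxA [LHS]mxtrace_mulC -!mulmxA.
pose c : 'M[A]_n := \matrix_(i, j)
  \tr (S *m rm_mx34 d hf2 Gsym GGi (delta_mx 0 i) (delta_mx 0 j)).
pose c' : 'M[A']_n := \matrix_(i, j)
  \tr (S' *m rm_mx34 d' hf2' Gsym' GGi' (delta_mx 0 i) (delta_mx 0 j)).
change (\tr (S^T *m c) = phi (\tr (S'^T *m c'))).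
have bil_c X Y : bform c X Y = \tr (S *m rm_mx34 d hf2 Gsym GGi X Y).
  rewrite -(bilinear_form (B := fun X Y => \tr (S *m rm_mx34 d hf2 Gsym GGi X Y))) // => *.
  - rewrite -linearD -mulmxDr; congr (\tr (_ *m _)).
    by apply/matrixP => i j; rewrite !mxE rmDl.
  - rewrite -linearZ /= scalemxAr; congr (\tr (_ *m _)).
    by apply/matrixP => i j; rewrite !mxE rmZl.
  - rewrite -linearD -mulmxDr; congr (\tr (_ *m _)).
    by apply/matrixP => i j; rewrite !mxE rmDr.
  - rewrite -linearZ /= scalemxAr; congr (\tr (_ *m _)).
    by apply/matrixP => i j; rewrite !mxE rmZr.
have /tr_form h (a b : 'I_n) : bform c (row a K) (row b K) = phi (c' a b).
  by rewrite bil_c !deltaK inner mxE.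
rewrite -trace_map_mx map_mxM -map_trmx -h.
rewrite [X in \tr (X^T *m _)]SK.
rewrite !trmx_mul trmxK.
by rewrite -!mulmxA [LHS]mxtrace_mulC -!mulmxA.
Qed.

End ContractionNaturality.

(** * The Pfaffian, and the identity d(dF) = 0 *)

Section Pfaffian.
Variable A : comPzRingType.

Lemma det_mx3 (f : nat -> nat -> A) : \det (\matrix_(i < 3, j < 3) f i j) =
  f 0%N 0%N * (f 1%N 1%N * f 2%N 2%N - f 1%N 2%N * f 2%N 1%N)
  - f 0%N 1%N * (f 1%N 0%N * f 2%N 2%N - f 1%N 2%N * f 2%N 0%N)
  + f 0%N 2%N * (f 1%N 0%N * f 2%N 1%N - f 1%N 1%N * f 2%N 0%N).
Proof.
rewrite (expand_det_row _ ord0) !big_ord_recl big_ord0 /cofactor.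
rewrite !(expand_det_row _ ord0) !big_ord_recl !big_ord0 /cofactor.
by rewrite !det_mx11 !mxE /= /bump /= !(exprS, expr0); ring.
Qed.

Lemma det_mx4 (f : nat -> nat -> A) : \det (\matrix_(i < 4, j < 4) f i j) =
  f 0%N 0%N * (f 1%N 1%N * (f 2%N 2%N * f 3%N 3%N - f 2%N 3%N * f 3%N 2%N)
    - f 1%N 2%N * (f 2%N 1%N * f 3%N 3%N - f 2%N 3%N * f 3%N 1%N)
    + f 1%N 3%N * (f 2%N 1%N * f 3%N 2%N - f 2%N 2%N * f 3%N 1%N))
  - f 0%N 1%N * (f 1%N 0%N * (f 2%N 2%N * f 3%N 3%N - f 2%N 3%N * f 3%N 2%N)
    - f 1%N 2%N * (f 2%N 0%N * f 3%N 3%N - f 2%N 3%N * f 3%N 0%N)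
    + f 1%N 3%N * (f 2%N 0%N * f 3%N 2%N - f 2%N 2%N * f 3%N 0%N))
  + f 0%N 2%N * (f 1%N 0%N * (f 2%N 1%N * f 3%N 3%N - f 2%N 3%N * f 3%N 1%N)
    - f 1%N 1%N * (f 2%N 0%N * f 3%N 3%N - f 2%N 3%N * f 3%N 0%N)
    + f 1%N 3%N * (f 2%N 0%N * f 3%N 1%N - f 2%N 1%N * f 3%N 0%N))
  - f 0%N 3%N * (f 1%N 0%N * (f 2%N 1%N * f 3%N 2%N - f 2%N 2%N * f 3%N 1%N)
    - f 1%N 1%N * (f 2%N 0%N * f 3%N 2%N - f 2%N 2%N * f 3%N 0%N)
    + f 1%N 2%N * (f 2%N 0%N * f 3%N 1%N - f 2%N 1%N * f 3%N 0%N)).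
Proof.
have cof (k : 'I_4) : cofactor (\matrix_(i < 4, j < 4) f i j) ord0 k =
    (-1) ^+ k * \det (\matrix_(i < 3, j < 3) f i.+1 (bump k j)).
  rewrite /cofactor add0n; congr (_ * \det _).
  by apply/matrixP => i j; rewrite !mxE.
rewrite (expand_det_row _ ord0) !big_ord_recl big_ord0 !cof.
rewrite !(det_mx3 (fun i j => f i.+1 (bump _ j))) !mxE /= /bump /=.
by rewrite !(exprS, expr0); ring.
Qed.

Definition pfaffian (F : 'M[A]_4) : A :=
  let f i j := F (inord i) (inord j) in
  f 0%N 1%N * f 2%N 3%N - f 0%N 2%N * f 1%N 3%N + f 0%N 3%N * f 1%N 2%N.

(** The coefficients are indicators of the indices, so [pfaffian_det] becomes one polynomial
    identity in these indicators, valid for arbitrary vectors, in place of a case analysis on four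
    indices. *)
Lemma skew_mxE (F : 'M[A]_4) (a b : 'I_4) :
  (forall i, F i i = 0) -> (forall i j, F j i = - F i j) ->
  let f i j := F (inord i) (inord j) in
  let e (a : 'I_4) i : A := (a == i :> nat)%:R in
  F a b = (e a 0%N * e b 1%N - e a 1%N * e b 0%N) * f 0%N 1%N
    + (e a 0%N * e b 2%N - e a 2%N * e b 0%N) * f 0%N 2%N
    + (e a 0%N * e b 3%N - e a 3%N * e b 0%N) * f 0%N 3%N
    + (e a 1%N * e b 2%N - e a 2%N * e b 1%N) * f 1%N 2%N
    + (e a 1%N * e b 3%N - e a 3%N * e b 1%N) * f 1%N 3%N
    + (e a 2%N * e b 3%N - e a 3%N * e b 2%N) * f 2%N 3%N.
Proof.
move=> F0 FN f e.
have fE : F a b = f a b by rewrite /f !inord_val.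
have f0 i : f i i = 0 by rewrite /f F0.
have fN i j : f i j = - f j i by rewrite /f FN.
rewrite fE /e; case: a b {fE} => [[|[|[|[|a]]]] alt] [[|[|[|[|b]]]] blt] //=;
  rewrite ?f0; first [ring | rewrite fN; ring].
Qed.

Lemma pfaffian_det (F : 'M[A]_4) (a b c d : 'I_4) :
  (forall i, F i i = 0) -> (forall i j, F j i = - F i j) ->
  F a b * F c d - F a c * F b d + F a d * F b c = pfaffian F *
  \det (\matrix_(r < 4, s < 4) (tnth [tuple a; b; c; d] r == s)%:R).
Proof.
move=> F0 FN.
have -> : \matrix_(r < 4, s < 4) (tnth [tuple a; b; c; d] r == s)%:R =
    \matrix_(r < 4, s < 4) ((fun r s =>
      (nth 0%N [:: a : nat; b : nat; c : nat; d : nat] r == s)%:R) r s) :> 'M[A]_4.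
  apply/matrixP => r s; rewrite !mxE (tnth_nth ord0) /=.
  by case: r => [[|[|[|[|r]]]] rlt].
rewrite (det_mx4 (fun r s =>
  (nth 0%N [:: a : nat; b : nat; c : nat; d : nat] r == s)%:R)) /=.
rewrite (skew_mxE a b F0 FN) (skew_mxE c d F0 FN) (skew_mxE a c F0 FN).
rewrite (skew_mxE b d F0 FN) (skew_mxE a d F0 FN) (skew_mxE b c F0 FN).
rewrite /pfaffian /=.
ring.
Qed.

End Pfaffian.

(** In the alternating sum of the derivatives of the four equations the second derivatives cancel by
    [derC]. The terms with an undifferentiated theta form theta wedge dF = theta wedge theta wedge F
    = 0. *)
Lemma dd_lee_form (A : comPzRingType) n (d : derivations A n) (F : 'M[A]_n)
    (t : 'I_n -> A) :
  (forall i j, F j i = - F i j) ->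
  (forall i j k, d i (F j k) + d j (F k i) + d k (F i j) =
    t i * F j k + t j * F k i + t k * F i j) ->
  let D i j := d i (t j) - d j (t i) in
  forall a b c e, D a b * F c e - D a c * F b e + D a e * F b c
    + D b c * F a e - D b e * F a c + D c e * F a b = 0.
Proof.
move=> FN lee D a b c e; rewrite /D.
have L i j k : d i (F j k) - d j (F i k) + d k (F i j) =
    t i * F j k - t j * F i k + t k * F i j.
  by have := lee i j k; rewrite (FN i k) derN mulrN.
have dL m i j k := congr1 (d m) (L i j k).
have ha := dL a b c e; have hb := dL b a c e.
have hc := dL c a b e; have he := dL e a b c.
rewrite !(derD, derN, derM) in ha hb hc he.
rewrite (derC d b a) (derC d c a) (derC d c b) (derC d e a) (derC d e b)
  (derC d e c) in ha hb hc he.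
have h := eq_sub (eq_add (eq_sub (eq_scale (t a) (L b c e))
  (eq_scale (t b) (L a c e))) (eq_scale (t c) (L a b e)))
  (eq_scale (t e) (L a b c)).
apply: (lincomb (eq_sub h (eq_sub (eq_add (eq_sub ha hb) hc) he))).
ring.
Qed.

(** * Smooth functions on open sets *)

Section LocalDifferentiability.
Variables (R : realType) (V W : normedModType R).

(** Both functions share the same little-o expansion at x. This permits altering a function away
    from the open set under study. *)
Lemma near_eq_differentiable (f g : V -> W) (x : V) :
  {near x, f =1 g} -> differentiable f x -> differentiable g x.
Proof.
move=> fg df.
have /diff_locallyP [cdf /eqaddoP fo] := df.
have go : g \o shift x = cst (g x) + 'd f x +o_ 0 id.
  apply/eqaddoP => e e0; have := fo e e0; rewrite -(nbhs_singleton fg).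
  have : \forall y \near (0 : V), f (y + x) = g (y + x).
    by move: fg; rewrite -/(prop_near1 _) (near_shift (0 : V) x) /= subr0.
  apply: filterS2 => y; rewrite !fctE /= => <-.
  by [].
by apply/diff_locallyP; rewrite (diff_unique cdf go).
Qed.

End LocalDifferentiability.

Section Partials.
Variables (R : realType) (n : nat).
Implicit Types (U : set 'rV[R]_n) (f g : 'rV[R]_n -> R) (x : 'rV[R]_n).

Lemma partial_diff i f x : differentiable f x ->
  partial i f x = 'd f x (basisv R i).
Proof. by move=> df; rewrite /partial deriveE. Qed.

Lemma eq_on_near U f g x : open U -> U x -> {in U, f =1 g} ->
  {near x, f =1 g}.
Proof.
move=> oU Ux fg; apply: filterS (open_nbhs_nbhs (conj oU Ux)) => y Uy.
by apply: fg; rewrite inE.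
Qed.

Lemma partial_eq_on U i f g : open U -> {in U, f =1 g} ->
  {in U, partial i f =1 partial i g}.
Proof.
move=> oU fg x; rewrite inE => Ux; apply: near_eq_derive.
exact: eq_on_near fg.
Qed.

(** Finite orders make closure under products, inverses and composition provable by induction: a
    derivative of such a function is built from functions controlled to one order less. *)
Fixpoint class_C (k : nat) U f : Prop :=
  match k with
  | 0%N => forall x, U x -> differentiable f x
  | k'.+1 => (forall x, U x -> differentiable f x) /\
             (forall i, class_C k' U (partial i f))
  end.

Lemma class_C_diff k U f : class_C k U f -> forall x, U x -> differentiable f x.
Proof. by case: k => [|k] // []. Qed.

(** [class_C] peels off the innermost derivative, which [partials] keeps at the end of its list;
    hence the induction through [rcons]. *)
Lemma smooth_onP U f : smooth_on U f <-> forall k, class_C k U f.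
Proof.
split=> [|fC s].
  move=> fs k; elim: k f fs => [|k IH] f fs.
    by move=> x; exact: (fs [::]).
  split; first by move=> x; exact: (fs [::]).
  move=> i; apply: IH => s x Ux.
  by have := fs (rcons s i) x Ux; rewrite /partials foldr_rcons.
have {}fC := fC (size s); elim/last_ind: s f fC => [|s i IH] f.
  by [].
rewrite size_rcons => -[_ /(_ i) /IH h].
by rewrite /partials foldr_rcons.
Qed.

Lemma class_C_eq k U f g : open U -> {in U, f =1 g} ->
  class_C k U f -> class_C k U g.
Proof.
move=> oU; have dfg f' g' : {in U, f' =1 g'} ->
    (forall x, U x -> differentiable f' x) -> forall x, U x -> differentiable g' x.
  move=> fg df x Ux; apply: near_eq_differentiable (df x Ux).
  exact: eq_on_near fg.
elim: k f g => [|k IH] f g fg /= ; first exact: dfg fg.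
move=> [df dfk]; split; first exact: dfg fg df.
by move=> i; apply: IH (dfk i); exact: partial_eq_on.
Qed.

Lemma class_CW k U f : class_C k.+1 U f -> class_C k U f.
Proof.
elim: k f => [|k IH] f /= [df dfk] //.
by split=> // i; apply: IH; exact: dfk.
Qed.

Lemma partial_cst i (c : R) : partial i (cst c : 'rV[R]_n -> R) = cst 0.
Proof. by apply/funext => x; rewrite /partial derive_cst. Qed.

Lemma class_C_cst k U (c : R) : class_C k U (cst c).
Proof.
elim: k c => [|k IH] c; first by move=> x _; exact: differentiable_cst.
split=> [x _|i]; first exact: differentiable_cst.
by rewrite partial_cst.
Qed.

Section Closure.
Variables (U : set 'rV[R]_n) (oU : open U).

Lemma partialD i f g x : differentiable f x -> differentiable g x ->
  partial i (f + g) x = partial i f x + partial i g x.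
Proof.
by move=> df dg; rewrite /partial deriveD //; exact: diff_derivable.
Qed.

Lemma partialM i f g x : differentiable f x -> differentiable g x ->
  partial i (f * g) x = partial i f x * g x + f x * partial i g x.
Proof.
move=> df dg; rewrite /partial deriveM; [|exact: diff_derivable..].
rewrite addrC mulrC -[X in _ + X]/(f x * _) -[X in X + _]/(g x * _).
by [].
Qed.

Lemma class_CD k f g : class_C k U f -> class_C k U g -> class_C k U (f + g).
Proof.
elim: k f g => [|k IH] f g /=.
  by move=> df dg x Ux; apply: differentiableD; [exact: df|exact: dg].
move=> [df dfk] [dg dgk]; split=> [x Ux|i].
  by apply: differentiableD; [exact: df|exact: dg].
apply: (@class_C_eq _ _ (partial i f + partial i g)) => //.
  by move=> x; rewrite inE => Ux; rewrite partialD; [|exact: df|exact: dg].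
exact: IH.
Qed.

Lemma class_CM k f g : class_C k U f -> class_C k U g -> class_C k U (f * g).
Proof.
elim: k f g => [|k IH] f g fC gC; have df := class_C_diff fC;
    have dg := class_C_diff gC.
  by move=> x Ux; apply: differentiableM; [exact: df|exact: dg].
split=> [x Ux|i]; first by apply: differentiableM; [exact: df|exact: dg].
apply: (@class_C_eq _ _ (partial i f * g + f * partial i g)) => //.
  by move=> x; rewrite inE => Ux; rewrite partialM; [|exact: df|exact: dg].
have [_ dfk] := fC; have [_ dgk] := gC.
by apply: class_CD; apply: IH;
  first [exact: dfk | exact: dgk | exact: class_CW].
Qed.

Lemma class_CN k f : class_C k U f -> class_C k U (- f).
Proof.
move=> fC; have -> : - f = cst (-1) * f.
  by apply/funext => x; rewrite !fctE /= mulN1r.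
by apply: class_CM => //; exact: class_C_cst.
Qed.

Lemma class_C_sum k (I : finType) (F : I -> 'rV[R]_n -> R) :
  (forall i, class_C k U (F i)) -> class_C k U (\sum_i F i).
Proof.
move=> FC; elim/big_ind: _ => //; first exact: class_C_cst.
exact: class_CD.
Qed.

(** The derivative of 1/f is minus the square of 1/f times that of f, so 1/f is only needed to the
    order below, which the induction provides. *)
Lemma class_CV k f : (forall x, U x -> f x != 0) -> class_C k U f ->
  class_C k U (fun x => (f x)^-1).
Proof.
move=> f0; elim: k => [|k IH] fC; have df := class_C_diff fC.
  by move=> x Ux; apply: differentiableV; [exact: df|exact: f0].
split=> [x Ux|i]; first by apply: differentiableV; [exact: df|exact: f0].
set h := fun x => (f x)^-1.
apply: (@class_C_eq _ _ (- (h * h * partial i f))) => //.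
  move=> x; rewrite inE => Ux; rewrite /partial deriveV; last 2 first.
  - exact: f0.
  - by apply: diff_derivable; exact: df.
  rewrite -[_ *: _]/(_ * _) /h !fctE /= expr2 invfM mulNr.
  by [].
have hC : class_C k U h by apply: IH; exact: class_CW.
have [_ dfk] := fC.
by apply/class_CN/class_CM; [exact: class_CM|exact: dfk].
Qed.

End Closure.
End Partials.

Section Composition.
Variables (R : realType) (m n : nat).
Implicit Types (U : set 'rV[R]_m) (V : set 'rV[R]_n).
Implicit Types (f : 'rV[R]_n -> R) (phi : 'rV[R]_m -> 'rV[R]_n).

Lemma differentiable_rV phi x :
  (forall k, differentiable (fun y => phi y 0 k) x) -> differentiable phi x.
Proof.
move=> dphi.
have -> : phi = \sum_(k < n) (fun y => phi y 0 k *: (delta_mx 0 k : 'rV[R]_n)).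
  apply/funext => y; rewrite fct_sumE; exact: row_sum_delta.
by apply: differentiable_sum => k; exact: differentiableZl.
Qed.

Lemma jacobianE phi x i k : (forall k, differentiable (fun y => phi y 0 k) x) ->
  'J phi x i k = partial i (fun y => phi y 0 k) x.
Proof.
move=> dphi; have dp := differentiable_rV dphi.
have := deriveEjacobian (basisv R i) dp.
rewrite derive_mx; last exact: diff_derivable.
rewrite /basisv -rowE => /rowP /(_ k).
by rewrite !mxE => <-.
Qed.

Lemma partial_comp i f phi x : differentiable f (phi x) ->
  (forall k, differentiable (fun y => phi y 0 k) x) ->
  partial i (f \o phi) x =
  \sum_k partial k f (phi x) * partial i (fun y => phi y 0 k) x.
Proof.
move=> df dphi; have dp := differentiable_rV dphi.
rewrite partial_diff; last exact: differentiable_comp.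
rewrite diff_comp //= [X in 'd f _ X](row_sum_delta _) linear_sum.
apply: eq_bigr => k _; rewrite linearZ /= mulrC (partial_diff k df).
congr (_ * _).
by rewrite -(jacobianE i k dphi) /jacobian mxE.
Qed.

Lemma class_C_comp k U V f phi : open U -> open V ->
  (forall x, U x -> V (phi x)) -> class_C k V f ->
  (forall l, class_C k U (fun y => phi y 0 l)) -> class_C k U (f \o phi).
Proof.
move=> oU oV UV; elim: k f => [|k IH] f fC pC.
  move=> x Ux; apply: differentiable_comp; last exact/fC/UV.
  by apply: differentiable_rV => l; exact: pC.
have dp x l : U x -> differentiable (fun y => phi y 0 l) x.
  by move=> Ux; exact: (class_C_diff (pC l)).
have [df dfk] := fC.
split=> [x Ux|i].
  apply: differentiable_comp; last exact/df/UV.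
  by apply: differentiable_rV => l; exact: dp.
apply: (@class_C_eq _ _ _ _ (\sum_l (partial l f \o phi)
    * partial i (fun y => phi y 0 l))) => //.
  move=> x; rewrite inE => Ux; rewrite fct_sumE partial_comp //.
    by apply: df; exact: UV.
  by move=> l; exact: dp.
apply: class_C_sum => // l; apply: class_CM => //.
  by apply: IH (dfk l) _ => l'; exact/class_CW/pC.
by have [_] := pC l; apply.
Qed.

End Composition.

(** * Symmetry of second partial derivatives *)

Section Schwarz.
Variables (R : realType) (n : nat).
Implicit Types (U : set 'rV[R]_n) (f : 'rV[R]_n -> R) (x y : 'rV[R]_n).

Lemma is_derive_line f y v (s : R) : differentiable f (y + s *: v) ->
  is_derive s 1 (fun s => f (y + s *: v)) ('D_v f (y + s *: v)).
Proof.
move=> df; have dv : derivable f (y + s *: v) v by exact: diff_derivable.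
have e : (fun h : R => h^-1 *: (f (y + (h *: 1 + s) *: v) - f (y + s *: v))) =
    (fun h => h^-1 *: (f (h *: v + (y + s *: v)) - f (y + s *: v))).
  apply/funext => h; congr (_ *: (f _ - _)).
  by rewrite scalerDl -[h *: 1]/(h * 1) mulr1 addrCA.
by apply: DeriveDef; rewrite /derivable /derive /= e.
Qed.

Lemma norm_basisv i : `|basisv R i : 'rV[R]_n| <= 1.
Proof.
rewrite /Num.Def.normr /= mx_normrE; apply: bigmax_le => // -[a b] _.
by rewrite mxE; case: (_ && _); rewrite ?normr1 ?normr0.
Qed.

Lemma line_MVT i f y (h : R) : 0 < h ->
  (forall s, 0 <= s <= h -> differentiable f (y + s *: basisv R i)) ->
  exists2 c, 0 < c < h &
  f (y + h *: basisv R i) - f y = partial i f (y + c *: basisv R i) * h.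
Proof.
move=> h0 df; set g := fun s => f (y + s *: basisv R i).
have gd s : 0 <= s <= h -> is_derive s 1 g (partial i f (y + s *: basisv R i)).
  by move=> /df; exact: is_derive_line.
have [||c] := @MVT R g (fun s => partial i f (y + s *: basisv R i)) 0 h h0.
- move=> s; rewrite in_itv /= => /andP[s0 sh].
  by apply: gd; rewrite !ltW.
- apply: derivable_within_continuous => s; rewrite in_itv /= => sh.
  by have [] := gd s sh.
rewrite in_itv /= => ch; rewrite /g scale0r addr0 subr0 => e.
by exists c.
Qed.

(** The mean value theorem twice: along e_i for the increment of f in the direction e_j, then along
    e_j for the i-th partial derivative. *)
Lemma second_difference i j f x (h : R) : 0 < h ->
  (forall s t, 0 <= s <= h -> 0 <= t <= h ->
     differentiable f (x + s *: basisv R i + t *: basisv R j) /\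
     differentiable (partial i f) (x + s *: basisv R i + t *: basisv R j)) ->
  exists c, exists2 c', 0 < c < h /\ 0 < c' < h &
  f (x + h *: basisv R i + h *: basisv R j) - f (x + h *: basisv R i)
    - f (x + h *: basisv R j) + f x =
  partial j (partial i f) (x + c *: basisv R i + c' *: basisv R j) * h * h.
Proof.
move=> h0 df; set u := basisv R i; set v := basisv R j.
pose F y := f (y + h *: v) - f y.
have h_in : 0 <= h <= h by apply/andP; split; [exact: ltW|].
have zero_in : (0 : R) <= 0 <= h by apply/andP; split; [exact: lexx|exact: ltW].
have dsh y : differentiable f (y + h *: v) ->
    differentiable (fun z => f (z + h *: v)) y /\
    partial i (fun z => f (z + h *: v)) y = partial i f (y + h *: v).
  move=> dfy; have dsv : differentiable (fun z => z + h *: v) y by [].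
  split; first exact: (differentiable_comp dsv).
  rewrite /partial /derive -/u.
  have -> // : (fun k : R => k^-1 *: (f (k *: u + y + h *: v) - f (y + h *: v)))
    = (fun k => k^-1 *: (f (k *: u + (y + h *: v)) - f (y + h *: v))).
  by apply/funext => k; rewrite addrA.
have dF s : 0 <= s <= h -> differentiable F (x + s *: u).
  move=> sh; apply: differentiableB.
    by have [] := dsh _ (df s h sh h_in).1.
  by have [] := df s 0 sh zero_in; rewrite scale0r addr0.
have [c ch eF] := line_MVT h0 dF.
have ch' : 0 <= c <= h by case/andP: ch => c0 ch; rewrite !ltW.
have [c' ch2 eG] := line_MVT h0 (fun t th => (df c t ch' th).2).
exists c, c' => //; rewrite -/u -/v -eG.
have -> : partial i f (x + c *: u + h *: v) - partial i f (x + c *: u)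
    = partial i F (x + c *: u).
  have d1 := (df c h ch' h_in).1.
  have d2 : differentiable f (x + c *: u).
    by have := (df c 0 ch' zero_in).1; rewrite scale0r addr0.
  have [d3 e3] := dsh _ d1.
  by rewrite -e3 /partial [RHS]deriveB //; exact: diff_derivable.
by rewrite -eF /F; ring.
Qed.

(** Both orders share the same second difference, so the two mixed derivatives take equal values at
    two points near x. If they differed at x, continuity within half the gap on each side would
    contradict the triangle inequality. *)
Theorem partialC U i j f x : open U -> U x -> class_C 2 U f ->
  partial i (partial j f) x = partial j (partial i f) x.
Proof.
move=> oU Ux [df dpf].
have cont k l : {for x, continuous (partial k (partial l f))}.
  by apply: differentiable_continuous; have [_ /(_ k)] := dpf l; apply.
have [r /= r0 xU] := (nbhs_ballP x U).1 (open_nbhs_nbhs (conj oU Ux)).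
set a := partial i (partial j f) x; set b := partial j (partial i f) x.
apply/eqP; rewrite -subr_eq0; apply/negPn/negP; rewrite -normr_gt0 => gt0.
pose e := `|a - b| / 2.
have e0 : 0 < e by rewrite divr_gt0.
have [s1 /= s10 h1] := (nbhs_ballP _ _).1 ((cvgrPdist_lt _ _).1 (cont i j) e e0).
have [s2 /= s20 h2] := (nbhs_ballP _ _).1 ((cvgrPdist_lt _ _).1 (cont j i) e e0).
(* A point x + s e_k + t e_l with s, t at most h is within 2 h of x; a third of the radius keeps 2 h
   strictly below it. *)
pose h := Num.min r (Num.min s1 s2) / 3.
have h0 : 0 < h by rewrite divr_gt0 // !lt_min r0 s10.
have hr : 2 * h < Num.min r (Num.min s1 s2).
  rewrite /h; have : 0 < Num.min r (Num.min s1 s2) by rewrite !lt_min r0 s10.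
  by move=> ?; lra.
have near_x k l (s t : R) : 0 <= s <= h -> 0 <= t <= h ->
    ball x (Num.min r (Num.min s1 s2)) (x + s *: basisv R k + t *: basisv R l).
  move=> /andP[s0 sh] /andP[t0 th].
  rewrite -ball_normE /ball_ /= -addrA opprD addrA subrr add0r normrN.
  apply: le_lt_trans hr; apply: le_trans (ler_normD _ _) _.
  rewrite !normrZ !ger0_norm // mulr_natl mulr2n.
  by apply: lerD; rewrite -[leRHS]mulr1 ler_pM // norm_basisv.
have inU k l (s t : R) : 0 <= s <= h -> 0 <= t <= h ->
    U (x + s *: basisv R k + t *: basisv R l).
  by move=> sh th; apply: xU; apply: le_ball (near_x k l s t sh th); rewrite ge_min lexx.
have [c [c' [ch ch'] ec]] := second_difference (i := i) (j := j) h0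
  (fun s t sh th => conj (df _ (inU i j s t sh th))
     ((dpf i).1 _ (inU i j s t sh th))).
have [k [k' [kh kh'] ek]] := second_difference (i := j) (j := i) h0
  (fun s t sh th => conj (df _ (inU j i s t sh th))
     ((dpf j).1 _ (inU j i s t sh th))).
have cl (z : R) : 0 < z < h -> 0 <= z <= h by case/andP => z0 zh; rewrite !ltW.
have eq1 : partial j (partial i f) (x + c *: basisv R i + c' *: basisv R j) =
    partial i (partial j f) (x + k *: basisv R j + k' *: basisv R i).
  apply: (mulIf (lt0r_neq0 h0)); apply: (mulIf (lt0r_neq0 h0)).
  apply: (etrans (esym ec)); apply: (etrans _ ek).
  rewrite (addrAC x (h *: basisv R j)); congr (_ + _).
  exact: addrAC.
have /h1 d1 : ball x s1 (x + k *: basisv R j + k' *: basisv R i).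
  apply: le_ball (near_x j i k k' (cl _ kh) (cl _ kh')).
  by rewrite !ge_min lexx orbT.
have /h2 d2 : ball x s2 (x + c *: basisv R i + c' *: basisv R j).
  apply: le_ball (near_x i j c c' (cl _ ch) (cl _ ch')).
  by rewrite !ge_min lexx !orbT.
rewrite eq1 in d2.
have := le_lt_trans (ler_normB _ _) (ltrD d1 d2).
rewrite opprB addrA subrK -/a -/b /e -splitr ltxx.
by [].
Qed.

End Schwarz.

(** * The ring of smooth functions on an open set *)

Record open_set (R : realType) (n : nat) := OpenSet {
  open_dom :> set 'rV[R]_n;
  open_domP : open open_dom
}.

Section SmoothRing.
Variables (R : realType) (n : nat) (O : open_set R n).
Local Notation U := (open_dom O).
Implicit Types (x : 'rV[R]_n).

(* The value 0 outside of U makes Leibniz equality the equality of functions on U. *)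
Record smooth_fun := SmoothFun {
  sf_val :> 'rV[R]_n -> R;
  sf_smooth : smooth_on U sf_val;
  sf_out : forall x, ~ U x -> sf_val x = 0
}.

HB.instance Definition _ := gen_eqMixin smooth_fun.
HB.instance Definition _ := gen_choiceMixin smooth_fun.

Lemma smooth_funP (f g : smooth_fun) : (forall x, U x -> f x = g x) -> f = g.
Proof.
case: f g => [f fs f0] [g gs g0] /= fg.
have {}fg : f = g.
  apply/funext => x; have [/fg //|nUx] := pselect (U x).
  by rewrite f0 // g0.
by case: _ / fg in gs g0 *; congr SmoothFun; exact: Prop_irrelevance.
Qed.

Definition restr (f : 'rV[R]_n -> R) x := if pselect (U x) then f x else 0.

Lemma restrE f x : U x -> restr f x = f x.
Proof. by rewrite /restr; case: pselect. Qed.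

Lemma restr_out f x : ~ U x -> restr f x = 0.
Proof. by rewrite /restr; case: pselect. Qed.

Lemma smooth_on_eq f g : {in U, f =1 g} -> smooth_on U f -> smooth_on U g.
Proof.
move=> fg /smooth_onP fC; apply/smooth_onP => k.
exact: (class_C_eq (open_domP (o := O)) fg (fC k)).
Qed.

Lemma restr_smooth f : smooth_on U f -> smooth_on U (restr f).
Proof. by apply: smooth_on_eq => x; rewrite inE => Ux; rewrite restrE. Qed.

Definition sf_of f (fs : smooth_on U f) : smooth_fun :=
  SmoothFun (restr_smooth fs) (@restr_out f).

Lemma sf_ofE f (fs : smooth_on U f) x : U x -> sf_of fs x = f x.
Proof. exact: restrE. Qed.

Lemma smooth_cst (c : R) : smooth_on U (cst c).
Proof. by apply/smooth_onP => k; exact: class_C_cst. Qed.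

Lemma smooth_add f g : smooth_on U f -> smooth_on U g -> smooth_on U (f + g).
Proof.
move=> /smooth_onP fC /smooth_onP gC; apply/smooth_onP => k.
by apply: class_CD; [exact: open_domP|exact: fC|exact: gC].
Qed.

Lemma smooth_mul f g : smooth_on U f -> smooth_on U g -> smooth_on U (f * g).
Proof.
move=> /smooth_onP fC /smooth_onP gC; apply/smooth_onP => k.
by apply: class_CM; [exact: open_domP|exact: fC|exact: gC].
Qed.

Lemma smooth_opp f : smooth_on U f -> smooth_on U (- f).
Proof.
move=> /smooth_onP fC; apply/smooth_onP => k.
by apply: class_CN; [exact: open_domP|exact: fC].
Qed.

Lemma smooth_inv f : (forall x, U x -> f x != 0) -> smooth_on U f ->
  smooth_on U (fun x => (f x)^-1).
Proof.
move=> f0 /smooth_onP fC; apply/smooth_onP => k.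
by apply: class_CV; [exact: open_domP|exact: f0|exact: fC].
Qed.

Lemma smooth_partial i f : smooth_on U f -> smooth_on U (partial i f).
Proof.
by move=> /smooth_onP fC; apply/smooth_onP => k; have [_] := fC k.+1; apply.
Qed.

Definition sf_zero := sf_of (smooth_cst 0).
Definition sf_one := sf_of (smooth_cst 1).
Definition sf_add (f g : smooth_fun) := sf_of (smooth_add (sf_smooth f) (sf_smooth g)).
Definition sf_mul (f g : smooth_fun) := sf_of (smooth_mul (sf_smooth f) (sf_smooth g)).
Definition sf_opp (f : smooth_fun) := sf_of (smooth_opp (sf_smooth f)).

Lemma sf_zeroE x : U x -> sf_zero x = 0. Proof. exact: sf_ofE. Qed.
Lemma sf_oneE x : U x -> sf_one x = 1. Proof. exact: sf_ofE. Qed.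
Lemma sf_addE f g x : U x -> sf_add f g x = f x + g x. Proof. exact: sf_ofE. Qed.
Lemma sf_mulE f g x : U x -> sf_mul f g x = f x * g x. Proof. exact: sf_ofE. Qed.
Lemma sf_oppE f x : U x -> sf_opp f x = - f x. Proof. exact: sf_ofE. Qed.

Let sfE := (sf_zeroE, sf_oneE, sf_addE, sf_mulE, sf_oppE).

Fact sf_addA : associative sf_add.
Proof. by move=> f g h; apply: smooth_funP => x Ux; rewrite !sfE // addrA. Qed.
Fact sf_addC : commutative sf_add.
Proof. by move=> f g; apply: smooth_funP => x Ux; rewrite !sfE // addrC. Qed.
Fact sf_add0 : left_id sf_zero sf_add.
Proof. by move=> f; apply: smooth_funP => x Ux; rewrite !sfE // add0r. Qed.
Fact sf_addN : left_inverse sf_zero sf_opp sf_add.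
Proof. by move=> f; apply: smooth_funP => x Ux; rewrite !sfE // addNr. Qed.
Fact sf_mulA : associative sf_mul.
Proof. by move=> f g h; apply: smooth_funP => x Ux; rewrite !sfE // mulrA. Qed.
Fact sf_mulC : commutative sf_mul.
Proof. by move=> f g; apply: smooth_funP => x Ux; rewrite !sfE // mulrC. Qed.
Fact sf_mul1 : left_id sf_one sf_mul.
Proof. by move=> f; apply: smooth_funP => x Ux; rewrite !sfE // mul1r. Qed.
Fact sf_mulDl : left_distributive sf_mul sf_add.
Proof. by move=> f g h; apply: smooth_funP => x Ux; rewrite !sfE // mulrDl. Qed.

HB.instance Definition _ :=
  GRing.isZmodule.Build smooth_fun sf_addA sf_addC sf_add0 sf_addN.

Fact sf_mulr1 : right_id sf_one sf_mul.
Proof. by move=> f; rewrite sf_mulC sf_mul1. Qed.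
Fact sf_mulDr : right_distributive sf_mul sf_add.
Proof. by move=> f g h; rewrite !(sf_mulC f) sf_mulDl. Qed.

HB.instance Definition _ := GRing.Zmodule_isPzRing.Build smooth_fun
  sf_mulA sf_mul1 sf_mulr1 sf_mulDl sf_mulDr.
HB.instance Definition _ :=
  GRing.PzRing_hasCommutativeMul.Build smooth_fun sf_mulC.

Definition ev x (Ux : U x) (f : smooth_fun) : R := f x.

Fact ev_additive x (Ux : U x) : zmod_morphism (ev Ux).
Proof. by move=> f g; rewrite /ev sf_addE // sf_oppE. Qed.
HB.instance Definition _ x (Ux : U x) :=
  GRing.isZmodMorphism.Build _ _ (ev Ux) (ev_additive Ux).
Fact ev_multiplicative x (Ux : U x) : monoid_morphism (ev Ux).
Proof. by split=> [|f g]; rewrite /ev ?sf_oneE ?sf_mulE. Qed.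
HB.instance Definition _ x (Ux : U x) :=
  GRing.isMonoidMorphism.Build _ _ (ev Ux) (ev_multiplicative Ux).

Definition sf_der i (f : smooth_fun) := sf_of (smooth_partial i (sf_smooth f)).

Lemma partial_congr i (f g : 'rV[R]_n -> R) x : U x -> (forall y, U y -> f y = g y) ->
  partial i f x = partial i g x.
Proof.
move=> Ux fg; have h : {in U, f =1 g} by move=> y; rewrite inE => /fg.
by have := partial_eq_on i (open_domP (o := O)) h; apply; rewrite inE.
Qed.

Lemma sf_diff (f : smooth_fun) x : U x -> differentiable f x.
Proof. by move=> Ux; exact: (@sf_smooth f [::] x Ux). Qed.

Fact sf_derD i (f g : smooth_fun) : sf_der i (f + g) = sf_der i f + sf_der i g.
Proof.
apply: smooth_funP => x Ux; rewrite sf_addE // !sf_ofE //.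
transitivity (partial i ((f : _ -> R) + g) x).
  by apply: partial_congr => // y Uy; rewrite sf_addE.
by apply: partialD; exact: sf_diff.
Qed.

Fact sf_derM i (f g : smooth_fun) :
  sf_der i (f * g) = sf_der i f * g + f * sf_der i g.
Proof.
apply: smooth_funP => x Ux; rewrite sf_addE // !sf_mulE // !sf_ofE //.
transitivity (partial i ((f : _ -> R) * g) x).
  by apply: partial_congr => // y Uy; rewrite sf_mulE.
by apply: partialM; exact: sf_diff.
Qed.

Fact sf_derC i j (f : smooth_fun) : sf_der i (sf_der j f) = sf_der j (sf_der i f).
Proof.
apply: smooth_funP => x Ux.
have der_on k l : sf_der k (sf_der l f) x = partial k (partial l f) x.
  rewrite (sf_ofE _ Ux); apply: (partial_congr _ Ux) => y Uy.
  exact: (sf_ofE _ Uy).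
apply: (etrans (der_on i j)); apply: (etrans _ (esym (der_on j i))).
apply: (partialC i j (open_domP (o := O)) Ux).
exact: ((smooth_onP _ _).1 (sf_smooth f)).
Qed.

Definition sf_derivations : derivations smooth_fun n :=
  Derivations sf_derD sf_derM sf_derC.

Lemma sf_derE i f (a : smooth_fun) x : U x -> (forall y, U y -> f y = a y) ->
  partial i f x = sf_derivations i a x.
Proof. by move=> Ux fa; rewrite sf_ofE //; exact: partial_congr. Qed.

Lemma smooth_fun_torsion_free m (a : smooth_fun) : m.+1%:R * a = 0 -> a = 0.
Proof.
move=> ma; apply: smooth_funP => x Ux.
have := congr1 (ev Ux) ma; rewrite rmorphM rmorph_nat rmorph0 => /eqP.
rewrite mulf_eq0 pnatr_eq0 => /eqP a0.
by apply: (etrans a0); rewrite sf_zeroE.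
Qed.

Lemma smooth_fun_reduced (a : smooth_fun) : a * a = 0 -> a = 0.
Proof.
move=> aa; apply: smooth_funP => x Ux.
have := congr1 (ev Ux) aa; rewrite rmorphM rmorph0 => /eqP.
rewrite mulf_eq0 orbb => /eqP a0.
by apply: (etrans a0); rewrite sf_zeroE.
Qed.

Definition sf_half := sf_of (smooth_cst 2^-1).

Lemma sf_half2 : 2 * sf_half = 1.
Proof.
apply: smooth_funP => x Ux.
have := rmorphM (ev Ux) 2 sf_half; rewrite rmorph_nat => h.
have e : ev Ux sf_half = 2^-1 := sf_ofE _ Ux.
apply: (etrans h); apply: (etrans (congr1 ( *%R 2) e)).
by rewrite divff ?pnatr_eq0 // [RHS]sf_oneE.
Qed.

Lemma smooth_fun_inv (a : smooth_fun) : (forall x, U x -> a x != 0) ->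
  exists b : smooth_fun, a * b = 1.
Proof.
move=> a0; exists (sf_of (smooth_inv a0 (sf_smooth a))).
by apply: smooth_funP => x Ux; rewrite sf_mulE // [RHS](sf_oneE Ux) (sf_ofE _ Ux) divff ?a0.
Qed.

Definition sf_mx p q (A : 'rV[R]_n -> 'M[R]_(p, q)) (As : smooth_mx_on U A) :
  'M[smooth_fun]_(p, q) := \matrix_(i, j) sf_of (As i j).

Lemma sf_mxE p q (A : 'rV[R]_n -> 'M[R]_(p, q)) (As : smooth_mx_on U A) x
  (Ux : U x) : map_mx (ev Ux) (sf_mx As) = A x.
Proof. by apply/matrixP => i j; rewrite !mxE /ev sf_ofE. Qed.

Lemma sf_mxP p q (A B : 'M[smooth_fun]_(p, q)) :
  (forall x (Ux : U x), map_mx (ev Ux) A = map_mx (ev Ux) B) -> A = B.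
Proof.
move=> AB; apply/matrixP => i j; apply: smooth_funP => x Ux.
by have /matrixP/(_ i j) := AB x Ux; rewrite !mxE.
Qed.

(** A determinant without zeros is a unit, and the adjugate supplies the rest. *)
Lemma sf_mx_inv m (A : 'M[smooth_fun]_m) :
  (forall x (Ux : U x), map_mx (ev Ux) A \in unitmx) ->
  exists B, A *m B = 1%:M.
Proof.
move=> Au; have [x Ux|b detb] := @smooth_fun_inv (\det A).
  by have := Au x Ux; rewrite unitmxE det_map_mx unitfE.
by exists (b *: \adj A); rewrite -scalemxAr mul_mx_adj scale_scalar_mx mulrC detb.
Qed.

Lemma ev_invmx m (A B : 'M[smooth_fun]_m) x (Ux : U x) : A *m B = 1%:M ->
  map_mx (ev Ux) B = invmx (map_mx (ev Ux) A).
Proof.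
move=> /(congr1 (map_mx (ev Ux))); rewrite map_mxM map_mx1 => AB.
have [Au _] := mulmx1_unit AB.
by rewrite -[LHS]mul1mx -(mulVmx Au) -mulmxA AB mulmx1.
Qed.

End SmoothRing.

Arguments ev : simpl never.

Section Evaluation.
Variables (R : realType) (n : nat) (O : open_set R n).
Local Notation U := (open_dom O).
Local Notation A := (smooth_fun O).
Local Notation d := (sf_derivations O).

(** The bridge from functions in a chart to the ring. Agreement on U suffices for derivatives, since
    U is open; outside it f is arbitrary while the entries of F vanish. *)
Definition represents p q (f : 'rV[R]_n -> 'M[R]_(p, q)) (F : 'M[A]_(p, q)) :=
  forall y (Uy : U y), f y = map_mx (ev Uy) F.

Lemma represents_sf_mx p q (f : 'rV[R]_n -> 'M[R]_(p, q))
  (fs : smooth_mx_on U f) : represents f (sf_mx fs).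
Proof. by move=> y Uy; rewrite sf_mxE. Qed.

Lemma represents_const p q (M : 'M[R]_(p, q)) :
  represents (fun=> M) (\matrix_(i, j) sf_of (smooth_cst (O := O) (M i j))).
Proof.
by move=> y Uy; apply/matrixP => i j; rewrite !mxE; apply/esym/(sf_ofE _ Uy).
Qed.

Lemma partial_represents p q f (F : 'M[A]_(p, q)) i k l x (Ux : U x) :
  represents f F -> partial i (fun y => f y k l) x = ev Ux (d i (F k l)).
Proof.
by move=> fF; apply: sf_derE => // y Uy; rewrite (fF y Uy) mxE.
Qed.

Lemma lie_bracket_represents X Y (X' Y' : 'rV[A]_n) : represents X X' ->
  represents Y Y' -> represents (lie_bracket X Y) (cbr d X' Y').
Proof.
move=> hX hY y Uy; apply/rowP => k; rewrite !mxE rmorph_sum /=.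
apply: eq_bigr => i _; rewrite rmorphB !rmorphM /=.
by rewrite (partial_represents i 0 k Uy hX) (partial_represents i 0 k Uy hY)
  (hX y Uy) (hY y Uy) !mxE.
Qed.

Section Metric.
Variables (G : 'rV[R]_n -> 'M[R]_n) (G' Gi : 'M[A]_n).
Hypotheses (hG : represents G G') (GGi : G' *m Gi = 1%:M).
Local Notation hf := (sf_half O).

Lemma represents_invmx : represents (fun y => invmx (G y)) Gi.
Proof. by move=> y Uy; rewrite (hG Uy) (ev_invmx Uy GGi). Qed.

Lemma christoffel_ev k i j x (Ux : U x) :
  christoffel G k i j x = ev Ux (cgamma d G' Gi hf k i j).
Proof.
rewrite /christoffel /cgamma rmorphM rmorph_sum /=; congr (_ * _).
  exact/esym/(sf_ofE _ Ux).
apply: eq_bigr => l _; rewrite rmorphM rmorphB rmorphD /=; congr (_ * _).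
  by have := represents_invmx Ux => ->; rewrite mxE.
by rewrite (partial_represents i j l Ux hG) (partial_represents j i l Ux hG)
  (partial_represents l i j Ux hG).
Qed.

Lemma nabla_represents X Y (X' Y' : 'rV[A]_n) : represents X X' ->
  represents Y Y' -> represents (nabla G X Y) (cnab d G' Gi hf X' Y').
Proof.
move=> hX hY y Uy; apply/rowP => k; rewrite !mxE rmorphD !rmorph_sum /=.
congr (_ + _); apply: eq_bigr => i _.
  by rewrite rmorphM (partial_represents i 0 k Uy hY) (hX y Uy) mxE.
rewrite rmorph_sum; apply: eq_bigr => j _.
have := christoffel_ev k i j Uy; move: (cgamma _ _ _ _ _ _ _) => c ->.
by rewrite !rmorphM (hX y Uy) (hY y Uy) !mxE.
Qed.

Hypothesis (G'sym : G'^T = G').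
Local Notation C := (coordinate_connection d (sf_half2 O) G'sym GGi).

Lemma curvature_represents X Y Z (X' Y' Z' : 'rV[A]_n) : represents X X' ->
  represents Y Y' -> represents Z Z' ->
  represents (curvature G X Y Z) (curv C X' Y' Z').
Proof.
move=> hX hY hZ y Uy; rewrite /curvature /curv !map_mxB /=.
congr (_ - _ - _).
- exact: (nabla_represents hX (nabla_represents hY hZ)).
- exact: (nabla_represents hY (nabla_represents hX hZ)).
- exact: (nabla_represents (lie_bracket_represents hX hY) hZ).
Qed.

Lemma represents_coordinate_field i :
  represents (@coordinate_field R n i) (delta_mx 0 i : 'rV[A]_n).
Proof. by move=> y Uy; rewrite map_delta_mx. Qed.

Lemma ricci_represents :
  represents (ricci G) (cricci d (sf_half2 O) G'sym GGi).
Proof.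
move=> x Ux; apply/matrixP => j k; rewrite !mxE rmorph_sum /=.
apply: eq_bigr => i _; have hc := @represents_coordinate_field.
by rewrite (curvature_represents (hc i) (hc j) (hc k) Ux) mxE.
Qed.

Lemma riemann_ev x (Ux : U x) i j k l : riemann G x i j k l =
  ev Ux (rm C (delta_mx 0 i) (delta_mx 0 j) (delta_mx 0 k) (delta_mx 0 l)).
Proof.
have hc := @represents_coordinate_field.
rewrite /riemann (curvature_represents (hc i) (hc j) (hc k) Ux) (hG Ux) /bil.
rewrite /basisv -(map_delta_mx (ev Ux)) map_trmx -!map_mxM mxE.
by [].
Qed.

End Metric.
End Evaluation.

(** * The fundamental form and the Hodge operator *)

Section HodgeLinearAlgebra.
Variable R : realType.
Implicit Types (al be : 'M[R]_4).

(** With one argument raised and both skew this is twice the inner product of 2-forms, each pair of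
    indices being counted twice. *)
Definition dot be al : R := \sum_a \sum_b be a b * al a b.

Lemma dotE be al : dot be al = \tr (be *m al^T).
Proof.
rewrite /dot /mxtrace; apply: eq_bigr => a _; rewrite mxE.
by apply: eq_bigr => b _; rewrite mxE.
Qed.

Lemma contract13_24 be al (F : 'M[R]_4) c d :
  \sum_a \sum_b be a b * (al a c * F b d) = (al^T *m be *m F) c d.
Proof.
rewrite mxE exchange_big; apply: eq_bigr => b _.
rewrite mxE mulr_suml; apply: eq_bigr => a _; rewrite mxE; ring.
Qed.

Lemma contract_wedge al be (F : 'M[R]_4) a b : al^T = - al -> be^T = - be ->
  F^T = - F -> be *m F = 1%:M ->
  (forall a b c d, al a b * F c d - al a c * F b d + al a d * F b c
    + al b c * F a d - al b d * F a c + al c d * F a b = 0) ->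
  dot al be * F a b = 0.
Proof.
move=> als bes FN bF T0; have Fb : F *m be = 1%:M by exact: mulmx1C.
have cE : dot be F = - 4 by rewrite dotE FN mulmxN bF raddfN /= mxtrace1.
have dE : dot al be = dot be al.
  by rewrite /dot; apply: eq_bigr => x _; apply: eq_bigr => y _; rewrite mulrC.
have k1 : \sum_c \sum_d be c d * (al a c * F b d) = - al a b.
  have -> : \sum_c \sum_d be c d * (al a c * F b d) = (al *m be *m F^T) a b.
    rewrite mxE exchange_big; apply: eq_bigr => d _; rewrite mxE mulr_suml.
    by apply: eq_bigr => c _; rewrite mxE; ring.
  by rewrite FN mulmxN -mulmxA bF mulmx1 mxE.
have k2 : \sum_c \sum_d be c d * (al a d * F b c) = al a b.
  have -> : \sum_c \sum_d be c d * (al a d * F b c) = (al *m be^T *m F^T) a b.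
    rewrite mxE; apply: eq_bigr => c _; rewrite mxE mulr_suml.
    by apply: eq_bigr => d _; rewrite !mxE; ring.
  by rewrite FN bes !(mulmxN, mulNmx) opprK -mulmxA bF mulmx1.
have k3 : \sum_c \sum_d be c d * (al b c * F a d) = al a b.
  have -> : \sum_c \sum_d be c d * (al b c * F a d) = (F *m be^T *m al^T) a b.
    rewrite mxE; apply: eq_bigr => c _; rewrite mxE mulr_suml.
    by apply: eq_bigr => d _; rewrite !mxE; ring.
  by rewrite als bes !(mulmxN, mulNmx) opprK Fb mul1mx.
have k4 : \sum_c \sum_d be c d * (al b d * F a c) = - al a b.
  have -> : \sum_c \sum_d be c d * (al b d * F a c) = (F *m be *m al^T) a b.
    rewrite mxE exchange_big; apply: eq_bigr => d _; rewrite mxE mulr_suml.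
    by apply: eq_bigr => c _; rewrite mxE; ring.
  by rewrite als mulmxN Fb mul1mx mxE.
have k0 : \sum_c \sum_d be c d * (al a b * F c d) = - 4 * al a b.
  rewrite -cE /dot mulr_suml; apply: eq_bigr => c _; rewrite mulr_suml.
  by apply: eq_bigr => d _; ring.
have k5 : \sum_c \sum_d be c d * (al c d * F a b) = dot al be * F a b.
  rewrite dE /dot mulr_suml; apply: eq_bigr => c _; rewrite mulr_suml.
  by apply: eq_bigr => d _; ring.
have : \sum_c \sum_d be c d * (al a b * F c d - al a c * F b d + al a d * F b c
    + al b c * F a d - al b d * F a c + al c d * F a b) = 0.
  by rewrite big1 // => c _; rewrite big1 // => d _; rewrite T0 mulr0.
have -> : \sum_c \sum_d be c d * (al a b * F c d - al a c * F b d + al a d * F b c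
    + al b c * F a d - al b d * F a c + al c d * F a b) =
  \sum_c \sum_d be c d * (al a b * F c d)
  - \sum_c \sum_d be c d * (al a c * F b d)
  + \sum_c \sum_d be c d * (al a d * F b c)
  + \sum_c \sum_d be c d * (al b c * F a d)
  - \sum_c \sum_d be c d * (al b d * F a c)
  + \sum_c \sum_d be c d * (al c d * F a b).
  rewrite -!(sumrB, big_split); apply: eq_bigr => c _ /=.
  rewrite -!(sumrB, big_split); apply: eq_bigr => d _ /=; ring.
rewrite k0 k1 k2 k3 k4 k5.
by move=> h; lra.
Qed.

Lemma mx_neq0P (M : 'M[R]_4) : M != 0 -> exists c d, M c d != 0.
Proof.
move=> M0; apply: contrapT => h; case/eqP: M0; apply/matrixP => c d.
rewrite mxE; apply/eqP/negPn/negP => Mcd; apply: h; by exists c, d.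
Qed.

Variables (g P : 'M[R]_4) (o : R).
Hypotheses (gsym : g^T = g) (gu : g \in unitmx) (PP : P *m P = 1%:M)
  (PG : P *m g = - (g *m P^T)).
Local Notation F := (g *m P^T).
Local Notation r2 := (raise2 g).

Let gisym : (invmx g)^T = invmx g.
Proof. by rewrite trmx_inv gsym. Qed.

Lemma F_skew : F^T = - F.
Proof. by rewrite trmx_mul trmxK gsym PG. Qed.

Let PPT : P^T *m P^T = 1%:M.
Proof. by rewrite -trmx_mul PP trmx1. Qed.

Lemma raise2_F : r2 F = P^T *m invmx g.
Proof. by rewrite /raise2 gisym mulmxA mulVmx // mul1mx. Qed.

Lemma raise2_F_inv : r2 F *m F = 1%:M.
Proof. by rewrite raise2_F -mulmxA (mulmxA (invmx g)) mulVmx // mul1mx PPT. Qed.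

Lemma raise2_skew al : al^T = - al -> (r2 al)^T = - r2 al.
Proof.
by move=> h; rewrite /raise2 !trmx_mul trmxK h mulNmx mulmxN mulmxA gisym.
Qed.

Lemma dot_raise2 al be : dot (r2 al) be = dot al (r2 be).
Proof.
rewrite !dotE /raise2 !trmx_mul !trmxK gisym.
by rewrite -!mulmxA mxtrace_mulC !mulmxA.
Qed.

Lemma dot_F : dot (r2 F) F = - 4.
Proof. by rewrite dotE F_skew mulmxN raise2_F_inv raddfN /= mxtrace1. Qed.

Lemma F_raise2_F al : F^T *m r2 al *m F = P *m al *m P^T.
Proof.
rewrite /raise2 gisym trmx_mul trmxK gsym -!mulmxA; congr (_ *m _).
by rewrite mulKVmx // mulKmx.
Qed.

Lemma F_neq0 : F != 0.
Proof.
apply/eqP => F0; have := raise2_F_inv; rewrite F0 mulmx0 => /matrixP/(_ 0 0).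
by rewrite !mxE /= => /eqP; rewrite eq_sym oner_eq0.
Qed.

Let F_diag i : F i i = 0.
Proof.
have /matrixP/(_ i i) := F_skew; rewrite [LHS]mxE [RHS]mxE => h.
by move: h; move: (F i i) => x; lra.
Qed.

Let F_anti i j : F j i = - F i j.
Proof. by have /matrixP/(_ i j) := F_skew; rewrite [LHS]mxE [RHS]mxE. Qed.

(* The full antisymmetrisation of F (x) F is pfaffian F times the Levi-Civita symbol,
   so that the Hodge star is a contraction with F /\ F up to a scalar. *)
Let hodge_pfaffian al c d : al^T = - al ->
  pfaffian F * hodge g o al c d = o * Num.sqrt `|\det g| *
   (2^-1 * dot (r2 al) F * F c d - (P *m al *m P^T) c d).
Proof.
move=> als; rewrite mxE; set v0 := o * _.
have h : \sum_a \sum_b r2 al a b * (F a b * F c d - F a c * F b d + F a d * F b c)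
   = dot (r2 al) F * F c d - (P *m al *m P^T) c d *+ 2.
  have -> : dot (r2 al) F * F c d = \sum_a \sum_b r2 al a b * (F a b * F c d).
    rewrite /dot mulr_suml; apply: eq_bigr => a _; rewrite mulr_suml.
    by apply: eq_bigr => b _; rewrite mulrA.
  have e1 := contract13_24 (r2 al) F F c d.
  have e2 := contract13_24 (r2 al) F F d c.
  rewrite F_raise2_F in e1; rewrite F_raise2_F in e2.
  have e3 : (P *m al *m P^T) d c = - (P *m al *m P^T) c d.
    rewrite -[LHS](mxE trmx_key (fun i j => (P *m al *m P^T) j i)) -/(trmx _).
    by rewrite !trmx_mul trmxK als mulNmx mulmxN mulmxA mxE.
  rewrite mulr2n opprD addrA -{1}e1 -[X in _ - X]opprK -e3 -e2 opprK.
  rewrite -sumrB -big_split; apply: eq_bigr => a _ /=.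
  rewrite -sumrB -big_split; apply: eq_bigr => b _ /=; ring.
transitivity (2^-1 * v0 * \sum_a \sum_b
    r2 al a b * (F a b * F c d - F a c * F b d + F a d * F b c)).
  rewrite mulrCA -mulrA; congr (_ * _); rewrite !mulr_sumr.
  apply: eq_bigr => a _; rewrite !mulr_sumr; apply: eq_bigr => b _.
  rewrite (pfaffian_det _ _ _ _ F_diag F_anti) /volume /levi_civita_symbol -/v0.
  ring.
by rewrite h -mulr_natl; field.
Qed.

Hypothesis Fsd : hodge g o F = F.

Let PFP : P *m F *m P^T = - F.
Proof. by rewrite mulmxA PG !mulNmx -!mulmxA PPT mulmx1. Qed.

(** [hodge_pfaffian] applied to F itself, with [dot_F] and P F P^T = - F: the choice of orientation
    fixes the sign of the Pfaffian. Were it zero, the volume factor would vanish, and with it the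
    Hodge dual of F, which is F. *)
Let pfE : pfaffian F = - (o * Num.sqrt `|\det g|) /\ pfaffian F != 0.
Proof.
set v0 := o * _.
have key c d : pfaffian F * F c d = - v0 * F c d.
  have NE (M : 'M[R]_4) : (- M) c d = - M c d by rewrite mxE.
  by have := hodge_pfaffian c d F_skew; rewrite Fsd dot_F PFP NE -/v0 => ->; field.
have [c [d Fcd]] := mx_neq0P F_neq0.
split; first exact: (mulIf Fcd (key c d)).
apply/eqP => pf0; have v00 : v0 = 0.
  by apply/eqP; rewrite -oppr_eq0 -(mulIf Fcd (key c d)) pf0.
case/eqP: Fcd; rewrite -Fsd mxE big1 ?mulr0 // => a _; rewrite big1 // => b _.
by rewrite /volume -/v0 v00 mul0r mulr0.
Qed.

Lemma hodge_para al : al^T = - al ->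
  hodge g o al = P *m al *m P^T - (2^-1 * dot (r2 al) F) *: F.
Proof.
move=> als; have [pf pf0] := pfE; apply/matrixP => c d.
have subE (M N : 'M[R]_4) k : (M - k *: N) c d = M c d - k * N c d.
  by rewrite !mxE.
by apply: (mulfI pf0); rewrite hodge_pfaffian // subE pf; ring.
Qed.

(** Type (1, 1) means P al P^T = - al; then the first summand drops out and a multiple of F
    remains. *)
Lemma self_dual_part_para al : al^T = - al -> self_dual_part g o al =
  2^-1 *: (al + P *m al *m P^T) - (4^-1 * dot (r2 al) F) *: F.
Proof.
move=> als; rewrite /self_dual_part hodge_para // addrA scalerBr scalerA.
by congr (_ - _ *: _); field.
Qed.

Lemma wedge_F_eq0 al : al^T = - al ->
  (forall a b c d, al a b * F c d - al a c * F b d + al a d * F b c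
    + al b c * F a d - al b d * F a c + al c d * F a b = 0) ->
  dot (r2 al) F = 0.
Proof.
move=> als T0; rewrite dot_raise2.
have [a [b Fab]] := mx_neq0P F_neq0.
apply: (mulIf Fab); rewrite mul0r.
by apply: contract_wedge => //; [apply: raise2_skew; exact: F_skew
  |exact: F_skew|exact: raise2_F_inv].
Qed.

End HodgeLinearAlgebra.

(** * Eigenframes of P at a point *)

Lemma det_mx2 (A : comPzRingType) (M : 'M[A]_2) :
  \det M = M 0 0 * M 1 1 - M 0 1 * M 1 0.
Proof.
rewrite (expand_det_row _ 0) !big_ord_recl big_ord0 /cofactor !det_mx11.
rewrite !mxE /= expr0 expr1 addr0 mul1r mulN1r mulrN.
by congr (M _ _ * M _ _ - M _ _ * M _ _); apply/val_inj.
Qed.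

Section Eigenframe.
Variables (R : realType) (g P : 'M[R]_4).
Hypotheses (gu : g \in unitmx) (gsym : g^T = g) (PP : P *m P = 1%:M)
  (PG : P *m g = - (g *m P^T)).
Hypotheses (rk1 : \rank (eigenspace P 1) = 2%N)
  (rk2 : \rank (eigenspace P (-1)) = 2%N).

Lemma eigenspace_base (a : R) : \rank (eigenspace P a) = 2%N ->
  exists2 E : 'M[R]_(2, 4), row_free E & (E :=: eigenspace P a)%MS.
Proof.
move=> rk; have : exists2 E : 'M[R]_(\rank (eigenspace P a), 4),
    row_free E & (E :=: eigenspace P a)%MS.
  exists (row_base (eigenspace P a)); first exact: row_base_free.
  exact: eq_row_base.
by rewrite rk.
Qed.

Lemma isotropic_eigen (b : bool) (x y : 'rV[R]_4) : x *m P = (-1) ^+ b *: x ->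
  y *m P = (-1) ^+ b *: y -> bform g x y = 0.
Proof.
move=> hx hy; have : bform g (x *m P) y = - bform g x (y *m P).
  by rewrite /bform -(mulmxA x) PG mulmxN mulNmx mxE trmx_mul !mulmxA.
rewrite hx hy bformZl bformZr => h.
have : (-1) ^+ b * bform g x y *+ 2 = 0 by rewrite mulr2n {1}h addNr.
by move/eqP; rewrite mulrn_eq0 /= mulf_eq0 signr_eq0 => /eqP.
Qed.

(** Both eigenspaces are isotropic, so a vector of the first that is orthogonal to the second is
    orthogonal to everything and vanishes. Hence the 2 x 2 pairing matrix between them is
    invertible. *)
Lemma eigenframe : exists u1 u2 v1 v2 : 'rV[R]_4,
  [/\ [/\ u1 *m P = u1, u2 *m P = u2, v1 *m P = - v1 & v2 *m P = - v2],
    bform g u1 v1 * bform g u2 v2 - bform g u1 v2 * bform g u2 v1 != 0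
  & forall z, exists a1 a2 b1 b2,
      z = a1 *: u1 + a2 *: u2 + (b1 *: v1 + b2 *: v2)].
Proof.
have [E Efree Espan] := eigenspace_base rk1.
have [E' E'free E'span] := eigenspace_base rk2.
have EP : E *m P = E.
  have /eigenspaceP -> : (E <= eigenspace P 1)%MS by rewrite -Espan.
  by rewrite scale1r.
have E'P : E' *m P = - E'.
  have /eigenspaceP -> : (E' <= eigenspace P (-1))%MS by rewrite -E'span.
  by rewrite scaleN1r.
have rowE2 (D : 'M[R]_(2, 4)) (c : 'rV[R]_2) :
    c *m D = c 0 0 *: row 0 D + c 0 1 *: row 1 D.
  by rewrite mulmx_sum_row !big_ord_recl big_ord0 addr0; congr (_ + c 0 _ *: row _ D);
    apply/val_inj.
have decomp (z : 'rV[R]_4) : exists c c', z = c *m E + c' *m E'.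
  have zp : z + z *m P = (z + z *m P) *m P.
    by rewrite mulmxDl -mulmxA PP mulmx1 addrC.
  have zm : - (z - z *m P) = (z - z *m P) *m P.
    by rewrite mulmxBl -mulmxA PP mulmx1 opprB.
  have /submxP [c hc] : ((z + z *m P)%R <= E)%MS.
    by rewrite Espan; apply/eigenspaceP; rewrite scale1r; exact: esym.
  have /submxP [c' hc'] : ((z - z *m P)%R <= E')%MS.
    by rewrite E'span; apply/eigenspaceP; rewrite scaleN1r; exact: esym.
  exists (2^-1 *: c), (2^-1 *: c'); rewrite -!scalemxAl -hc -hc' -scalerDr.
  have -> : z + z *m P + (z - z *m P) = 2 *: z.
    by rewrite addrACA subrr addr0 -[2]/(1 + 1) scalerDl scale1r.
  by rewrite scalerA mulVf ?scale1r ?pnatr_eq0.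
exists (row 0 E), (row 1 E), (row 0 E'), (row 1 E').
have EPr k : row k E *m P = row k E by rewrite -row_mul EP.
have E'Pr k : row k E' *m P = - row k E'.
  by rewrite -row_mul E'P; apply/rowP => l; rewrite !mxE.
split; first by split.
  pose m := E *m g *m E'^T.
  have mE k l : bform g (row k E) (row l E') = m k l.
    rewrite /bform tr_row -row_mul [LHS]mxE [RHS]mxE.
    by apply: eq_bigr => r _; rewrite !mxE.
  have mu : m \in unitmx.
    rewrite -row_free_unit -kermx_eq0; apply/rowV0P => c /sub_kermxP cm.
    apply/eqP; rewrite -(mulmx_free_eq0 _ Efree); apply/eqP.
    set w := c *m E; have wP : w *m P = w by rewrite /w -mulmxA EP.
    have wz z : bform g w z = 0.
      have [b [b' ->]] := decomp z.
      rewrite bformDr (@isotropic_eigen false w (b *m E)) ?scale1r //; last first.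
        by rewrite -mulmxA EP.
      rewrite /bform /w trmx_mul mulmxA -(mulmxA c) -(mulmxA c) -/m cm mul0mx.
      by rewrite mxE addr0.
    rewrite -[w](mulmxK gu); have -> : w *m g = 0; last by rewrite mul0mx.
    apply/rowP => k; have := wz (delta_mx 0 k).
    by rewrite /bform trmx_delta -colE !mxE.
  rewrite !mE; have <- : \det m = m 0 0 * m 1 1 - m 0 1 * m 1 0.
    exact: det_mx2.
  by rewrite -unitfE -unitmxE.
move=> z; have [c [c' ->]] := decomp z.
by exists (c 0 0), (c 0 1), (c' 0 0), (c' 0 1); rewrite !rowE2.
Qed.

End Eigenframe.

Lemma smooth_mx_on_sub (R : realType) n (U V : set 'rV[R]_n) p q
    (f : 'rV[R]_n -> 'M[R]_(p, q)) :
  U `<=` V -> smooth_mx_on V f -> smooth_mx_on U f.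
Proof. by move=> UV fs i j s x Ux; apply: fs; exact: UV. Qed.

Lemma map_bform (A B : comPzRingType) (phi : {rmorphism A -> B}) n
    (M : 'M[A]_n) x y :
  phi (bform M x y) = bform (map_mx phi M) (map_mx phi x) (map_mx phi y).
Proof. by rewrite /bform map_trmx -!map_mxM [RHS]mxE. Qed.

Lemma antifixed_comb (A : comPzRingType) n (Q : 'M[A]_n) x y (a b : A) :
  x *m Q = - x -> y *m Q = - y ->
  (a *: x - b *: y : 'rV_n) *m Q = - (a *: x - b *: y).
Proof.
by move=> xQ yQ; rewrite mulmxBl -!scalemxAl xQ yQ !scalerN opprB addrC opprK.
Qed.

(** * Null eigenfields of the product structure *)

Section LocalLeaf.
Variables (R : realType) (O : open_set R 4) (g P : 'rV[R]_4 -> 'M[R]_4).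
Hypotheses (gs : smooth_mx_on (open_dom O) g) (Ps : smooth_mx_on (open_dom O) P).
Hypotheses (gsym : forall x, open_dom O x -> (g x)^T = g x)
  (gu : forall x, open_dom O x -> g x \in unitmx)
  (PP : forall x, open_dom O x -> P x *m P x = 1%:M)
  (PG : forall x, open_dom O x -> P x *m g x = - (g x *m (P x)^T)).
Hypothesis nij : forall u v x, open_dom O x ->
  lie_bracket (fun y => u *m P y) (fun y => v *m P y) x
  + lie_bracket (fun=> u) (fun=> v) x
  - lie_bracket (fun y => u *m P y) (fun=> v) x *m P x
  - lie_bracket (fun=> u) (fun y => v *m P y) x *m P x = 0.
Hypothesis ric_anti : forall x u v, open_dom O x ->
  bform (ricci g x) (u *m P x) (v *m P x) = - bform (ricci g x) u v.

Variable s : bool.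
Local Notation sg := ((-1) ^+ s).

Section OnOpenSubset.
Variables (W : open_set R 4) (WO : open_dom W `<=` open_dom O).
Local Notation A := (smooth_fun W).
Local Notation d := (sf_derivations W).

Definition gW : 'M[A]_4 := sf_mx (smooth_mx_on_sub WO gs).
Definition PW : 'M[A]_4 := sf_mx (smooth_mx_on_sub WO Ps).
Definition cW (u : 'rV[R]_4) : 'rV[A]_4 :=
  \matrix_(i, j) sf_of (smooth_cst (O := W) (u i j)).
(** [eW u] and [fW v] are twice the projections of constant vectors onto the two eigenbundles. The
    sign [sg] selects which one plays the role of D, so a single argument covers P and -P. *)
Definition eW u : 'rV[A]_4 := cW u + cW u *m (sg *: PW).
Definition fW v : 'rV[A]_4 := cW v - cW v *m (sg *: PW).

Lemma ev_gW y (Wy : open_dom W y) : map_mx (ev Wy) gW = g y.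
Proof. exact: sf_mxE. Qed.

Lemma ev_PW y (Wy : open_dom W y) : map_mx (ev Wy) PW = P y.
Proof. exact: sf_mxE. Qed.

Lemma ev_cW u y (Wy : open_dom W y) : map_mx (ev Wy) (cW u) = u.
Proof. exact/esym/represents_const. Qed.

Lemma ev_sgPW y (Wy : open_dom W y) :
  map_mx (ev Wy) (sg *: PW) = sg *: P y.
Proof. by rewrite map_mxZ rmorph_sign ev_PW. Qed.

Lemma ev_eW u y (Wy : open_dom W y) :
  map_mx (ev Wy) (eW u) = u + u *m (sg *: P y).
Proof. by rewrite map_mxD map_mxM ev_sgPW ev_cW. Qed.

Lemma ev_fW u y (Wy : open_dom W y) :
  map_mx (ev Wy) (fW u) = u - u *m (sg *: P y).
Proof. by rewrite map_mxB map_mxM ev_sgPW ev_cW. Qed.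

Let PW2 : PW *m PW = 1%:M.
Proof.
apply: sf_mxP => y Wy; rewrite map_mxM map_mx1 ev_PW PP //; exact: WO.
Qed.

Lemma sgPW2 : (sg *: PW) *m (sg *: PW) = 1%:M.
Proof. by rewrite -scalemxAl -scalemxAr PW2 scalerA -expr2 sqrr_sign scale1r. Qed.

Lemma eW_P u : eW u *m (sg *: PW) = eW u.
Proof. by rewrite mulmxDl -mulmxA sgPW2 mulmx1 addrC. Qed.

Lemma fW_P u : fW u *m (sg *: PW) = - fW u.
Proof. by rewrite mulmxBl -mulmxA sgPW2 mulmx1 opprB. Qed.

Lemma gWsym : gW^T = gW.
Proof. by apply: sf_mxP => y Wy; rewrite -map_trmx ev_gW gsym //; exact: WO. Qed.

Lemma gW_P : (sg *: PW) *m gW = - (gW *m (sg *: PW)^T).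
Proof.
rewrite -scalemxAl linearZ /= -scalemxAr -scalerN; congr (_ *: _).
apply: sf_mxP => y Wy; rewrite map_mxN !map_mxM -map_trmx ev_gW ev_PW PG //.
exact: WO.
Qed.

Lemma gW_inv : exists gi, gW *m gi = 1%:M.
Proof. by apply: sf_mx_inv => y Wy; rewrite ev_gW gu //; exact: WO. Qed.

Lemma represents_PW u : represents (fun y => u *m P y) (cW u *m PW).
Proof. by move=> y Wy; rewrite map_mxM ev_cW ev_PW. Qed.

Lemma represents_cW u : represents (fun=> u) (cW u).
Proof. exact: represents_const. Qed.

(** The integrability condition is even in P, so it holds for Q = [sg *: PW] and reads [XQ, YQ] +
    [X, Y] = S Q with S = [XQ, Y] + [X, YQ]. The bracket of X + XQ and Y + YQ is then S Q + S, which
    Q fixes since Q^2 = 1. *)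
Lemma eW_involutive u v :
  cbr d (eW u) (eW v) *m (sg *: PW) = cbr d (eW u) (eW v).
Proof.
set X := cW u; set Y := cW v; pose Q := sg *: PW.
have N : cbr d (X *m PW) (Y *m PW) + cbr d X Y =
    (cbr d (X *m PW) Y + cbr d X (Y *m PW)) *m PW.
  apply: sf_mxP => y Wy; rewrite map_mxD map_mxM map_mxD ev_PW.
  have := nij u v (WO Wy).
  rewrite (lie_bracket_represents (represents_PW u) (represents_PW v) Wy).
  rewrite (lie_bracket_represents (represents_cW u) (represents_cW v) Wy).
  rewrite (lie_bracket_represents (represents_PW u) (represents_cW v) Wy).
  rewrite (lie_bracket_represents (represents_cW u) (represents_PW v) Wy).
  move/eqP; rewrite -addrA -opprD subr_eq0 => /eqP ->.
  by rewrite mulmxDl.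
have Q2 : Q *m Q = 1%:M := sgPW2.
pose S := cbr d (X *m Q) Y + cbr d X (Y *m Q).
have {}N : cbr d (X *m Q) (Y *m Q) + cbr d X Y = S *m Q.
  rewrite /S /Q -!scalemxAr !(cbr_signl, cbr_signr) scalerA -expr2 sqrr_sign scale1r.
  by rewrite N -scalerDr -scalemxAl scalerA -expr2 sqrr_sign scale1r.
have -> : cbr d (eW u) (eW v) = S *m Q + S.
  rewrite -N /S /eW -/X -/Y -/Q cbrDl !cbrDr.
  move: (cbr d X Y) (cbr d X _) (cbr d _ Y) (cbr d _ _) => a b c e.
  by rewrite [LHS]addrC [RHS]addrACA (addrC c).
by rewrite mulmxDl -mulmxA Q2 mulmx1 addrC.
Qed.

End OnOpenSubset.

Variables (x0 : 'rV[R]_4) (Ox0 : open_dom O x0) (u1 u2 v1 v2 : 'rV[R]_4).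
Hypotheses (u1P : u1 *m (sg *: P x0) = u1) (u2P : u2 *m (sg *: P x0) = u2)
  (v1P : v1 *m (sg *: P x0) = - v1) (v2P : v2 *m (sg *: P x0) = - v2).
Hypothesis uv_det : bform (g x0) u1 v1 * bform (g x0) u2 v2
  - bform (g x0) u1 v2 * bform (g x0) u2 v1 != 0.

Definition pairW W (WO : open_dom W `<=` open_dom O) u v :=
  bform (gW WO) (eW WO u) (fW WO v).

Definition detW W (WO : open_dom W `<=` open_dom O) :=
  pairW WO u1 v1 * pairW WO u2 v2 - pairW WO u1 v2 * pairW WO u2 v1.

Let pair_at y u v := bform (g y) (u + u *m (sg *: P y)) (v - v *m (sg *: P y)).
Let det_at y := pair_at y u1 v1 * pair_at y u2 v2 - pair_at y u1 v2 * pair_at y u2 v1.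

Lemma ev_detW W (WO : open_dom W `<=` open_dom O) y (Wy : open_dom W y) :
  ev Wy (detW WO) = det_at y.
Proof.
have evp u v : ev Wy (pairW WO u v) = pair_at y u v.
  by rewrite map_bform ev_gW ev_eW ev_fW.
rewrite /detW; move: (pairW WO) evp => p evp.
by rewrite rmorphB !rmorphM /= !evp.
Qed.

(* The vectors u + u P and v - v P extend u and v to eigenfields; W is the set where
   these fields still form a frame. *)
Let DO : smooth_fun O := detW (@subset_refl _ (open_dom O)).

Let DO_at y : open_dom O y -> DO y = det_at y.
Proof. by move=> Oy; rewrite -(ev_detW (@subset_refl _ (open_dom O)) Oy). Qed.

Let W_sub : [set y | DO y != 0] `<=` open_dom O.
Proof.
move=> y Dy; have {}Dy : DO y != 0 := Dy.
apply: contrapT => nOy; move: Dy.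
by rewrite (@sf_out _ _ _ DO _ nOy) eqxx.
Qed.

Let W_open : open [set y | DO y != 0].
Proof.
rewrite openE => y Dy; have Oy := W_sub Dy.
have cD : {for y, continuous DO}.
  by apply: differentiable_continuous; exact: sf_diff.
apply: (cD [set z | z != 0]); apply: open_nbhs_nbhs; split => //.
Qed.

Let W : open_set R 4 := OpenSet W_open.
Let WO : open_dom W `<=` open_dom O := W_sub.
Let Wx0 : open_dom W x0.
Proof.
have twice a b : bform (g x0) (a + a) (b + b) = 4 * bform (g x0) a b.
  by rewrite !(bformDl, bformDr); ring.
change (is_true (DO x0 != 0)).
rewrite DO_at // /det_at /pair_at u1P u2P v1P v2P !opprK !twice.
rewrite mulrACA [X in _ - X]mulrACA -mulrBr mulf_neq0 // mulf_neq0 //.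
Qed.

Local Notation A := (smooth_fun W).
Local Notation d := (sf_derivations W).
Local Notation G := (gW WO).
Local Notation Q := (sg *: PW WO).
Local Notation m := (pairW WO).

Let det_unit : exists de : A, detW WO * de = 1.
Proof.
apply: smooth_fun_inv => y Wy; have Dy : DO y != 0 := Wy.
by rewrite (DO_at (WO Wy)) -(ev_detW WO Wy) in Dy.
Qed.

Section InverseMetric.
Variable gi : 'M[A]_4.
Hypothesis ggi : G *m gi = 1%:M.
Local Notation Rc := (cricci d (sf_half2 W) (gWsym WO) ggi).

(** P multiplies both arguments by the same sign, so anti-invariance equates the value with its
    opposite. *)
Let ricci_null u u' : bform Rc (eW WO u) (eW WO u') = 0.
Proof.
apply: smooth_funP => y Wy.
have rr := ricci_represents (@represents_sf_mx _ _ _ _ _ _ (smooth_mx_on_sub WO gs)).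
transitivity (bform (ricci g y) (u + u *m (sg *: P y)) (u' + u' *m (sg *: P y))).
  rewrite -[LHS]/(ev Wy _) map_bform !ev_eW; congr (bform _ _ _).
  by rewrite (rr _ ggi (gWsym WO) y Wy).
have eP z : (z + z *m (sg *: P y)) *m P y = sg *: (z + z *m (sg *: P y)).
  rewrite mulmxDl -scalemxAr -scalemxAl -mulmxA PP; last exact: WO.
  by rewrite mulmx1 scalerDr scalerA -expr2 sqrr_sign scale1r addrC.
have := ric_anti (u + u *m (sg *: P y)) (u' + u' *m (sg *: P y)) (WO Wy).
rewrite !eP bformZl bformZr mulrA -expr2 sqrr_sign mul1r.
move: (bform _ _ _) => z h; rewrite sf_zeroE //; lra.
Qed.

Section Frame.
Variable de : A.
Hypothesis dede : detW WO * de = 1.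
Let e1 := eW WO u1.
Let e2 := eW WO u2.
(** Cramer's rule: [f1] and [f2] are dual to [e1] and [e2], by the inverse of the 2 x 2 pairing
    matrix with [de] the inverse of its determinant. *)
Let f1 := (m u2 v2 * de) *: fW WO v1 - (m u2 v1 * de) *: fW WO v2.
Let f2 := (m u1 v1 * de) *: fW WO v2 - (m u1 v2 * de) *: fW WO v1.

Let f1P : f1 *m Q = - f1.
Proof. by apply: antifixed_comb; exact: fW_P. Qed.
Let f2P : f2 *m Q = - f2.
Proof. by apply: antifixed_comb; exact: fW_P. Qed.

Let ef (a b : A) u v v' : bform G (eW WO u) (a *: fW WO v - b *: fW WO v') =
  a * m u v - b * m u v'.
Proof. by rewrite bformDr bformNr (bformZr _ a) (bformZr _ b). Qed.

Let ef11 : bform G e1 f1 = 1.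
Proof.
rewrite ef -dede /detW; move: (m u1 v1) (m u2 v2) (m u1 v2) (m u2 v1) (de) => a b c e k.
ring.
Qed.
Let ef12 : bform G e1 f2 = 0.
Proof.
rewrite ef; move: (m u1 v1) (m u2 v2) (m u1 v2) (m u2 v1) (de) => a b c e k.
ring.
Qed.
Let ef21 : bform G e2 f1 = 0.
Proof.
rewrite ef; move: (m u1 v1) (m u2 v2) (m u1 v2) (m u2 v1) (de) => a b c e k.
ring.
Qed.
Let ef22 : bform G e2 f2 = 1.
Proof.
rewrite ef -dede /detW; move: (m u1 v1) (m u2 v2) (m u1 v2) (m u2 v1) (de) => a b c e k.
ring.
Qed.

Lemma contraction_null_ring :
  \tr (gi *m (rm_mx34 d (sf_half2 W) (gWsym WO) ggi e1 e2 *m Q^T)) = 0.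
Proof.
apply: (curvature_contraction_null
  (@smooth_fun_torsion_free _ _ W) (@smooth_fun_reduced _ _ W)
  (gW_P WO) (eW_P WO u1) (eW_P WO u2) f1P f2P ef11 ef12 ef21 ef22
  (eW_involutive WO u1 u2)); exact: ricci_null.
Qed.

Lemma closed_null_ring (t : 'cV[A]_4) : let F := G *m Q^T in
  (forall i j k, d i (F j k) + d j (F k i) + d k (F i j) =
     t i 0 * F j k + t j 0 * F k i + t k 0 * F i j) ->
  bform (\matrix_(i, j) (d i (t j 0) - d j (t i 0))) e1 e2 = 0.
Proof.
move=> F lee.
apply: (d_lee_form_null (hf2 := sf_half2 W) (Gsym := gWsym WO) (GGi := ggi)
  (@smooth_fun_torsion_free _ _ W) (@smooth_fun_reduced _ _ W)
  (gW_P WO) (eW_P WO u1) (eW_P WO u2) f1P f2P ef11 ef12 ef21 ef22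
  (eW_involutive WO u1 u2)); first [exact: ricci_null | exact: lee].
Qed.

End Frame.
End InverseMetric.

Let ev_eW_x0 u : u *m (sg *: P x0) = u -> map_mx (ev Wx0) (eW WO u) = 2 *: u.
Proof. by move=> uP; rewrite ev_eW uP -[2]/(1 + 1) scalerDl scale1r. Qed.

(** The ring identity evaluated at [x0], where the eigenfields take the values 2 u1 and 2 u2. The
    factor 4 and the sign carried by [sg *: P] are nonzero and cancel. *)
Lemma contraction_null :
  \tr (invmx (g x0) *m ((\matrix_(k, l)
    bform (\matrix_(i, j) riemann g x0 i j k l) u1 u2) *m (P x0)^T)) = 0.
Proof.
have [gi ggi] := gW_inv WO; have [de dede] := det_unit.
have := congr1 (ev Wx0) (contraction_null_ring ggi dede).
rewrite rmorph0 -trace_map_mx !map_mxM -map_trmx ev_sgPW (ev_invmx Wx0 ggi) ev_gW.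
have -> : map_mx (ev Wx0) (rm_mx34 d (sf_half2 W) (gWsym WO) ggi (eW WO u1) (eW WO u2))
    = 4 *: \matrix_(k, l) bform (\matrix_(i, j) riemann g x0 i j k l) u1 u2.
  apply/matrixP => k l; rewrite !mxE.
  rewrite (bilinear_form (B := fun X Y => rm (coordinate_connection d (sf_half2 W)
    (gWsym WO) ggi) X Y (delta_mx 0 k) (delta_mx 0 l))); last 4 first.
  - by move=> *; rewrite rmDl.
  - by move=> *; rewrite rmZl.
  - by move=> *; rewrite rmDr.
  - by move=> *; rewrite rmZr.
  rewrite map_bform !ev_eW_x0 // bformZl bformZr mulrA -natrM; congr (_ * bform _ _ _).
  apply/matrixP => i j; rewrite !mxE.
  by rewrite (riemann_ev (represents_sf_mx (smooth_mx_on_sub WO gs)) ggi (gWsym WO) Wx0).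
rewrite linearZ /= -scalemxAr -scalemxAl -!scalemxAr !linearZ /=.
move=> /eqP; rewrite !mulf_eq0 signr_eq0 pnatr_eq0 /= => /eqP.
by [].
Qed.

Lemma d_lee_form_null_at (theta : 'rV[R]_4 -> 'cV[R]_4) :
  smooth_mx_on (open_dom O) theta ->
  (forall x a b c, open_dom O x ->
    d_two_form (fun y => g y *m (P y)^T) x a b c =
    wedge12 (theta x) (g x *m (P x)^T) a b c) ->
  bform (d_one_form theta x0) u1 u2 = 0.
Proof.
move=> ths lee; have [gi ggi] := gW_inv WO; have [de dede] := det_unit.
pose t : 'cV[A]_4 := sf_mx (smooth_mx_on_sub WO ths).
have ht : represents theta t := represents_sf_mx _.
pose F0 := gW WO *m (PW WO)^T.
have hF : represents (fun y => g y *m (P y)^T) F0.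
  by move=> y Wy; rewrite map_mxM -map_trmx ev_gW ev_PW.
have lee0 i j k : d i (F0 j k) + d j (F0 k i) + d k (F0 i j) =
    t i 0 * F0 j k + t j 0 * F0 k i + t k 0 * F0 i j.
  apply: smooth_funP => y Wy.
  rewrite -[LHS]/(ev Wy _) -[RHS]/(ev Wy _) !(rmorphD, rmorphM) /=.
  rewrite -!(partial_represents _ _ _ Wy hF).
  have := lee y i j k (WO Wy); rewrite /d_two_form /wedge12 => ->.
  by rewrite (hF y Wy) (ht y Wy) !mxE.
have FE j k : (gW WO *m (sg *: PW WO)^T) j k = sg * F0 j k.
  by rewrite linearZ /= -scalemxAr mxE.
have dsg (b : bool) i a : d i ((-1) ^+ b * a) = (-1) ^+ b * d i a.
  by case: b; rewrite ?expr0 ?expr1 ?mul1r // !mulN1r derN.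
have := closed_null_ring ggi dede (t := t).
(* The equation dF = theta wedge F is linear in F, so it also holds for the form of -P, with the
   same theta. *)
pose F1 := gW WO *m (sg *: PW WO)^T.
have lee1 i j k : d i (F1 j k) + d j (F1 k i) + d k (F1 i j) =
    t i 0 * F1 j k + t j 0 * F1 k i + t k 0 * F1 i j.
  rewrite !FE !dsg -!mulrDr lee0 !mulrDr.
  by rewrite !(mulrCA sg).
move=> /(_ lee1) /(congr1 (ev Wx0)); rewrite rmorph0 map_bform !ev_eW_x0 //.
rewrite bformZl bformZr mulrA => /eqP; rewrite mulf_eq0 -natrM pnatr_eq0 /= => /eqP.
have -> // : map_mx (ev Wx0) (\matrix_(i, j) (d i (t j 0) - d j (t i 0))) =
  d_one_form theta x0.
apply/matrixP => i j; rewrite [LHS]mxE [X in ev _ X]mxE [RHS]mxE.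
rewrite (partial_represents i j 0 Wx0 ht) (partial_represents j i 0 Wx0 ht).
exact: (rmorphB (ev Wx0)).
Qed.

End LocalLeaf.

(** * Invariance of the eigenvalue under changes of chart *)

Section Pullback.
Variables (R : realType) (n : nat) (O1 O2 : open_set R n).
Variable phi : 'rV[R]_n -> 'rV[R]_n.
Hypotheses (phiO : forall x, open_dom O1 x -> open_dom O2 (phi x))
  (phis : smooth_mx_on (open_dom O1) phi).

Lemma smooth_comp (f : smooth_fun O2) : smooth_on (open_dom O1) (f \o phi).
Proof.
apply/smooth_onP => k; apply: (class_C_comp (V := open_dom O2)).
- exact: open_domP.
- exact: open_domP.
- exact: phiO.
- exact: ((smooth_onP _ _).1 (sf_smooth f)).
- by move=> l; exact: ((smooth_onP _ _).1 (phis 0 l)).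
Qed.

Definition pullback (f : smooth_fun O2) : smooth_fun O1 := sf_of (smooth_comp f).

Lemma ev_pullback x (Ox : open_dom O1 x) f :
  ev Ox (pullback f) = ev (phiO Ox) f.
Proof. exact: (sf_ofE _ Ox). Qed.

Fact pullback_additive : zmod_morphism pullback.
Proof.
move=> a b; apply: smooth_funP => x Ox.
rewrite -[LHS]/(ev Ox _) -[RHS]/(ev Ox _) [RHS]rmorphB /= !ev_pullback.
by rewrite rmorphB.
Qed.
HB.instance Definition _ :=
  GRing.isZmodMorphism.Build _ _ pullback pullback_additive.
Fact pullback_multiplicative : monoid_morphism pullback.
Proof.
split=> [|a b]; apply: smooth_funP => x Ox;
  rewrite -[LHS]/(ev Ox _) -[RHS]/(ev Ox _).
  by rewrite ev_pullback !rmorph1.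
by rewrite [RHS]rmorphM /= !ev_pullback rmorphM.
Qed.
HB.instance Definition _ :=
  GRing.isMonoidMorphism.Build _ _ pullback pullback_multiplicative.

Local Notation d1 := (sf_derivations O1).
Local Notation d2 := (sf_derivations O2).

Definition pull_coord k : smooth_fun O1 := sf_of (phis 0 k).
Definition pull_jac : 'M[smooth_fun O1]_n := \matrix_(i, k) d1 i (pull_coord k).

Let phi_diff x k : open_dom O1 x -> differentiable (fun y => phi y 0 k) x.
Proof. by move=> Ox; exact: (phis 0 k [::] Ox). Qed.

Lemma ev_pull_jac x (Ox : open_dom O1 x) :
  map_mx (ev Ox) pull_jac = 'J phi x.
Proof.
apply/matrixP => i k; rewrite [LHS]mxE [X in ev _ X]mxE.
rewrite jacobianE => [|l]; last exact: phi_diff.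
apply/esym/sf_derE => // y Oy; exact/esym/(sf_ofE _ Oy).
Qed.

Lemma der_pullback i f :
  d1 i (pullback f) = \sum_k pull_jac i k * pullback (d2 k f).
Proof.
apply: smooth_funP => x Ox; rewrite -[LHS]/(ev Ox _) -[RHS]/(ev Ox _).
have -> : ev Ox (d1 i (pullback f)) = partial i (f \o phi) x.
  by apply/esym/sf_derE => // y Oy; exact/esym/(sf_ofE _ Oy).
rewrite partial_comp; last 2 first.
- by apply: sf_diff; exact: phiO.
- by move=> k; exact: phi_diff.
rewrite rmorph_sum; apply: eq_bigr => k _.
rewrite [RHS]rmorphM mulrC; congr (_ * _).
  have /matrixP/(_ i k) := ev_pull_jac Ox; rewrite [LHS]mxE => jE.
  apply: (etrans _ (esym jE)); rewrite jacobianE // => l; exact: phi_diff.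
apply: etrans (esym (ev_pullback Ox _)).
exact: (sf_derE k (phiO Ox) (fun y _ => erefl)).
Qed.

End Pullback.

(** [B] is the fundamental form with both indices raised, as [raise2_F] shows; the scalar is R_abkl
    B^lk B^ab. *)
Definition chern_contraction (R : realType) n (G P : 'rV[R]_n -> 'M[R]_n) x : R :=
  let B := (P x)^T *m invmx (G x) in
  \sum_a \sum_b (\sum_k \sum_l riemann G x a b k l * B l k) * B a b.

Section ContractionEvaluation.
Variables (R : realType) (n : nat) (O : open_set R n).
Variables (G P : 'rV[R]_n -> 'M[R]_n) (G' Gi P' : 'M[smooth_fun O]_n).
Hypotheses (hG : represents G G') (hP : represents P P').
Hypotheses (GGi : G' *m Gi = 1%:M) (G'sym : G'^T = G').

Lemma ev_contraction x (Ox : open_dom O x) :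
  ev Ox (contraction12_34 (sf_derivations O) (sf_half2 O) G'sym GGi (P'^T *m Gi))
  = chern_contraction G P x.
Proof.
set S := P'^T *m Gi.
have evS : map_mx (ev Ox) S = (P x)^T *m invmx (G x).
  by rewrite map_mxM -map_trmx -(hP Ox) (ev_invmx Ox GGi) -(hG Ox).
have evSE a b : ev Ox (S a b) = ((P x)^T *m invmx (G x)) a b.
  by rewrite -evS [RHS]mxE.
move: S {evS} evSE => S evSE.
rewrite contraction12_34E (rmorph_sum (ev Ox)); apply: eq_bigr => a _.
rewrite (rmorph_sum (ev Ox)); apply: eq_bigr => b _.
rewrite (rmorphM (ev Ox)); congr (_ * _); last exact: evSE.
rewrite (rmorph_sum (ev Ox)); apply: eq_bigr => k _.
rewrite (rmorph_sum (ev Ox)); apply: eq_bigr => l _.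
rewrite (rmorphM (ev Ox)); congr (_ * _); last exact: evSE.
by apply/esym; exact: riemann_ev.
Qed.

End ContractionEvaluation.

Lemma raise_change (A A' : comPzRingType) (phi : {rmorphism A' -> A}) n
    (J K P1 Gi1 : 'M[A]_n) (P2 Gi2 : 'M[A']_n) : K *m J = 1%:M ->
  P1 = J *m map_mx phi P2 *m K -> Gi1 = K^T *m map_mx phi Gi2 *m K ->
  P1^T *m Gi1 = K^T *m map_mx phi (P2^T *m Gi2) *m K.
Proof.
move=> KJ -> ->; rewrite !trmx_mul map_mxM -map_trmx !mulmxA; congr (_ *m _ *m _).
by rewrite -(mulmxA _ J^T) -(trmx_mul K J) KJ trmx1 mulmx1.
Qed.

Section ContractionInvariance.
Variables (R : realType) (n : nat) (O1 O2 : open_set R n).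
Variable phi : 'rV[R]_n -> 'rV[R]_n.
Hypotheses (phiO : forall x, open_dom O1 x -> open_dom O2 (phi x))
  (phis : smooth_mx_on (open_dom O1) phi).
Variables (G1 P1 G2 P2 : 'rV[R]_n -> 'M[R]_n).
Hypotheses (G1s : smooth_mx_on (open_dom O1) G1) (P1s : smooth_mx_on (open_dom O1) P1)
  (G2s : smooth_mx_on (open_dom O2) G2) (P2s : smooth_mx_on (open_dom O2) P2).
Hypotheses (G1sym : forall x, open_dom O1 x -> (G1 x)^T = G1 x)
  (G2sym : forall x, open_dom O2 x -> (G2 x)^T = G2 x)
  (G1u : forall x, open_dom O1 x -> G1 x \in unitmx)
  (G2u : forall x, open_dom O2 x -> G2 x \in unitmx).
Hypotheses (GJ : forall x, open_dom O1 x ->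
    G1 x = 'J phi x *m G2 (phi x) *m ('J phi x)^T)
  (PJ : forall x, open_dom O1 x ->
    P1 x *m 'J phi x = 'J phi x *m P2 (phi x)).

Lemma chern_contraction_invariant x : open_dom O1 x ->
  chern_contraction G1 P1 x = chern_contraction G2 P2 (phi x).
Proof.
move=> Ox; pose G1' := sf_mx G1s; pose G2' := sf_mx G2s.
pose P1' := sf_mx P1s; pose P2' := sf_mx P2s.
have [Gi1 GGi1] : exists B, G1' *m B = 1%:M.
  by apply: sf_mx_inv => y Oy; rewrite sf_mxE; exact: G1u.
have [Gi2 GGi2] : exists B, G2' *m B = 1%:M.
  by apply: sf_mx_inv => y Oy; rewrite sf_mxE; exact: G2u.
have sym1 : G1'^T = G1'.
  by apply: sf_mxP => y Oy; rewrite -map_trmx sf_mxE; exact: G1sym.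
have sym2 : G2'^T = G2'.
  by apply: sf_mxP => y Oy; rewrite -map_trmx sf_mxE; exact: G2sym.
pose J := pull_jac phis; pose pb := pullback phiO phis.
have evpb k l (M : 'M[smooth_fun O2]_(k, l)) y (Oy : open_dom O1 y) :
    map_mx (ev Oy) (map_mx pb M) = map_mx (ev (phiO Oy)) M.
  by apply/matrixP => a b; rewrite !mxE; exact: ev_pullback.
have GJ' : G1' = J *m map_mx pb G2' *m J^T.
  apply: sf_mxP => y Oy; rewrite !map_mxM -map_trmx evpb !sf_mxE.
  by rewrite ev_pull_jac; exact: GJ.
have PJ' : P1' *m J = J *m map_mx pb P2'.
  apply: sf_mxP => y Oy; rewrite !map_mxM evpb !sf_mxE ev_pull_jac; exact: PJ.
have [K KJ] : exists K, K *m J = 1%:M.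
  (* The transformation law of the metric inverts the Jacobian: J times this matrix is G1 times its
     inverse. *)
  exists (map_mx pb G2' *m J^T *m Gi1); apply: mulmx1C.
  by rewrite !mulmxA -GJ' GGi1.
rewrite -(ev_contraction (represents_sf_mx G1s) (represents_sf_mx P1s) GGi1 sym1 Ox).
rewrite -(ev_contraction (represents_sf_mx G2s) (represents_sf_mx P2s) GGi2 sym2 (phiO Ox)).
rewrite -(ev_pullback phiO phis Ox); congr (ev Ox _).
have JK := mulmx1C KJ.
apply: (contraction_pull (phi := pb) KJ (x := pull_coord phis)).
- by move=> i k; rewrite mxE.
- by move=> i a; exact: der_pullback.
- exact: smooth_fun_torsion_free.
- exact: GJ'.
have eP : P1' = J *m map_mx pb P2' *m K by rewrite -PJ' -mulmxA JK mulmx1.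
have eG : Gi1 = K^T *m map_mx pb Gi2 *m K.
  have h : G1' *m (K^T *m map_mx pb Gi2 *m K) = 1%:M.
    rewrite GJ' !mulmxA -(mulmxA _ J^T) -trmx_mul KJ trmx1 mulmx1.
    by rewrite -(mulmxA J) -map_mxM GGi2 map_mx1 mulmx1.
  by rewrite -[LHS]mulmx1 -h mulmxA (mulmx1C GGi1) mul1mx.
exact: (raise_change KJ eP eG).
Qed.

End ContractionInvariance.

(** * Forms of type (1, 1) and the Weyl operator of an Einstein metric *)

(** Only pairs of one vector from each eigenspace can give a nonzero value, and on these P changes
    the sign of exactly one argument. *)
Lemma null_on_eigenspaces (R : realType) (al P : 'M[R]_4) u1 u2 v1 v2 :
  al^T = - al -> bform al u1 u2 = 0 -> bform al v1 v2 = 0 ->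
  [/\ u1 *m P = u1, u2 *m P = u2, v1 *m P = - v1 & v2 *m P = - v2] ->
  (forall z, exists a1 a2 b1 b2,
     z = a1 *: u1 + a2 *: u2 + (b1 *: v1 + b2 *: v2)) ->
  al + P *m al *m P^T = 0.
Proof.
move=> als hu hv [u1P u2P v1P v2P] span.
have skew x y : bform al y x = - bform al x y.
  rewrite /bform -[in LHS](trmxK (y *m al *m x^T)) [LHS]mxE !trmx_mul trmxK als.
  by rewrite mulNmx mulmxN mulmxA mxE.
have diag x : bform al x x = 0.
  by have := skew x x; move: (bform al x x) => z h; lra.
have hu' : bform al u2 u1 = 0 by rewrite skew hu oppr0.
have hv' : bform al v2 v1 = 0 by rewrite skew hv oppr0.
have key x y : bform al x y + bform al (x *m P) (y *m P) = 0.
  have [a1 [a2 [b1 [b2 ->]]]] := span x; have [c1 [c2 [d1 [d2 ->]]]] := span y.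
  rewrite !mulmxDl -!scalemxAl u1P u2P v1P v2P.
  rewrite !(bformDl, bformDr, bformZl, bformZr, bformNl, bformNr).
  by rewrite !diag hu hu' hv hv'; ring.
apply/matrixP => i j; rewrite [RHS]mxE -(key (delta_mx 0 i) (delta_mx 0 j)).
rewrite [LHS]mxE -[in LHS](bform_delta al) -[in LHS](bform_delta (P *m al *m P^T)).
by congr (_ + _); rewrite /bform trmx_mul !mulmxA.
Qed.

Section RiemannContraction.
Variables (R : realType) (O : open_set R 4) (g : 'rV[R]_4 -> 'M[R]_4).
Hypotheses (gs : smooth_mx_on (open_dom O) g)
  (gsym : forall x, open_dom O x -> (g x)^T = g x)
  (gu : forall x, open_dom O x -> g x \in unitmx).

Lemma riemann_skew12 x i j k l : open_dom O x ->
  riemann g x j i k l = - riemann g x i j k l.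
Proof.
move=> Ox; pose G := sf_mx gs.
have [Gi GGi] : exists B, G *m B = 1%:M.
  by apply: sf_mx_inv => y Oy; rewrite sf_mxE; exact: gu.
have Gsym : G^T = G.
  by apply: sf_mxP => y Oy; rewrite -map_trmx sf_mxE; exact: gsym.
have E := riemann_ev (represents_sf_mx gs) GGi Gsym Ox.
by rewrite !E rm_skew12 rmorphN.
Qed.

Definition riemann_contraction (B : 'M[R]_4) x : 'M[R]_4 :=
  \matrix_(a, b) \sum_k \sum_l riemann g x a b k l * B l k.

Lemma riemann_contraction_skew B x : open_dom O x ->
  (riemann_contraction B x)^T = - riemann_contraction B x.
Proof.
move=> Ox; apply/matrixP => a b; rewrite !mxE -sumrN; apply: eq_bigr => k _.
by rewrite -sumrN; apply: eq_bigr => l _; rewrite riemann_skew12 // mulNr.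
Qed.

Lemma bform_riemann_contraction (P : 'M[R]_4) x u v :
  bform (riemann_contraction (P^T *m invmx (g x)) x) u v =
  \tr (invmx (g x) *m ((\matrix_(k, l)
    bform (\matrix_(i, j) riemann g x i j k l) u v) *m P^T)).
Proof.
set M := \matrix_(k, l) _; set B := P^T *m invmx (g x).
have -> : \tr (invmx (g x) *m (M *m P^T)) = \tr (M *m B).
  by rewrite mxtrace_mulC -mulmxA.
have -> : \tr (M *m B) = \sum_k \sum_l M k l * B l k.
  by apply: eq_bigr => k _; rewrite mxE.
transitivity (\sum_i \sum_j \sum_k \sum_l
    u 0 i * riemann g x i j k l * v 0 j * B l k).
  rewrite bformE; apply: eq_bigr => i _; apply: eq_bigr => j _.
  rewrite mxE mulr_sumr mulr_suml; apply: eq_bigr => k _.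
  by rewrite mulr_sumr mulr_suml; apply: eq_bigr => l _; ring.
under eq_bigr => i _ do rewrite exchange_big.
rewrite exchange_big; apply: eq_bigr => k _ /=.
under eq_bigr => i _ do rewrite exchange_big.
rewrite exchange_big; apply: eq_bigr => l _ /=.
rewrite [X in _ = X * _]mxE bformE mulr_suml; apply: eq_bigr => i _.
by rewrite mulr_suml; apply: eq_bigr => j _; rewrite [in RHS]mxE.
Qed.

End RiemannContraction.

Section WeylEinstein.
Variables (R : realType) (g : 'rV[R]_4 -> 'M[R]_4) (x : 'rV[R]_4) (c : R).
Hypotheses (gsym : (g x)^T = g x) (gu : g x \in unitmx)
  (ein : ricci g x = c *: g x).

(** With rho = c g and scalar curvature 4 c, the metric terms of the Weyl tensor carry the
    coefficient - c + 2 c / 3 = - c / 3. Their contraction with F is F_ij - F_ji = 2 F_ij, and the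
    factor 2 absorbs the 1/2 of the operator. *)
Lemma weyl_operator_einstein (F : 'M[R]_4) : F^T = - F ->
  weyl_operator g x F =
  2^-1 *: riemann_contraction g (raise2 (g x) F) x - (c / 3) *: F.
Proof.
move=> Fs; have sc : scalar_curvature g x = 4 * c.
  have -> : scalar_curvature g x = \tr (invmx (g x) *m (c *: (g x))^T).
    rewrite /scalar_curvature ein /mxtrace; apply: eq_bigr => i _.
    by rewrite [RHS]mxE; apply: eq_bigr => j _; rewrite [X in _ = _ * X]mxE.
  by rewrite linearZ /= gsym -scalemxAr mulVmx // mxtraceZ mxtrace1 mulrC.
have gE i j : g x i j = g x j i by rewrite -{1}gsym mxE.
have gB i j : \sum_k \sum_l g x j k * g x i l * raise2 (g x) F l k = F i j.
  have -> : F i j = (g x *m raise2 (g x) F *m (g x)^T) i j.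
    by rewrite /raise2 trmx_inv !gsym !mulmxA mulmxV // mul1mx mulmxKV.
  rewrite mxE; apply: eq_bigr => k _; rewrite mxE mulr_suml.
  by apply: eq_bigr => l _; rewrite [X in _ = _ * X]mxE; ring.
apply/matrixP => i j.
have FN : F j i = - F i j by have /matrixP/(_ i j) := Fs; rewrite !mxE.
rewrite [LHS]mxE.
transitivity (2^-1 * ((\sum_k \sum_l riemann g x i j k l * raise2 (g x) F l k)
  - c / 3 * (\sum_k \sum_l g x j k * g x i l * raise2 (g x) F l k)
  + c / 3 * (\sum_k \sum_l g x i k * g x j l * raise2 (g x) F l k))).
  congr (_ * _); rewrite !mulr_sumr -sumrB -big_split; apply: eq_bigr => k _ /=.
  rewrite !mulr_sumr -sumrB -big_split; apply: eq_bigr => l _ /=.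
  by rewrite /weyl sc ein !mxE; field.
rewrite (gB i j) (gB j i) FN.
have subE (M N : 'M[R]_4) a b : (a *: M - b *: N) i j = a * M i j - b * N i j.
  by rewrite !mxE.
by rewrite subE [X in _ = _ * X - _]mxE; field.
Qed.

End WeylEinstein.

Lemma rmorph_wedge (A B : pzRingType) (f : {rmorphism A -> B})
    (x1 x2 x3 x4 x5 x6 y1 y2 y3 y4 y5 y6 : A) :
  f (x1 * y1 - x2 * y2 + x3 * y3 + x4 * y4 - x5 * y5 + x6 * y6) =
  f x1 * f y1 - f x2 * f y2 + f x3 * f y3 + f x4 * f y4 - f x5 * f y5 + f x6 * f y6.
Proof. by rewrite !(rmorphB, rmorphD, rmorphM). Qed.

(** * Para-Hermitian 4-manifolds *)

Section ParaHermitianManifold.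
Variables (R : realType) (M : smooth_manifold R 4) (H : paraHermitian M).
Variable o : orientation M.
Hypothesis Fsd : fundamental_form_self_dual H o.
Local Notation g := (metric H).
Local Notation P := (para H).

Definition chart_set (i : chart_index M) : open_set R 4 :=
  OpenSet (@chart_img_open R 4 M i).

Lemma fundamental_formE i x : fundamental_form H i x = g i x *m (P i x)^T.
Proof.
apply/matrixP => a b; rewrite [LHS]mxE.
by rewrite -[RHS]bform_delta /bil /bform /basisv trmx_mul !mulmxA.
Qed.

Lemma fundamental_form_funE i :
  fundamental_form H i = (fun x => g i x *m (P i x)^T).
Proof. by apply/funext => x; exact: fundamental_formE. Qed.

Let PG i x : chart_img i x -> P i x *m g i x = - (g i x *m (P i x)^T).
Proof.
move=> Ux; apply/matrixP => a b.
have := para_compatible H (basisv R a) (basisv R b) Ux.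
rewrite /bil /basisv trmx_mul !mulmxA => h.
have e1 := bform_delta (P i x *m g i x) a b.
have e2 := bform_delta (g i x *m (P i x)^T) a b.
rewrite /bform !mulmxA in e1 e2.
by apply/eqP; rewrite [X in _ == X]mxE -addr_eq0 -e1 -e2; apply/eqP.
Qed.

Let nij i u v x : chart_img i x ->
  lie_bracket (fun y => u *m P i y) (fun y => v *m P i y) x
  + lie_bracket (fun=> u) (fun=> v) x
  - lie_bracket (fun y => u *m P i y) (fun=> v) x *m P i x
  - lie_bracket (fun=> u) (fun y => v *m P i y) x *m P i x = 0.
Proof.
have cs (w : 'rV[R]_4) : smooth_mx_on (chart_img i) (fun=> w).
  by move=> a b; exact: (@smooth_cst _ _ (chart_set i)).
move=> Ux; exact: (para_integrable H (cs u) (cs v) Ux).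
Qed.

Lemma ricci_anti_bform : ricci_anti_invariant H -> forall i x u v, chart_img i x ->
  bform (ricci (g i) x) (u *m P i x) (v *m P i x) = - bform (ricci (g i) x) u v.
Proof. by move=> ra i x u v Ux; exact: ra. Qed.

Lemma para_eigenframe i x : chart_img i x -> exists u1 u2 v1 v2 : 'rV[R]_4,
  [/\ [/\ u1 *m P i x = u1, u2 *m P i x = u2, v1 *m P i x = - v1
        & v2 *m P i x = - v2],
    bform (g i x) u1 v1 * bform (g i x) u2 v2
      - bform (g i x) u1 v2 * bform (g i x) u2 v1 != 0
  & forall z, exists a1 a2 b1 b2,
      z = a1 *: u1 + a2 *: u2 + (b1 *: v1 + b2 *: v2)].
Proof.
move=> Ux; apply: eigenframe.
- exact: metric_nondegenerate.
- exact: para_invol.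
- exact: PG.
- exact: para_rank_pos.
- exact: para_rank_neg.
Qed.

Section AntiInvariantRicci.
Hypothesis ra : ricci_anti_invariant H.
Variables (i : chart_index M) (x : 'rV[R]_4) (Ux : chart_img i x).

Let O := chart_set i.
Let gs : smooth_mx_on (open_dom O) (g i). Proof. exact: tensor02_smooth. Qed.
Let Ps : smooth_mx_on (open_dom O) (P i). Proof. exact: tensor11_smooth. Qed.

Let sym y : open_dom O y -> (g i y)^T = g i y := fun Oy => Defs.metric_sym H Oy.

(** A property proved for either sign is applied to both eigenbundles of one frame: for s = true the
    matrix is -P, which fixes the v's, and the pairs exchange roles. *)
Lemma eigenframe_null (Q : 'rV[R]_4 -> 'rV[R]_4 -> R) :
  (forall (s : bool) (u1 u2 v1 v2 : 'rV[R]_4),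
    u1 *m ((-1) ^+ s *: P i x) = u1 -> u2 *m ((-1) ^+ s *: P i x) = u2 ->
    v1 *m ((-1) ^+ s *: P i x) = - v1 -> v2 *m ((-1) ^+ s *: P i x) = - v2 ->
    bform (g i x) u1 v1 * bform (g i x) u2 v2
      - bform (g i x) u1 v2 * bform (g i x) u2 v1 != 0 -> Q u1 u2 = 0) ->
  exists u1 u2 v1 v2, [/\ Q u1 u2 = 0, Q v1 v2 = 0,
    [/\ u1 *m P i x = u1, u2 *m P i x = u2, v1 *m P i x = - v1 & v2 *m P i x = - v2]
  & forall z, exists a1 a2 b1 b2,
     z = a1 *: u1 + a2 *: u2 + (b1 *: v1 + b2 *: v2)].
Proof.
move=> hQ; have [u1 [u2 [v1 [v2 [eig det span]]]]] := para_eigenframe Ux.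
have [u1P u2P v1P v2P] := eig; exists u1, u2, v1, v2; split => //.
  by apply: (hQ false u1 u2 v1 v2) => //; rewrite expr0 scale1r.
apply: (hQ true v1 v2 u1 u2); rewrite ?expr1 ?scaleN1r ?mulmxN ?u1P ?u2P //.
- by rewrite v1P opprK.
- by rewrite v2P opprK.
have gC y z : bform (g i x) y z = bform (g i x) z y.
  rewrite /bform -[in LHS](trmxK (y *m g i x *m z^T)) [LHS]mxE.
  by rewrite !trmx_mul trmxK (Defs.metric_sym H Ux) mulmxA.
rewrite !(gC v1) !(gC v2); apply: contraNneq det => <-; apply/eqP.
by ring.
Qed.

Lemma d_lee_form_type (theta : one_form M) : is_lee_form H theta ->
  d_one_form (theta i) x + P i x *m d_one_form (theta i) x *m (P i x)^T = 0.
Proof.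
move=> lee; have ths : smooth_mx_on (open_dom O) (theta i) by exact: one_form_smooth.
have [s u1 u2 v1 v2 h1 h2 h3 h4 det|u1 [u2 [v1 [v2 [hu hv eig span]]]]] :=
  @eigenframe_null (bform (d_one_form (theta i) x)).
  apply: (d_lee_form_null_at (O := O) gs Ps sym (fun y Oy => metric_nondegenerate H Oy)
    (fun y Oy => para_invol H Oy) (@PG i) (@nij i) (ricci_anti_bform ra (i := i))
    Ux h1 h2 h3 h4 det ths).
  by move=> y a b c Oy; rewrite -fundamental_form_funE -fundamental_formE; exact: lee.
apply: null_on_eigenspaces hu hv eig span.
by apply/matrixP => a b; rewrite !mxE opprB.
Qed.

Lemma riemann_contraction_type :
  let B := (P i x)^T *m invmx (g i x) in
  riemann_contraction (g i) B x
  + P i x *m riemann_contraction (g i) B x *m (P i x)^T = 0.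
Proof.
move=> B.
have [s u1 u2 v1 v2 h1 h2 h3 h4 det|u1 [u2 [v1 [v2 [hu hv eig span]]]]] :=
  @eigenframe_null (bform (riemann_contraction (g i) B x)).
  rewrite bform_riemann_contraction.
  exact: (contraction_null (O := O) gs Ps sym (fun y Oy => metric_nondegenerate H Oy)
    (fun y Oy => para_invol H Oy) (@PG i) (@nij i) (ricci_anti_bform ra (i := i))
    Ux h1 h2 h3 h4 det).
apply: null_on_eigenspaces hu hv eig span.
exact: (riemann_contraction_skew (O := O) gs sym (fun y Oy => metric_nondegenerate H Oy)).
Qed.

End AntiInvariantRicci.

Lemma d_lee_form_wedge (theta : one_form M) i x : chart_img i x ->
  is_lee_form H theta ->
  dot (raise2 (g i x) (d_one_form (theta i) x)) (g i x *m (P i x)^T) = 0.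
Proof.
move=> Ux lee; pose O := chart_set i; have Ox : open_dom O x := Ux.
have gs : smooth_mx_on (open_dom O) (g i) by exact: tensor02_smooth.
have Ps : smooth_mx_on (open_dom O) (P i) by exact: tensor11_smooth.
have ths : smooth_mx_on (open_dom O) (theta i) by exact: one_form_smooth.
apply: (wedge_F_eq0 (Defs.metric_sym H Ux) (metric_nondegenerate H Ux)
  (para_invol H Ux) (PG Ux)).
  by apply/matrixP => a b; rewrite !mxE opprB.
pose F' := sf_mx gs *m (sf_mx Ps)^T; pose t := sf_mx ths.
have hF : represents (fun y => g i y *m (P i y)^T) F'.
  by move=> y Oy; rewrite map_mxM -map_trmx !sf_mxE.
have ht : represents (theta i) t := represents_sf_mx _.
have F'skew a b : F' b a = - F' a b.
  have /matrixP/(_ a b) : F'^T = - F'.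
    apply: sf_mxP => y Oy; rewrite -map_trmx map_mxN -(hF y Oy).
    exact: (F_skew (Defs.metric_sym H Oy) (PG Oy)).
  by rewrite [LHS]mxE [RHS]mxE.
have lee' a b c : sf_derivations O a (F' b c) + sf_derivations O b (F' c a)
    + sf_derivations O c (F' a b) = t a 0 * F' b c + t b 0 * F' c a + t c 0 * F' a b.
  apply: smooth_funP => y Oy.
  rewrite -[LHS]/(ev Oy _) -[RHS]/(ev Oy _) !(rmorphD, rmorphM) /=.
  rewrite -!(partial_represents _ _ _ Oy hF).
  have := lee i y Oy a b c; rewrite fundamental_form_funE /d_two_form /wedge12.
  by move=> ->; rewrite (hF y Oy) (ht y Oy) !mxE.
move=> a b c e.
have DE k l : ev Ox (sf_derivations O k (t l 0) - sf_derivations O l (t k 0)) =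
    d_one_form (theta i) x k l.
  rewrite [RHS]mxE (partial_represents k l 0 Ox ht) (partial_represents l k 0 Ox ht).
  exact: (rmorphB (ev Ox)).
have FE k l : ev Ox (F' k l) = (g i x *m (P i x)^T) k l.
  by rewrite (hF x Ox) [RHS]mxE.
have hD := dd_lee_form F'skew lee' a b c e.
rewrite -!DE -!FE -(rmorph0 (ev Ox)) -hD.
exact/esym/rmorph_wedge.
Qed.

Lemma d_self_dual_part_anti_invariant : ricci_anti_invariant H ->
  forall theta : one_form M, is_lee_form H theta -> d_self_dual_part_zero H o theta.
Proof.
move=> ra theta lee i x Ux.
have Fx := Fsd Ux; rewrite fundamental_formE in Fx.
rewrite (self_dual_part_para (Defs.metric_sym H Ux) (metric_nondegenerate H Ux)
  (para_invol H Ux) (PG Ux) Fx); last first.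
  by apply/matrixP => a b; rewrite !mxE opprB.
rewrite (d_lee_form_type ra Ux lee) (d_lee_form_wedge Ux lee).
by rewrite mulr0 scaler0 scale0r subr0.
Qed.

(** P is g-skew with square 1, hence an anti-isometry, so every multiple of g is anti-invariant. *)
Lemma einstein_anti_invariant : einstein H -> ricci_anti_invariant H.
Proof.
move=> [c ein] i x Ux u v; rewrite (ein i x Ux).
have PPx := para_invol H Ux.
have := para_compatible H (u *m P i x) v Ux.
rewrite -mulmxA PPx mulmx1 /bil -!scalemxAr -!scalemxAl !mxE => /eqP.
by rewrite addr_eq0 => /eqP ->; rewrite mulrN opprK.
Qed.

(** Inside the open image of one chart, the overlap is the preimage of the other domain under the
    continuous [chart_inv]. *)
Lemma overlap_open (i j : chart_index M) : open (overlap i j).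
Proof.
rewrite openE => x /= [p [pi pj] <-].
have Ui : chart_img i (chart i p) by exists p.
have ci := chart_inv_continuous Ui.
have nj : nbhs (chart_inv i (chart i p)) (chart_dom j).
  by rewrite chartK //; apply: open_nbhs_nbhs; split => //; exact: chart_dom_open.
have ni := open_nbhs_nbhs (conj (@chart_img_open R 4 M i) Ui).
apply: filterS2 ni (ci _ nj) => y [q qi <-]; rewrite /= chartK // => qj.
by exists q.
Qed.

(* The number - 1/8 R_abkl F^lk F^ab - c/3. *)
Definition eigenvalue_at (c : R) i x : R :=
  - 8^-1 * chern_contraction (g i) (P i) x - c / 3.

Lemma eigenvalue_at_invariant c i j x : overlap i j x ->
  eigenvalue_at c i x = eigenvalue_at c j (transition i j x).
Proof.
move=> Ox; congr (- 8^-1 * _ - _).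
have sub_img (k l : chart_index M) : overlap k l `<=` chart_img k.
  by move=> y [p [pk pl] <-]; exists p.
pose O1 := OpenSet (@overlap_open i j); pose O2 := OpenSet (@overlap_open j i).
have phiO y : open_dom O1 y -> open_dom O2 (transition i j y).
  move=> [p [pi pj] <-]; rewrite /transition chartK //; by exists p.
apply: (@chern_contraction_invariant R 4 O1 O2 (transition i j) phiO
  (@transition_smooth R 4 M i j)).
- exact: smooth_mx_on_sub (@sub_img i j) (@tensor02_smooth _ _ _ g i).
- exact: smooth_mx_on_sub (@sub_img i j) (@tensor11_smooth _ _ _ P i).
- exact: smooth_mx_on_sub (@sub_img j i) (@tensor02_smooth _ _ _ g j).
- exact: smooth_mx_on_sub (@sub_img j i) (@tensor11_smooth _ _ _ P j).
- by move=> y /sub_img; exact: Defs.metric_sym.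
- by move=> y /sub_img; exact: Defs.metric_sym.
- by move=> y /sub_img; exact: metric_nondegenerate.
- by move=> y /sub_img; exact: metric_nondegenerate.
- by move=> y; exact: tensor02_change.
- by move=> y; exact: tensor11_change.
- exact: Ox.
Qed.

(** F is self-dual, so only W(F) = R(F)/2 - (c/3) F has to be projected. The F-component - 1/4 [dot]
    of R(F)/2 gives the factor - 1/8, and that of - (c/3) F gives - c/3, as [dot_F] is - 4. *)
Lemma weyl_plus_einstein c i x : chart_img i x -> ricci (g i) x = c *: g i x ->
  ricci_anti_invariant H ->
  weyl_plus (g i) x (o i x) (fundamental_form H i x) =
  eigenvalue_at c i x *: fundamental_form H i x.
Proof.
move=> Ux ein ra; have gx := Defs.metric_sym H Ux; have ux := metric_nondegenerate H Ux.
have PPx := para_invol H Ux; have PGx := PG Ux.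
have Fx := Fsd Ux; rewrite fundamental_formE in Fx *.
set F := g i x *m (P i x)^T in Fx *.
have Fs : F^T = - F := F_skew gx PGx.
have B2 : raise2 (g i x) F = (P i x)^T *m invmx (g i x) := raise2_F (P i x) gx ux.
have sdF : self_dual_part (g i x) (o i x) F = F.
  rewrite /self_dual_part Fx scalerDr -scalerDl.
  by rewrite (_ : 2^-1 + 2^-1 = 1) ?scale1r //; field.
rewrite /weyl_plus sdF (weyl_operator_einstein gx ux ein Fs) B2.
set RF := riemann_contraction _ _ _.
have RFs : RF^T = - RF.
  by exact: (riemann_contraction_skew (O := chart_set i) (@tensor02_smooth _ _ _ g i)
    (fun y Oy => Defs.metric_sym H Oy) (fun y Oy => metric_nondegenerate H Oy)).
have RFt : RF + P i x *m RF *m (P i x)^T = 0 := riemann_contraction_type ra Ux.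
have PFP : P i x *m F *m (P i x)^T = - F.
  by rewrite /F mulmxA PGx !mulNmx -!mulmxA -trmx_mul PPx trmx1 mulmx1.
rewrite (self_dual_part_para gx ux PPx PGx Fx); last first.
  by rewrite linearB !linearZ /= RFs Fs !scalerN -opprD.
rewrite -/F mulmxBr mulmxBl -!scalemxAr -!scalemxAl PFP.
have -> : 2^-1 *: RF - (c / 3) *: F + (2^-1 *: (P i x *m RF *m (P i x)^T)
    - (c / 3) *: - F) = 2^-1 *: (RF + P i x *m RF *m (P i x)^T).
  by rewrite scalerN opprK addrACA addNr addr0 scalerDr.
rewrite RFt !scaler0 sub0r -scaleNr; congr (_ *: _).
rewrite (dot_raise2 gx) B2.
have dotB (k1 k2 : R) (N1 N2 B : 'M[R]_4) : dot (k1 *: N1 - k2 *: N2) B =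
    k1 * dot N1 B - k2 * dot N2 B.
  rewrite /dot !mulr_sumr -sumrB; apply: eq_bigr => a _.
  by rewrite !mulr_sumr -sumrB; apply: eq_bigr => b _; rewrite !mxE; ring.
rewrite dotB -B2 -(dot_raise2 gx F F) (dot_F gx ux PPx PGx) B2.
have -> : dot RF ((P i x)^T *m invmx (g i x)) = chern_contraction (g i) (P i) x.
  rewrite /dot /chern_contraction; apply: eq_bigr => a _; apply: eq_bigr => b _.
  by rewrite [X in X * _]mxE.
by rewrite /eigenvalue_at; field.
Qed.

Lemma weyl_plus_eigenform : einstein H -> fundamental_form_weyl_plus_eigenform H o.
Proof.
move=> ein; have ra := einstein_anti_invariant ein; have [c hc] := ein.
(* The eigenvalue at p is computed in one chosen chart around p; its invariance makes the choice
   immaterial. *)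
pose ch (p : M) := sval (cid (chart_dom_cover p)).
have chP (p : M) : chart_dom (ch p) p := svalP (cid (chart_dom_cover p)).
exists (fun p => eigenvalue_at c (ch p) (chart (ch p) p)) => i x Ux.
split.
  rewrite fundamental_formE.
  exact: (F_neq0 (Defs.metric_sym H Ux) (metric_nondegenerate H Ux) (para_invol H Ux)).
rewrite (weyl_plus_einstein Ux (hc i x Ux) ra); congr (_ *: _).
have [q qi qx] := Ux; rewrite -qx chartK //.
rewrite (@eigenvalue_at_invariant c i (ch q)); last by exists q.
by rewrite /transition chartK.
Qed.

End ParaHermitianManifold.

Theorem corollary1p2 (R : realType) (M : smooth_manifold R 4)
    (H : paraHermitian M) (o : orientation M)
    (Fsd : fundamental_form_self_dual H o) :
  (ricci_anti_invariant H ->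
     forall theta : one_form M, is_lee_form H theta ->
       d_self_dual_part_zero H o theta) /\
  (einstein H -> fundamental_form_weyl_plus_eigenform H o).
Proof.
split; first exact: d_self_dual_part_anti_invariant.
exact: weyl_plus_eigenform.
Qed.
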